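(* For each integer $k>2$ there exists a polynomial $p$ of degree $k$ such that the spectrum $\sigma(T_{\overline{z}+p})$ of the Bergman-space Toeplitz operator $T_{\overline{z}+p}$ has an isolated point, and hence is disconnected.
   Context: $\mathbb D$ is the open unit disk, $dA$ normalized area measure on $\mathbb D$, $L^2_a$ the Bergman space of analytic functions in $L^2(\mathbb D,dA)$, $P$ the orthogonal projection onto $L^2_a$, and $T_\varphi f=P(\varphi f)$ for $\varphi\in L^\infty(\mathbb D)$, $f\in L^2_a$. *)

(* Defs.v *)
From HB Require Import structures.
From mathcomp Require Import all_boot all_order all_algebra.
From mathcomp Require Import all_classical all_reals all_analysis.
From mathcomp.real_closed Require Import complex.
Import Order.TTheory GRing.Theory Num.Theory.
Import numFieldNormedType.Exports.
Local Open Scope ring_scope.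
Local Open Scope classical_set_scope.

Section Bergman.
Variable R : realType.
Local Notation C := (R[i]).

Definition cabs (z : C) : R := Num.sqrt (complex.Re z ^+ 2 + complex.Im z ^+ 2).

Definition lam2 := (@lebesgue_measure R \x @lebesgue_measure R)%E.

Definition toC (p : R * R) : C := (p.1 +i* p.2)%C.

Definition disk2 : set (R * R) := [set p | p.1 ^+ 2 + p.2 ^+ 2 < 1].

Definition dA_int (u : C -> R) : R := Rintegral lam2 disk2 (u \o toC) / pi.

Definition L2D (u : C -> C) : Prop :=
  measurable_fun disk2 (fun p => complex.Re (u (toC p))) /\
  measurable_fun disk2 (fun p => complex.Im (u (toC p))) /\
  lam2.-integrable disk2 (fun p => ((cabs (u (toC p))) ^+ 2)%:E).

Definition inner (u v : C -> C) : C :=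
  (dA_int (fun z => complex.Re (u z * conjc (v z)))
     +i* dA_int (fun z => complex.Im (u z * conjc (v z))))%C.

Definition normL2 (u : C -> C) : R :=
  Num.sqrt (dA_int (fun z => cabs (u z) ^+ 2)).

(* Bergman space: analytic (complex differentiable) functions on D lying in
   L^2(D, dA); as canonical representatives they are taken to vanish off D. *)
Definition L2a : set (C -> C) :=
  [set f | L2D f /\
           (forall z : C, cabs z < 1 -> derivable (f : C^o -> C^o) z 1) /\
           (forall z : C, 1 <= cabs z -> f z = 0)].

Definition bergman_proj (u : C -> C) : C -> C :=
  xget (fun _ => 0)
    [set g | L2a g /\ forall h, L2a h -> inner u h = inner g h].

Definition toeplitz (phi : C -> C) (f : C -> C) : C -> C :=
  bergman_proj (fun z => phi z * f z).

Definition invertible_op (A : (C -> C) -> (C -> C)) : Prop :=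
  exists B : (C -> C) -> (C -> C),
    (exists M : R, forall f, L2a f -> L2a (B f) /\ normL2 (B f) <= M * normL2 f) /\
    (forall f, L2a f -> B (A f) = f /\ A (B f) = f).

Definition toeplitz_spectrum (phi : C -> C) : set C :=
  [set lam | ~ invertible_op (fun f z => toeplitz phi f z - lam * f z)].

Definition isolated_point (S : set C) (lam : C) : Prop :=
  S lam /\ exists e : R, 0 < e /\ forall mu, S mu -> cabs (mu - lam) < e -> mu = lam.

End Bergman.

(* Main.v *)
Require Import Defs.
From HB Require Import structures.
From mathcomp Require Import all_boot all_order all_algebra.
From mathcomp Require Import all_classical all_reals all_analysis measurable_realfun.
From mathcomp.real_closed Require Import complex.
From mathcomp Require Import ring lra zify.
Import Order.TTheory GRing.Theory Num.Theory.
Import numFieldNormedType.Exports.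
Local Open Scope ring_scope.
Local Open Scope classical_set_scope.
Set Implicit Arguments.
Unset Strict Implicit.
Unset Printing Implicit Defensive.

(* On Taylor coefficients, T_(conj z + p) maps a to (n+1)/(n+2) a_(n+1) + (p a)_n. Writing
   c_n = a_n / (n+1) and q = 1 + z p - lam z, the equation (T - lam) f = g becomes the first
   order equation q (z c)' = c + z g, which is singular at the zeros of q in the disk. At a
   simple zero t, the formal quotients of c by the powers of z - t satisfy equations of the
   same kind in which 1 - j t q'(t) multiplies the value at t of the j-th one.

   The polynomial p is chosen so that, for lam = 0, q has exactly one zero t in the closed
   disk, with t q'(t) = 1/m for an integer m > 0. At this resonance (z - t)^m is not in the
   range of T, so 0 is in the spectrum. For small lam <> 0 the number 1/(t q'(t)) is no longer
   an integer; a solution of the homogeneous equation is then divisible by all powers of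
   z - t, hence zero, so T - lam is injective. As T - lam is a finite rank perturbation of an
   invertible operator on sequences, it is invertible. Thus 0 is isolated, while q(1), the
   value of the symbol at 1, is a nonzero point of the spectrum because slowly varying
   sequences are approximate eigenvectors.

   The Bergman space is identified with weighted sequences by Cauchy's formula (Goursat), the
   moments of disks (Green's formula and Fubini), Fatou's lemma, and exhaustion of the unit disk
   by smaller ones. *)

(** * Modulus and convergence of complex numbers *)

(** The isolated point is an effect of the Bergman weight. With 1 in place of (n+1)/(n+2), as on the
    Hardy space, T would send a to the backward shift of q a, and this map is invertible: the shift
    compensates exactly the single zero t of q. The correction - a_(n+1)/(n+2) is small for large n,
    so invertibility near 0 becomes a question of injectivity; but it also turns the kernel equation
    into a differential equation whose solutions behave like (z - t)^s at t, with s = 1/(t q'(t)).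
    An integer s is an obstruction. The exponent moves with lam: at a zero x of q - lam z it is
    1/P(x), where P = z q' - q is free of lam. As m P - 1 is a nonzero polynomial, a zero that
    leaves t also leaves the resonance. The other obstacle is the norm. Here t is close to 1, and t
    times the backward shift, whose squared norm on the Bergman weights is 2, is not a contraction.
    Invertibility is therefore proved for the equivalent weights 1/(n+K+1) with K large, where it is
    one. *)

Section Cabs.
Variable R : realType.
Implicit Types (z : R[i]) (x : R).
Local Notation C := R[i].
Local Notation cabs := (cabs R).

Lemma normr_cabs z : `|z| = (cabs z)%:C%C.
Proof. exact: normc_def. Qed.

Lemma cabs_ge0 z : 0 <= cabs z.
Proof. exact: sqrtr_ge0. Qed.

Lemma cabs2 z : cabs z ^+ 2 = complex.Re z ^+ 2 + complex.Im z ^+ 2.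
Proof. by rewrite sqr_sqrtr // addr_ge0 // sqr_ge0. Qed.

Lemma cabsM z z' : cabs (z * z') = cabs z * cabs z'.
Proof. by apply: complexI; rewrite rmorphM /= -!normr_cabs normrM. Qed.

Lemma cabs0 : cabs 0 = 0.
Proof. by apply: complexI; rewrite -normr_cabs normr0. Qed.

Lemma cabs1 : cabs 1 = 1.
Proof. by apply: complexI; rewrite -normr_cabs normr1. Qed.

Lemma cabsN z : cabs (- z) = cabs z.
Proof. by apply: complexI; rewrite -!normr_cabs normrN. Qed.

Lemma cabsB z z' : cabs (z - z') = cabs (z' - z).
Proof. by rewrite -cabsN opprB. Qed.

Lemma cabsD z z' : cabs (z + z') <= cabs z + cabs z'.
Proof. by rewrite -lecR rmorphD /= -!normr_cabs ler_normD. Qed.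

Lemma cabs_eq0 z : (cabs z == 0) = (z == 0).
Proof.
by rewrite -(inj_eq (@complexI R)) -normr_cabs normr_eq0.
Qed.

Lemma cabs_gt0 z : (0 < cabs z) = (z != 0).
Proof. by rewrite lt_neqAle cabs_ge0 andbT eq_sym cabs_eq0. Qed.

Lemma cabsX z n : cabs (z ^+ n) = cabs z ^+ n.
Proof. by apply: complexI; rewrite rmorphXn /= -!normr_cabs normrX. Qed.

Lemma cabsV z : cabs z^-1 = (cabs z)^-1.
Proof. by apply: complexI; rewrite fmorphV /= -!normr_cabs normfV. Qed.

Lemma cabs_real x : cabs x%:C%C = `|x|.
Proof. by rewrite /Defs.cabs /= expr0n addr0 sqrtr_sqr. Qed.

Lemma cabsJ z : cabs (conjc z) = cabs z.
Proof. by apply: complexI; rewrite -!normr_cabs normcJ. Qed.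

Lemma cabs_nat n : cabs n%:R = n%:R.
Proof. by apply: complexI; rewrite -normr_cabs normr_nat rmorph_nat. Qed.

Lemma cabs_Re z : `|complex.Re z| <= cabs z.
Proof. by rewrite -lecR -normr_cabs normc_ge_Re. Qed.

Lemma cabs_Im z : `|complex.Im z| <= cabs z.
Proof. by rewrite -sqrtr_sqr ler_wsqrtr // lerDr sqr_ge0. Qed.

Lemma cabs_le z : cabs z <= `|complex.Re z| + `|complex.Im z|.
Proof.
rewrite [leLHS](_ : _ = cabs ((complex.Re z)%:C%C + 'i%C * (complex.Im z)%:C%C)).
  apply: (le_trans (cabsD _ _)); rewrite cabsM !cabs_real.
  by rewrite /Defs.cabs /= expr0n expr1n add0r sqrtr1 mul1r.
by rewrite -complexE.
Qed.

Lemma cabs_sum (I : Type) (r : seq I) (P : pred I) (F : I -> C) :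
  cabs (\sum_(i <- r | P i) F i) <= \sum_(i <- r | P i) cabs (F i).
Proof.
apply: (big_ind2 (fun u v => cabs u <= v)) => // [|u u' v v' uu' vv'].
  by rewrite cabs0.
exact/(le_trans (cabsD _ _))/lerD.
Qed.

Lemma cabs_dist z z' : `|cabs z - cabs z'| <= cabs (z - z').
Proof.
rewrite ler_norml; apply/andP; split.
  by have := cabsD (z' - z) z; rewrite subrK (cabsB z'); lra.
by have := cabsD (z - z') z'; rewrite subrK; lra.
Qed.

Lemma cabsB_ge z z' : cabs z - cabs z' <= cabs (z - z').
Proof. exact: le_trans (ler_norm _) (cabs_dist _ _). Qed.

End Cabs.
Arguments cabs0 {R}.
Arguments cabs1 {R}.

(** * Convergence of complex sequences and geometric series *)

Section Ccvg.
Variable R : realType.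
Local Notation C := R[i].
Local Notation cabs := (cabs R).

(** Convergence is stated through the real modulus, so that only limits of real sequences are
    taken. *)
Definition ccvg (u : nat -> C) (l : C) := (fun k => cabs (u k - l)) @ \oo --> (0 : R).

Lemma ccvg_le u l (e : nat -> R) :
  (forall k, cabs (u k - l) <= e k) -> e @ \oo --> (0 : R) -> ccvg u l.
Proof.
move=> ue e0; apply: (@squeeze_cvgr _ _ _ _ (fun=> 0) e) => //; last exact: cvg_cst.
by near=> k; rewrite cabs_ge0 ue.
Unshelve. all: by end_near. Qed.

Lemma ccvg_cst l : ccvg (fun=> l) l.
Proof. by rewrite /ccvg subrr cabs0; exact: cvg_cst. Qed.

Lemma ccvgD u l v m : ccvg u l -> ccvg v m -> ccvg (fun k => u k + v k) (l + m).
Proof.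
move=> ul vm; apply: (@ccvg_le _ _ (fun k => cabs (u k - l) + cabs (v k - m))).
  by move=> k; rewrite opprD addrACA cabsD.
by rewrite -[X in _ --> X](addr0 (0:R)); exact: cvgD.
Qed.

Lemma ccvgZ c u l : ccvg u l -> ccvg (fun k => c * u k) (c * l).
Proof.
move=> ul; apply: (@ccvg_le _ _ (fun k => cabs c * cabs (u k - l))).
  by move=> k; rewrite -mulrBr cabsM.
by rewrite -[X in _ --> X](mulr0 (cabs c)); exact: cvgMr.
Qed.

Lemma ccvgN u l : ccvg u l -> ccvg (fun k => - u k) (- l).
Proof. by move=> /(ccvgZ (-1)); rewrite mulN1r; under eq_fun do rewrite mulN1r. Qed.

Lemma ccvg_cabs u l : ccvg u l -> (fun k => cabs (u k)) @ \oo --> cabs l.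
Proof.
move=> ul; rewrite -[X in _ --> X](add0r (cabs l)).
under eq_fun do rewrite -[cabs _](subrK (cabs l)).
apply: cvgD; last exact: cvg_cst.
apply/norm_cvg0P; apply: (@squeeze_cvgr _ _ _ _ (fun=> 0) (fun k => cabs (u k - l))) => //; last exact: cvg_cst.
by near=> k; rewrite normr_ge0 cabs_dist.
Unshelve. all: by end_near. Qed.

Lemma ccvg_unique u l m : ccvg u l -> ccvg u m -> l = m.
Proof.
move=> ul um; apply/eqP; rewrite -subr_eq0 -cabs_eq0.
have : ccvg (fun k => u k - u k) (m - l) by apply: ccvgD => //; apply: ccvgN.
under eq_fun do rewrite subrr; move=> /ccvg_cabs; rewrite cabs0 => /cvg_lim.
rewrite lim_cst // cabsB => <- //.
Qed.

Lemma le_geom (x y K th : R) : 0 <= th < 1 -> (forall k, x <= y + K * th ^+ k) ->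
  x <= y.
Proof.
move=> th01 xy.
have h : (fun k => y + K * th ^+ k) @ \oo --> y.
  rewrite -[X in _ --> X]addr0 -[X in _ + X](mulr0 K); apply: cvgD; first exact: cvg_cst.
  by apply: cvgMr; apply: cvg_expr; rewrite ger0_norm; lra.
rewrite -(cvg_lim _ h) //; apply: limr_ge; first by apply/cvg_ex; exists y.
by near=> k; exact: xy.
Unshelve. all: by end_near. Qed.

Lemma cvg_dist0 (v : nat -> R) (l : R) : v @ \oo --> l ->
  (fun n => `|v n - l|) @ \oo --> (0 : R).
Proof.
move=> vl; have -> : (0 : R) = `|l - l| by rewrite subrr normr0.
by apply: cvg_norm; apply: cvgB => //; exact: cvg_cst.
Qed.

(** With s the square root of th, n th^n = (n s^n) s^n, and n s^n stays below 1/(1 - s). *)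
Lemma nat_geom (th : R) : 0 <= th < 1 ->
  exists K s, [/\ 0 <= K, 0 <= s < 1 & forall n, n%:R * th ^+ n <= K * s ^+ n].
Proof.
move=> /andP[th0 th1]; set s := Num.sqrt th.
have s0 : 0 <= s by exact: sqrtr_ge0.
have s2 : s ^+ 2 = th by exact: sqr_sqrtr.
have s1 : s < 1 by rewrite -sqrtr1 ltr_sqrt.
exists (1 - s)^-1, s; split; rewrite ?s0 ?s1 //; first by rewrite invr_ge0; lra.
have h n : n%:R * (1 - s) * s ^+ n <= 1 - s ^+ n.
  elim: n => [|n IH]; first by rewrite expr0; lra.
  have sn0 : 0 <= s ^+ n by exact: exprn_ge0.
  have sn1 : s ^+ n <= 1 by apply: exprn_ile1 => //; lra.
  rewrite exprS -natr1; have := ler_wpM2l s0 IH.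
  have : (1 - s) * (s * s ^+ n) <= 1 - s by rewrite ler_piMr //; nra.
  lra.
move=> n; rewrite -s2 -exprM mulnC muln2 -addnn exprD mulrA ler_wpM2r ?exprn_ge0 //.
rewrite -[leRHS]mul1r ler_pdivlMr ?subr_gt0 //; apply: (@le_trans _ _ (1 - s ^+ n)).
  by rewrite mulrAC.
by rewrite gerBl exprn_ge0.
Qed.

(** Completeness is used on real and imaginary parts separately; the explicit tail bound then comes
    from letting the upper end of a finite block tend to infinity. *)
Lemma geom_series (u : nat -> C) (K th : R) : 0 <= th < 1 ->
  (forall i, cabs (u i) <= K * th ^+ i) ->
  exists l, forall n, cabs (l - \sum_(i < n) u i) <= K / (1 - th) * th ^+ n.
Proof.
move=> th01 uK.
have K0 : 0 <= K by have := uK 0%N; rewrite expr0 mulr1; apply: le_trans (cabs_ge0 _).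
have part n m : cabs (\sum_(i < n + m) u i - \sum_(i < n) u i) <= K / (1 - th) * th ^+ n.
  rewrite big_split_ord /= addrAC subrr add0r; apply: (le_trans (cabs_sum _ _ _)).
  apply: (@le_trans _ _ (\sum_(i < m) K * th ^+ n * th ^+ i)).
    by apply: ler_sum => i _; rewrite -mulrA -exprD.
  rewrite -mulr_sumr -[leRHS]mulrA [_ ^-1 * _]mulrC [leRHS]mulrA.
  apply: ler_wpM2l; first by rewrite mulr_ge0 // exprn_ge0 //; lra.
  rewrite -[leLHS](mulKf (_ : 1 - th != 0)); last by apply/eqP; lra.
  rewrite ler_piMr ?invr_ge0; [lra| |].
    lra.
  rewrite -opprB mulNr -subrX1; rewrite opprB.
  by rewrite gerBl exprn_ge0 //; lra.
have rcvg (v : nat -> R) : (forall i, `|v i| <= cabs (u i)) ->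
    exists l : R, (fun n => \sum_(i < n) v i) @ \oo --> l.
  move=> vu; have /cvg_ex[l hl] : cvgn (series v).
    apply: normed_cvg; apply: (@series_le_cvg _ _ (geometric K th)) => //.
    - by move=> n /=; exact: normr_ge0.
    - by move=> n /=; apply: mulr_ge0 => //; apply: exprn_ge0; lra.
    - by move=> n; exact: le_trans (vu n) (uK n).
    - by apply: is_cvg_geometric_series; rewrite ger0_norm; lra.
  exists l; rewrite (_ : (fun n => _) = series v) //.
  by apply/funext => n; rewrite seriesEord.
have [lr hr] := rcvg _ (fun i => cabs_Re (u i)).
have [li hi] := rcvg _ (fun i => cabs_Im (u i)).
have raddRe n : complex.Re (\sum_(i < n) u i) = \sum_(i < n) complex.Re (u i).
  by elim/big_rec2 : _ => // i a b _ <-; case: (u i) b => ? ? [].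
have raddIm n : complex.Im (\sum_(i < n) u i) = \sum_(i < n) complex.Im (u i).
  by elim/big_rec2 : _ => // i a b _ <-; case: (u i) b => ? ? [].
have hl : ccvg (fun n => \sum_(i < n) u i) (lr +i* li)%C.
  apply: (@ccvg_le _ _ (fun n => `|\sum_(i < n) complex.Re (u i) - lr| +
                                 `|\sum_(i < n) complex.Im (u i) - li|)).
    move=> n; apply: (le_trans (cabs_le _)); rewrite -raddRe -raddIm.
    by case: (\sum_(i < n) u i).
  rewrite -[X in _ --> X]addr0; apply: cvgD.
    exact: cvg_dist0.
  exact: cvg_dist0.
exists (lr +i* li)%C => n; rewrite cabsB.
have hn : ccvg (fun m => \sum_(i < n + m) u i - \sum_(i < n) u i)
   ((lr +i* li)%C - \sum_(i < n) u i).
  apply: ccvgD; last exact: ccvg_cst.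
  have := hl; rewrite /ccvg => /(cvg_comp (addn n)); apply.
  exact: cvg_addnl.
have hn' := ccvg_cabs hn.
rewrite cabsB -(cvg_lim _ hn') //; apply: limr_le; first by apply/cvg_ex; eexists; exact: hn'.
by near=> m; exact: part.
Unshelve. all: by end_near. Qed.

End Ccvg.

(** * Operators on weighted sequence spaces *)

Section WeightedSpace.
Variable R : realType.
Local Notation C := R[i].
Local Notation cabs := (cabs R).
Implicit Types (w : nat -> R) (a b : nat -> C) (L E : (nat -> C) -> nat -> C).

(* The weighted l2 norm of [a] is at most [M]; partial sums avoid infinite series. *)
Definition nb w a (M : R) :=
  0 < M /\ forall N, \sum_(n < N) w n * cabs (a n) ^+ 2 <= M ^+ 2.

Definition lin L := forall c a b,
  L (fun n => c * a n + b n) = (fun n => c * L a n + L b n).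

Definition opb w L c := forall a M, nb w a M -> nb w (L a) (c * M).

Lemma nb_gt0 w a M : nb w a M -> 0 < M. Proof. by case. Qed.

Lemma nb_le w a M M' : nb w a M -> M <= M' -> nb w a M'.
Proof.
move=> [M0 h] MM'; split; first exact: lt_le_trans MM'.
by move=> N; apply: (le_trans (h N)); rewrite ler_sqr ?nnegrE ?(ltW M0) // (le_trans (ltW M0)).
Qed.

Lemma nb_zero w M : 0 < M -> nb w (fun=> 0) M.
Proof.
move=> M0; split=> // N; rewrite big1 ?sqr_ge0 // => i _.
by rewrite cabs0 expr0n mulr0.
Qed.

(** The difference of the two sides is a square. Summed over sequences of norms at most M and M',
    the right-hand side becomes (M + M')^2, which is Minkowski's inequality without square roots. *)
Lemma minkowski_weight (x y M M' : R) : 0 < M -> 0 < M' ->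
  (x + y) ^+ 2 <= (1 + M' / M) * x ^+ 2 + (1 + M / M') * y ^+ 2.
Proof.
move=> M0 M'0; rewrite -subr_ge0.
rewrite [leRHS](_ : _ = (M' * x - M * y) ^+ 2 / (M * M')).
  by rewrite divr_ge0 ?sqr_ge0 // mulr_ge0 // ltW.
by field; rewrite !gt_eqF.
Qed.

Section Weight.
Variable w : nat -> R.
Hypothesis w0 : forall n, 0 < w n.

Lemma nbD a b M M' : nb w a M -> nb w b M' -> nb w (fun n => a n + b n) (M + M').
Proof.
move=> [M0 ha] [M'0 hb]; split; first exact: addr_gt0.
move=> N; apply: (@le_trans _ _ (\sum_(n < N) ((1 + M' / M) * (w n * cabs (a n) ^+ 2)
    + (1 + M / M') * (w n * cabs (b n) ^+ 2)))).
  apply: ler_sum => n _; rewrite !(mulrCA _ (w n)) -mulrDr ler_pM2l //.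
  apply: le_trans (minkowski_weight _ _ M0 M'0).
  by rewrite ler_sqr ?nnegrE ?addr_ge0 ?cabs_ge0 // cabsD.
rewrite big_split /= -!mulr_sumr.
apply: (@le_trans _ _ ((1 + M' / M) * M ^+ 2 + (1 + M / M') * M' ^+ 2)).
  apply: lerD; (apply: ler_wpM2l; last by [exact: ha|exact: hb]);
    by apply: addr_ge0 => //; apply: divr_ge0; apply: ltW.
by rewrite le_eqVlt; apply/orP; left; apply/eqP; field; rewrite !gt_eqF.
Qed.

Lemma nbZ c a M K : nb w a M -> 0 < K -> cabs c <= K ->
  nb w (fun n => c * a n) (K * M).
Proof.
move=> [M0 ha] K0 cK; split; first exact: mulr_gt0.
move=> N; rewrite exprMn; apply: (@le_trans _ _ (cabs c ^+ 2 * M ^+ 2)).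
  apply: le_trans (ler_wpM2l (sqr_ge0 _) (ha N)); rewrite mulr_sumr.
  by apply: ler_sum => n _; rewrite cabsM exprMn mulrCA.
by rewrite ler_wpM2r ?sqr_ge0 // ler_sqr ?nnegrE ?cabs_ge0 // ltW.
Qed.

Lemma nbN a M : nb w a M -> nb w (fun n => - a n) M.
Proof.
move=> [M0 h]; split=> // N; apply: le_trans (h N).
by apply: ler_sum => i _; rewrite cabsN.
Qed.

Lemma nbB a b M M' : nb w a M -> nb w b M' -> nb w (fun n => a n - b n) (M + M').
Proof. by move=> ha hb; apply: nbD => //; exact: nbN. Qed.

Lemma nb_coord a M n : nb w a M -> cabs (a n) <= M / Num.sqrt (w n).
Proof.
move=> [M0 h]; have s0 : 0 < Num.sqrt (w n) by rewrite sqrtr_gt0.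
rewrite ler_pdivlMr // -ler_sqr ?nnegrE ?mulr_ge0 ?cabs_ge0 ?(ltW M0) ?(ltW s0) //.
rewrite exprMn (sqr_sqrtr (ltW (w0 n))) mulrC; apply: le_trans (h n.+1).
rewrite big_ord_recr /= lerDr; apply: sumr_ge0 => i _.
by rewrite mulr_ge0 ?sqr_ge0 // ltW.
Qed.

(** The bounds in [nb] are strictly positive, so the zero sequence is recognised by bounds that tend
    to 0. *)
Lemma nb_geom0 a K th : 0 <= th < 1 -> (forall k, exists2 M, M <= K * th ^+ k & nb w a M) ->
  a = fun=> 0.
Proof.
move=> th01 h; apply/funext => n; apply/eqP; rewrite -cabs_eq0 eq_le cabs_ge0 andbT.
apply: (@le_geom _ _ _ (K / Num.sqrt (w n)) th) => // k.
have [M MK /(nb_coord n) hM] := h k.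
by rewrite add0r mulrAC; apply: (le_trans hM); rewrite ler_wpM2r // invr_ge0 sqrtr_ge0.
Qed.

(** Each finite partial sum passes to a coordinatewise limit. Closed balls are thus closed under
    such limits, which takes the place of completeness of the space. *)
Lemma nb_lim (s : nat -> nat -> C) b M : (forall k, nb w (s k) M) ->
  (forall n, ccvg (fun k => s k n) (b n)) -> nb w b M.
Proof.
move=> hs sb; have M0 := nb_gt0 (hs 0%N); split => // N.
have h : (fun k => \sum_(n < N) w n * cabs (s k n) ^+ 2) @ \oo -->
         \sum_(n < N) w n * cabs (b n) ^+ 2.
  elim: N => [|N IH].
    by rewrite big_ord0; under eq_fun do rewrite big_ord0; exact: cvg_cst.
  rewrite big_ord_recr /=; under eq_fun do rewrite big_ord_recr /=.
  by apply: cvgD => //; apply: cvgMr; under eq_fun do rewrite expr2;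
    rewrite expr2; apply: cvgM; exact: ccvg_cabs.
rewrite -(cvg_lim _ h) //; apply: limr_le; first by apply/cvg_ex; eexists; exact: h.
by near=> k; have [_] := hs k; apply.
Unshelve. all: by end_near. Qed.

End Weight.

Section Linear.

Lemma lin0 L : lin L -> L (fun=> 0) = fun=> 0.
Proof.
move=> lL; have := lL (-1) (fun=> 0) (fun=> 0).
under eq_fun do rewrite mulr0 addr0.
by move=> {1}->; apply/funext => n; rewrite mulN1r addNr.
Qed.

Lemma linZ L c a : lin L -> L (fun n => c * a n) = fun n => c * L a n.
Proof.
move=> lL; have := lL c a (fun=> 0); rewrite lin0 //.
by under eq_fun do rewrite addr0; move=> ->; apply/funext => n; rewrite addr0.
Qed.

Lemma linD L a b : lin L -> L (fun n => a n + b n) = fun n => L a n + L b n.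
Proof.
move=> lL; have := lL 1 a b; under eq_fun do rewrite mul1r.
by move=> ->; apply/funext => n; rewrite mul1r.
Qed.

Lemma linN L a : lin L -> L (fun n => - a n) = fun n => - L a n.
Proof.
move=> lL; have := linZ (-1) a lL; under eq_fun do rewrite mulN1r.
by move=> ->; apply/funext => n; rewrite mulN1r.
Qed.

Lemma linB L a b : lin L -> L (fun n => a n - b n) = fun n => L a n - L b n.
Proof. by move=> lL; rewrite linD // linN. Qed.

Lemma lin_sum L m (x : 'I_m -> C) (b : 'I_m -> nat -> C) : lin L ->
  L (fun n => \sum_j x j * b j n) = fun n => \sum_j x j * L (b j) n.
Proof.
move=> lL; elim: m x b => [|m IH] x b.
  under eq_fun do rewrite big_ord0; rewrite lin0 //.
  by apply/funext => n; rewrite big_ord0.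
under eq_fun do rewrite big_ord_recl; rewrite lL IH.
by apply/funext => n; rewrite big_ord_recl.
Qed.

Lemma lin_comp L E : lin L -> lin E -> lin (fun a => L (E a)).
Proof. by move=> lL lE c a b; rewrite lE lL. Qed.

Lemma lin_sub L E : lin L -> lin E -> lin (fun a n => L a n - E a n).
Proof. by move=> lL lE c a b; apply/funext => n; rewrite lE lL; ring. Qed.

Lemma lin_scale k L : lin L -> lin (fun a n => k * L a n).
Proof. by move=> lL c a b; apply/funext => n; rewrite lL; ring. Qed.

End Linear.

(** * Bounded bijections, Neumann series and finite rank perturbations *)

Section Bij.
Variable w : nat -> R.
Hypothesis w0 : forall n, 0 < w n.
Local Notation nb := (nb w).

(** [L] acts on all sequences, but bijectivity is asked only on those of finite norm; [c] bounds the
    inverse there. *)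
Definition bij_bound L (c : R) :=
  [/\ lin L, exists l, 0 < l /\ opb w L l, 0 < c,
      forall a M, nb a M -> L a = (fun=> 0) -> a = (fun=> 0) &
      forall a M, nb a M -> exists b, nb b (c * M) /\ L b = a].

Lemma bij_bound_inj L c a b M M' : bij_bound L c -> nb a M -> nb b M' -> L a = L b -> a = b.
Proof.
move=> [lL _ _ iL _] ha hb Lab; have h := nbB w0 ha hb.
have : (fun n => a n - b n) = (fun=> 0).
  by apply: (iL _ _ h); rewrite linB // Lab; apply/funext => n; rewrite subrr.
by move=> ab; apply/funext => n; apply/eqP; rewrite -subr_eq0; have := congr1 (@^~ n) ab => /= ->.
Qed.

Lemma bij_inverse L c : bij_bound L c ->
  exists G, forall a M, nb a M -> nb (G a) (c * M) /\ L (G a) = a.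
Proof.
move=> bL; have [lL _ c0 iL sL] := bL.
have h a : exists b, (exists M, nb a M) -> (exists M, nb b M) /\ L b = a.
  (* A sequence of infinite norm receives itself as a dummy value. *)
  have [[M ha]|na] := pselect (exists M, nb a M); last by exists a.
  by have [b [hb Lb]] := sL _ _ ha; exists b => _; split => //; eexists; exact: hb.
have [G hG] := choice h; exists G => a M ha.
have [[M' h1] h2] := hG a (ex_intro _ M ha); split=> //.
have [b [hb Lb]] := sL _ _ ha.
by rewrite (bij_bound_inj bL h1 hb) ?Lb.
Qed.

Lemma bij_bound_id : bij_bound (fun a => a) 1.
Proof.
split => //; first by exists 1; split=> // a M; rewrite mul1r.
by move=> a M ha; exists a; rewrite mul1r.
Qed.

Lemma bij_bound_comp L L' c c' : bij_bound L c -> bij_bound L' c' ->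
  bij_bound (fun a => L (L' a)) (c' * c).
Proof.
move=> [lL [l [l0 oL]] c0 iL sL] [lL' [l' [l'0 oL']] c'0 iL' sL']; split.
- exact: lin_comp.
- exists (l * l'); split; first exact: mulr_gt0.
  by move=> a M ha; rewrite -mulrA; apply: oL; exact: oL'.
- exact: mulr_gt0.
- by move=> a M ha /(iL _ _ (oL' _ _ ha)); exact: iL' ha.
- move=> a M ha; have [b [hb Lb]] := sL _ _ ha; have [d [hd Ld]] := sL' _ _ hb.
  by exists d; rewrite -mulrA Ld Lb.
Qed.

Lemma bij_bound_scale k L c : k != 0 -> bij_bound L c ->
  bij_bound (fun a n => k * L a n) ((cabs k)^-1 * c).
Proof.
move=> k0 [lL [l [l0 oL]] c0 iL sL]; have k0' : 0 < cabs k by rewrite cabs_gt0.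
split.
- exact: lin_scale.
- exists (cabs k * l); split; first exact: mulr_gt0.
  by move=> a M ha; rewrite -mulrA; apply: nbZ => //; exact: oL.
- by rewrite mulr_gt0 ?invr_gt0.
- move=> a M ha h; apply: (iL _ _ ha); apply/funext => n.
  by have := congr1 (@^~ n) h => /= /eqP; rewrite mulf_eq0 (negbTE k0) => /eqP.
- move=> a M ha; have [|b [hb Lb]] := sL (fun n => k^-1 * a n) ((cabs k)^-1 * M).
    by apply: nbZ => //; rewrite ?invr_gt0 // cabsV.
  exists b; split; first by rewrite -mulrA mulrCA.
  by apply/funext => n; rewrite Lb mulVKf.
Qed.

(** Neumann series: with [G] the inverse of [L], a preimage of a is the sum of the (G E)^i (G a),
    whose norms decay like (c e)^i. A kernel element is fixed by G E, so its norm is at most M (c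
    e)^k for every k. *)
Lemma bij_perturb L E c e : bij_bound L c -> lin E -> 0 < e -> opb w E e -> c * e < 1 ->
  exists c', bij_bound (fun a n => L a n - E a n) c'.
Proof.
move=> bL lE e0 oE ce1; have [lL [l [l0 oL]] c0 iL _] := bL.
have [G hG] := bij_inverse bL; set th := c * e.
have th0 : 0 < th by rewrite mulr_gt0.
have th01 : 0 <= th < 1 by rewrite ltW.
have oGE a M : nb a M -> nb (G (E a)) (th * M).
  by move=> ha; rewrite -mulrA; apply: (hG _ _ _).1; exact: oE.
have LGE a M : nb a M -> L (G (E a)) = E a.
  by move=> ha; apply: (hG _ _ (oE _ _ ha)).2.
exists (c / (1 - th)); split.
- exact: lin_sub.
- exists (l + e); split; first exact: addr_gt0.
  by move=> a M ha; rewrite mulrDl; apply: nbB => //; [exact: oL|exact: oE].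
- by rewrite divr_gt0 // subr_gt0.
- move=> a M ha h; have hLE : L a = E a.
    by apply/funext => n; apply/eqP; rewrite -subr_eq0; have := congr1 (@^~ n) h => /= ->.
  have aG : a = G (E a) by apply: (bij_bound_inj bL ha (oGE _ _ ha)); rewrite (LGE _ _ ha).
  apply: (@nb_geom0 _ w0 _ M th) => // k; exists (M * th ^+ k) => //.
  elim: k => [|k IH]; first by rewrite expr0 mulr1.
  by rewrite exprS mulrCA aG; exact: oGE.
move=> a M ha; have M0 := nb_gt0 ha.
pose b i := iter i (G \o E) (G a).
have hb i : nb (b i) (c * M * th ^+ i).
  elim: i => [|i IH]; first by rewrite expr0 mulr1; exact: (hG _ _ ha).1.
  by rewrite exprS mulrCA; exact: oGE.
have LbS i : L (b i.+1) = E (b i) by exact: LGE (hb i).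
pose s k n := \sum_(i < k) b i n.
(* Positivity of m keeps the bound positive, as [nb] requires; writing it as an exact geometric sum
   makes the induction close. *)
have hs m k : 0 < (m : nat)%:R :> R -> nb (fun n => s (k + m)%N n - s k n) (c * M / (1 - th) * th ^+ k * (1 - th ^+ m)).
  move=> m0; have [{m0}] : (0 < m)%N by rewrite ltr0n in m0.
  elim: m => // -[_ _|m /(_ isT) IH _].
    rewrite addn1 expr1 mulrAC divfK; last by apply/eqP; lra.
    by rewrite (_ : (fun n => _) = b k) //; apply/funext => n; rewrite /s big_ord_recr /= addrAC subrr add0r.
  rewrite (_ : (fun n => _) = (fun n => (s (k + m.+1)%N n - s k n) + b (k + m.+1)%N n)).
    rewrite (_ : _ * (1 - th ^+ m.+2) = c * M / (1 - th) * th ^+ k * (1 - th ^+ m.+1) + c * M * th ^+ (k + m.+1)).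
      exact: nbD.
    by rewrite exprD (exprS _ m.+1); field; rewrite gt_eqF // subr_gt0.
  by apply/funext => n; rewrite addnS /s big_ord_recr /= addrAC.
have hs' m k : exists2 M', M' <= c * M / (1 - th) * th ^+ k & nb (fun n => s (k + m.+1)%N n - s k n) M'.
  exists (c * M / (1 - th) * th ^+ k * (1 - th ^+ m.+1)); last by apply: hs; rewrite ltr0n.
  rewrite ler_piMr //; last by rewrite gerBl exprn_ge0 // ltW.
  by rewrite !mulr_ge0 ?exprn_ge0 ?invr_ge0 ?subr_ge0 // ltW.
have geo n : exists l, forall k, cabs (l - s k n) <= c * M / Num.sqrt (w n) / (1 - th) * th ^+ k.
  apply: (@geom_series _ (fun i => b i n) (c * M / Num.sqrt (w n)) th) => // i.
  by rewrite mulrAC; exact: (nb_coord w0 n (hb i)).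
have [bb hbb] := choice geo.
have ccv n k : ccvg (fun m => s (k + m.+1)%N n - s k n) (bb n - s k n).
  apply: (@ccvg_le _ _ _ (fun m => c * M / Num.sqrt (w n) / (1 - th) * th ^+ k * th * th ^+ m)).
    move=> m; rewrite opprB addrA subrK cabsB; apply: (le_trans (hbb _ _)).
    by rewrite exprD exprS !mulrA.
  rewrite -[X in _ --> X](mulr0 (c * M / Num.sqrt (w n) / (1 - th) * th ^+ k * th)).
  by apply: cvgMr; apply: cvg_expr; rewrite ger0_norm ?(ltW th0).
have hr k : nb (fun n => bb n - s k n) (c * M / (1 - th) * th ^+ k).
  apply: (@nb_lim _ (fun m n => s (k + m.+1)%N n - s k n)); last exact: (fun n => ccv n k).
  move=> m.
  by have [M' M'l h] := hs' m k; exact: nb_le h _.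
exists bb; split.
  have := hr 0%N; rewrite expr0 mulr1 mulrAC.
  by under eq_fun do rewrite /s big_ord0 subr0.
(* The partial sums telescope because L b_(i+1) = E b_i. *)
have LEs k : (fun n => L (s k) n - E (s k) n) = fun n => a n - L (b k) n.
  elim: k => [|k IH].
    have s0 : s 0%N = fun=> 0 by apply/funext => n; rewrite /s big_ord0.
    by rewrite s0 !lin0 // (hG _ _ ha).2; apply/funext => n; rewrite !subrr.
  have sS : s k.+1 = fun n => s k n + b k n by apply/funext => n; rewrite /s big_ord_recr.
  rewrite sS !linD // LbS; apply/funext => n.
  by have := congr1 (@^~ n) IH => /= h; rewrite opprD addrACA h; ring.
apply/funext => n; apply/eqP; rewrite -subr_eq0; apply/eqP.
suff : (fun n => L bb n - E bb n - a n) = fun=> 0 by move/(congr1 (@^~ n)).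
apply: (@nb_geom0 _ w0 _ ((l + e) * (c * M / (1 - th)) + l * (c * M)) th) => // k.
exists (l * (c * M / (1 - th) * th ^+ k) + e * (c * M / (1 - th) * th ^+ k) + l * (c * M * th ^+ k)).
  by rewrite le_eqVlt; apply/orP; left; apply/eqP; ring.
(* Splitting the residual at stage k leaves three terms, all of order th^k. *)
have -> : (fun n => L bb n - E bb n - a n) =
   (fun n => (L (fun n => bb n - s k n) n - E (fun n => bb n - s k n) n) - L (b k) n).
  rewrite !linB //; apply/funext => j.
  by have := congr1 (@^~ j) (LEs k) => /= h; rewrite -[L (b k) j](subKr (a j)) -h; ring.
by apply: nbB => //; [apply: nbB => //; [exact: oL|exact: oE]|exact: oL].
Qed.

Lemma nb_delta i : nb (fun n => (n == i)%:R) (1 + w i).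
Proof.
have wi : 0 < 1 + w i by apply: addr_gt0.
split=> // N; apply: (@le_trans _ _ (w i)); last first.
  by have := w0 i; rewrite expr2; nra.
elim: N => [|N IH]; first by rewrite big_ord0 ltW.
have [iN|iN] := ltnP i N.
  by rewrite big_ord_recr /= gtn_eqF // cabs0 expr0n mulr0 addr0.
rewrite big_ord_recr /= big1 ?add0r.
  by case: eqP => [->|_]; rewrite ?cabs1 ?expr1n ?mulr1 // cabs0 expr0n mulr0 ltW.
move=> j _; rewrite ltn_eqF ?cabs0 ?expr0n ?mulr0 //.
exact: leq_trans (ltn_ord j) iN.
Qed.

Lemma nbD_sum (I : Type) (r : seq I) b (F : I -> nat -> C) M (K : I -> R) :
  nb b M -> (forall i, nb (F i) (K i)) ->
  nb (fun n => b n + \sum_(i <- r) F i n) (M + \sum_(i <- r) K i).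
Proof.
move=> hb hF; elim: r => [|i r IH].
  by rewrite big_nil addr0; under eq_fun do rewrite big_nil addr0.
rewrite big_cons addrCA; under eq_fun do rewrite big_cons addrCA.
exact: nbD.
Qed.

(** Fredholm alternative: the values of [Phi] live in the first N coordinates, so solvability
    reduces to an N by N system, and injectivity of L - Phi makes its matrix invertible. *)
Lemma bij_finite_rank L c Phi N : bij_bound L c -> lin Phi ->
  (exists e, 0 < e /\ opb w Phi e) -> (forall a n, (N <= n)%N -> Phi a n = 0) ->
  (forall a M, nb a M -> (fun n => L a n - Phi a n) = (fun=> 0) -> a = fun=> 0) ->
  exists c', bij_bound (fun a n => L a n - Phi a n) c'.
Proof.
move=> bL lP [e [e0 oP]] PN inj; have [lL [l [l0 oL]] c0 iL _] := bL.
have [G hG] := bij_inverse bL.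
pose delta i : nat -> C := fun n => (n == i)%:R.
pose b (i : 'I_N) := G (delta i).
have hb i : nb (b i) (c * (1 + w i)) by exact: (hG _ _ (nb_delta i)).1.
have Lb i : L (b i) = delta i by exact: (hG _ _ (nb_delta i)).2.
(* Row j holds the coordinates of (L - Phi) (b j), so coefficient rows multiply from the left. *)
pose A : 'M[C]_N := \matrix_(j, i) ((i == j)%:R - Phi (b j) i).
have lLP : lin (fun a n => L a n - Phi a n) by exact: lin_sub.
have deltaN i n : (N <= n)%N -> delta (i : 'I_N) n = 0.
  by move=> Nn; rewrite /delta gtn_eqF // (leq_trans (ltn_ord i)).
have LPsum (x : 'rV[C]_N) n :
    L (fun n => \sum_j x 0 j * b j n) n - Phi (fun n => \sum_j x 0 j * b j n) n =
    if insub n is Some i then (x *m A) 0 i else 0.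
  rewrite !lin_sum // -sumrB; case: insubP => [i _ <-|]; last first.
    by rewrite -leqNgt => Nn; apply: big1 => j _; rewrite Lb PN // deltaN // mulr0 subrr.
  by rewrite mxE; apply: eq_bigr => j _; rewrite mxE Lb -mulrBr.
have Au : A \in unitmx.
  rewrite -row_free_unit; apply: inj_row_free => x xA.
  have nbx : exists M, nb (fun n => \sum_j x 0 j * b j n) M.
    exists (1 + \sum_j ((cabs (x 0 j) + 1) * (c * (1 + w j)))).
    rewrite (_ : (fun n => _) = (fun n => 0 + \sum_j x 0 j * b j n)).
      apply: nbD_sum; first exact: nb_zero.
      by move=> j; apply: nbZ => //; rewrite ?lerDl //; apply: ltr_wpDl => //; exact: cabs_ge0.
    by apply/funext => n; rewrite add0r.
  have [M hM] := nbx.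
  have z : (fun n => \sum_j x 0 j * b j n) = fun=> 0.
    apply: (inj _ _ hM); apply/funext => n; rewrite LPsum xA.
    by case: insub => // i; rewrite mxE.
  have := congr1 L z; rewrite lin_sum // lin0 // => h.
  apply/rowP => i; rewrite mxE; have := congr1 (@^~ (i : nat)) h => /=.
  rewrite (bigD1 i) //= big1 ?addr0 => [|j ji]; rewrite Lb /delta ?eqxx ?mulr1 //.
  by rewrite eq_sym val_eqE (negbTE ji) mulr0.
pose K (j : 'I_N) := (\sum_(i < N) e * c / Num.sqrt (w i) * cabs (invmx A i j)) + 1.
have K0 j : 0 < K j.
  apply: ltr_wpDl => //; apply: sumr_ge0 => i _.
  by rewrite !mulr_ge0 ?cabs_ge0 ?invr_ge0 ?sqrtr_ge0 // ltW.
exists (c + \sum_j K j * (c * (1 + w j))); split => //.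
- exists (l + e); split; first exact: addr_gt0.
  by move=> a M ha; rewrite mulrDl; apply: nbB => //; [exact: oL|exact: oP].
- apply: ltr_wpDr => //; apply: sumr_ge0 => j _.
  by rewrite ltW // !mulr_gt0 // addr_gt0.
move=> a M ha; have M0 := nb_gt0 ha; have [hGa LGa] := hG _ _ ha.
(* [y] is the error a - (L - Phi) (G a); the combination of the b j with coefficients y A^-1 removes
   it. *)
pose y : 'rV[C]_N := \row_i Phi (G a) i.
pose x := y *m invmx A.
exists (fun n => G a n + \sum_j x 0 j * b j n); split.
  rewrite mulrDl mulr_suml; apply: nbD_sum => // j; rewrite mulrAC.
  apply: nbZ => //; first exact: mulr_gt0.
  rewrite mxE; apply: (le_trans (cabs_sum _ _ _)).
  rewrite mulrDl mulr_suml; apply: ler_wpDr; first by rewrite mul1r ltW.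
  apply: ler_sum => i _; rewrite cabsM mulrAC ler_wpM2r ?cabs_ge0 //.
  have := nb_coord w0 i (oP _ _ hGa).
  by rewrite mxE (_ : e * (c * M) / _ = e * c / Num.sqrt (w i) * M) // mulrA -!mulrA (mulrC M).
rewrite (linD (G a)) // linD //; apply/funext => n.
rewrite opprD addrACA LPsum LGa -mulmxA mulVmx // mulmx1.
case: insubP => [i _ <-|]; first by rewrite mxE subrK.
by rewrite -leqNgt => Nn; rewrite PN // subr0 addr0.
Qed.

End Bij.
End WeightedSpace.

(** * Power series and polynomials as sequences *)

Section PolyAction.
Variable R : realType.
Local Notation C := R[i].
Local Notation cabs := (cabs R).
Implicit Types (p q : {poly C}) (a b c y g : nat -> C).

Definition mulp p a : nat -> C := fun n => \sum_(i < n.+1) p`_i * a (n - i)%N.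

(** Truncating the series beyond degree n leaves this coefficient unchanged, so associativity is
    inherited from polynomials. *)
Lemma mulp_coef p a N n : (n < N)%N -> mulp p a n = (p * \poly_(i < N) a i)`_n.
Proof.
move=> nN; rewrite coefM; apply: eq_bigr => i _.
by rewrite coef_poly (leq_ltn_trans (leq_subr _ _) nN).
Qed.

Lemma mulpM p q a : mulp (p * q) a = mulp p (mulp q a).
Proof.
apply/funext => n; rewrite (mulp_coef _ _ (ltnSn n)) -mulrA coefM.
apply: eq_bigr => i _; rewrite (mulp_coef q _ (N := n.+1)) //.
by rewrite ltnS leq_subr.
Qed.

Lemma mulpDl p q a : mulp (p + q) a = fun n => mulp p a n + mulp q a n.
Proof.
apply/funext => n; rewrite -big_split; apply: eq_bigr => i _.
by rewrite coefD mulrDl.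
Qed.

Lemma mulpZl k p a : mulp (k *: p) a = fun n => k * mulp p a n.
Proof.
apply/funext => n; rewrite mulr_sumr; apply: eq_bigr => i _.
by rewrite coefZ mulrA.
Qed.

Lemma mulpNl p a : mulp (- p) a = fun n => - mulp p a n.
Proof.
apply/funext => n; rewrite -sumrN; apply: eq_bigr => i _.
by rewrite coefN mulNr.
Qed.

Lemma mulpBl p q a : mulp (p - q) a = fun n => mulp p a n - mulp q a n.
Proof. by rewrite mulpDl mulpNl. Qed.

Lemma lin_mulp p : lin (mulp p).
Proof.
move=> k a b; apply/funext => n; rewrite mulr_sumr -big_split /=.
by apply: eq_bigr => i _; rewrite mulrDr mulrCA.
Qed.

Lemma mulpXn k a : mulp 'X^k a = fun n => if (n < k)%N then 0 else a (n - k)%N.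
Proof.
apply/funext => n; rewrite (mulp_coef _ _ (ltnSn n)) coefXnM; case: ltnP => // kn.
by rewrite coef_poly ltnS leq_subr.
Qed.

Lemma mulpX a : mulp 'X a = fun n => if n is m.+1 then a m else 0.
Proof. by rewrite -['X]expr1 mulpXn; apply/funext => -[|n] //=; rewrite subn1. Qed.

Lemma mulpC k a : mulp k%:P a = fun n => k * a n.
Proof.
by rewrite -[k%:P]mulr1 mul_polyC -(expr0 'X) mulpZl mulpXn; apply/funext => n; rewrite subn0.
Qed.

Lemma mulp1 a : mulp 1 a = a.
Proof. by rewrite mulpC; apply/funext => n; rewrite mul1r. Qed.

Lemma mulpXsub z a : mulp ('X - z%:P) a =
  fun n => (if n is m.+1 then a m else 0) - z * a n.
Proof. by rewrite mulpBl mulpX mulpC. Qed.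

Lemma mulp_poly p q : mulp p (fun n => q`_n) = fun n => (p * q)`_n.
Proof. by apply/funext => n; rewrite coefM. Qed.

Lemma mulp0 p : mulp p (fun=> 0) = fun=> 0.
Proof. by rewrite lin0 //; exact: lin_mulp. Qed.

(** If a has finite Bergman norm, the c_n = a_n/(n+1) are bounded, and [deriv1] turns boundedness
    into linear growth. These two classes carry the analysis at a point of the disk. *)
Definition bds a := exists M : R, forall n, cabs (a n) <= M.
Definition lgr a := exists M : R, forall n, cabs (a n) <= M * n.+1%:R.

Lemma mulp_bound p a (e : nat -> R) : (forall n m, (n <= m)%N -> 0 <= e n <= e m) ->
  (forall n, cabs (a n) <= e n) ->
  forall n, cabs (mulp p a n) <= (\sum_(i < size p) cabs p`_i) * e n.
Proof.
move=> e_mono ae n; apply: (le_trans (cabs_sum _ _ _)).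
have en m : 0 <= e m by have /andP[] := e_mono _ _ (leqnn m).
apply: (@le_trans _ _ (\sum_(i < n.+1) cabs p`_i * e n)).
  apply: ler_sum => i _; rewrite cabsM ler_wpM2l ?cabs_ge0 //.
  by apply: (le_trans (ae _)); have /andP[] := e_mono _ _ (leq_subr i n).
rewrite -mulr_suml ler_wpM2r //.
have [pn|pn] := leqP (size p) n.+1.
  rewrite -(subnKC pn) big_split_ord /= [X in _ + X]big1 ?addr0 //.
  by move=> i _; rewrite nth_default ?leq_addr // cabs0.
rewrite -(subnKC (ltnW pn)) big_split_ord /= lerDl sumr_ge0 // => i _.
exact: cabs_ge0.
Qed.

Lemma bds_mulp p a : bds a -> bds (mulp p a).
Proof.
move=> [M aM]; exists ((\sum_(i < size p) cabs p`_i) * M).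
apply: (mulp_bound _ (e := fun=> M)) => // n m _; rewrite lexx andbT.
exact: le_trans (cabs_ge0 _) (aM 0%N).
Qed.

Lemma lgr_mulp p a : lgr a -> lgr (mulp p a).
Proof.
move=> [M aM]; exists ((\sum_(i < size p) cabs p`_i) * M).
have M0 : 0 <= M by have := aM 0%N; rewrite mulr1; apply: le_trans; exact: cabs_ge0.
move=> n; rewrite -mulrA; apply: (mulp_bound _ (e := fun n => M * n.+1%:R)) => // {}n m nm.
by rewrite mulr_ge0 // ler_wpM2l // ler_nat.
Qed.

Lemma lgrD a b : lgr a -> lgr b -> lgr (fun n => a n + b n).
Proof.
move=> [M aM] [M' bM']; exists (M + M') => n; rewrite mulrDl.
by apply: (le_trans (cabsD _ _)); apply: lerD.
Qed.

Lemma bds_lgr a : bds a -> lgr a.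
Proof.
move=> [M aM]; exists M => n; apply: (le_trans (aM n)).
by rewrite ler_peMr ?(le_trans (cabs_ge0 _) (aM 0%N)) // ler1n.
Qed.

(** Coefficients of the derivative of z a(z), the operation that occurs in the equation for c. *)
Definition deriv1 a : nat -> C := fun n => n.+1%:R * a n.

Lemma lgr_deriv1 a : bds a -> lgr (deriv1 a).
Proof.
move=> [M aM]; exists M => n; rewrite cabsM cabs_nat mulrC ler_wpM2r //.
Qed.

Lemma deriv1_mulp z a : deriv1 (mulp ('X - z%:P) a) =
  fun n => mulp ('X - z%:P) (deriv1 a) n + mulp 'X a n.
Proof.
rewrite !mulpXsub mulpX /deriv1; apply/funext => -[|n]; first by ring.
by rewrite -(natr1 n.+1) -(natr1 n); ring.
Qed.

(** * Division of power series by X - z *)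

Section Division.
Variable z : C.
Hypothesis z0 : z != 0.

Definition psum a : nat -> C := fun n => \sum_(i < n.+1) a i * z ^+ i.

(* Formal division of a power series by [X - z]; it preserves boundedness only when the
   series vanishes at [z]. *)
Definition divX a : nat -> C := fun n => - z ^- n.+1 * psum a n.

Lemma divXK a : mulp ('X - z%:P) (divX a) = a.
Proof.
apply/funext => n; rewrite mulpXsub /divX /psum; case: n => [|n].
  by rewrite big_ord1 expr0 mulr1 expr1; field.
rewrite [in X in _ - X](big_ord_recr n.+1) /= [z ^+ n.+2]exprS.
have : z ^+ n.+1 != 0 by rewrite expf_neq0.
set S := \sum_(_ < _) _; set zn := z ^+ n.+1 => zn0.
by field; rewrite zn0.
Qed.

Lemma mulpX_psum a n : psum (mulp ('X - z%:P) a) n = - z ^+ n.+1 * a n.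
Proof.
rewrite /psum; elim: n => [|n IH]; first by rewrite big_ord1 mulpXsub; ring.
rewrite big_ord_recr IH mulpXsub /= [z ^+ n.+2]exprS.
by set zn := z ^+ n.+1; ring.
Qed.

Lemma divX_mulp a : divX (mulp ('X - z%:P) a) = a.
Proof.
apply/funext => n; rewrite /divX mulpX_psum.
by field; rewrite expf_neq0.
Qed.

Lemma mulpX_inj a b : mulp ('X - z%:P) a = mulp ('X - z%:P) b -> a = b.
Proof. by move=> /(congr1 divX); rewrite !divX_mulp. Qed.

Hypothesis z1 : cabs z < 1.

(** The value at z of a multiple of X - z: the partial sums telescope to - z^(n+1) a_n, and linear
    growth loses against |z|^n. *)
Lemma lgr_psum a : lgr a -> ccvg (psum (mulp ('X - z%:P) a)) 0.
Proof.
move=> [M aM]; apply: (@ccvg_le _ _ _ (fun n => M * (n.+1%:R * cabs z ^+ n.+1))).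
  move=> n; rewrite subr0 mulpX_psum cabsM cabsN cabsX mulrA mulrC.
  by rewrite ler_wpM2r ?exprn_ge0 ?cabs_ge0.
rewrite -[X in _ --> X](mulr0 M); apply: cvgMr.
have [|K [s [K0 /andP[s0 s1] h]]] := @nat_geom R (cabs z); first by rewrite cabs_ge0.
apply: (@squeeze_cvgr _ _ _ _ (fun=> 0) (fun n => K * s * s ^+ n)) => /=.
- near=> n; rewrite -mulrA -exprS h andbT.
  by rewrite mulr_ge0 ?exprn_ge0 ?cabs_ge0.
- exact: cvg_cst.
- rewrite -[X in _ --> X](mulr0 (K * s)); apply: cvgMr.
  by apply: cvg_expr; rewrite ger0_norm.
Unshelve. all: by end_near. Qed.

(** If the series vanishes at z, its partial sum is minus its tail and hence O(|z|^(n+1)), which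
    compensates the factor z^-(n+1) of [divX]. *)
Lemma divX_bds a : bds a -> ccvg (psum a) 0 -> bds (divX a).
Proof.
move=> [M aM] a0; have M0 : 0 <= M := le_trans (cabs_ge0 _) (aM 0%N).
exists (M / (1 - cabs z)) => n.
have zn0 : 0 < cabs z ^+ n.+1 by rewrite exprn_gt0 // cabs_gt0.
rewrite cabsM cabsN cabsV cabsX mulrC ler_pdivrMr //.
have th01 : 0 <= cabs z < 1 by rewrite cabs_ge0.
have uM i : cabs (a i * z ^+ i) <= M * cabs z ^+ i.
  by rewrite cabsM cabsX ler_wpM2r // exprn_ge0 // cabs_ge0.
have [l hl] := geom_series th01 uM.
suff l0 : l = 0 by have := hl n.+1; rewrite l0 sub0r cabsN.
apply: (ccvg_unique (u := psum a)) => //.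
apply: (@ccvg_le _ _ _ (fun n => M / (1 - cabs z) * cabs z * cabs z ^+ n)).
  by move=> k; rewrite cabsB -mulrA -exprS; exact: hl.
rewrite -[X in _ --> X](mulr0 (M / (1 - cabs z) * cabs z)).
by apply: cvgMr; apply: cvg_expr; rewrite ger0_norm ?cabs_ge0.
Qed.

End Division.
End PolyAction.

(** * The differential equation near its singular point *)

Section RegularSingularPoint.
Variable R : realType.
Local Notation C := R[i].
Local Notation cabs := (cabs R).
Implicit Types (a b c y g : nat -> C).

Lemma bdsZ k a : bds a -> bds (fun n => k * a n).
Proof.
move=> [M aM]; exists (cabs k * M) => n.
by rewrite cabsM ler_wpM2l // cabs_ge0.
Qed.

Lemma bds_poly (p : {poly C}) : bds (fun n => p`_n).
Proof.
rewrite (_ : (fun n => _) = mulp p (fun n => (1 : {poly C})`_n)).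
  apply: bds_mulp; exists 1 => n; rewrite coef1; case: eqP => _.
    by rewrite cabs1.
  by rewrite cabs0.
by rewrite mulp_poly mulr1.
Qed.

Variable z : C.
Hypotheses (z0 : z != 0) (z1 : cabs z < 1).
Local Notation psum := (psum z).
Local Notation divX := (divX z).

Lemma divX_head a : divX a 0%N = - z^-1 * a 0%N.
Proof. by rewrite /divX /psum big_ord1 expr0 mulr1 expr1. Qed.

Lemma psumD a b n : psum (fun n => a n + b n) n = psum a n + psum b n.
Proof. by rewrite /psum -big_split; apply: eq_bigr => i _; rewrite mulrDl. Qed.

Lemma psumZ k a n : psum (fun n => k * a n) n = k * psum a n.
Proof. by rewrite /psum mulr_sumr; apply: eq_bigr => i _; rewrite mulrA. Qed.

Lemma ccvg_psum_bounded a k : k != 0 -> ccvg (psum (fun n => k * a n)) 0 -> ccvg (psum a) 0.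
Proof.
move=> k0 /(ccvgZ k^-1); rewrite mulr0; congr (ccvg _ _).
by apply/funext => n; rewrite psumZ mulKf.
Qed.

Section ODE.
Variable qt : {poly C}.
Let q := ('X - z%:P) * qt.
Let sigma := z * qt.[z].

(* [zode j c g] encodes q (zc)' + j z qt c = c + z g: this is what
   q (zc)' = c + z g becomes after dividing c and g by (X - z)^j. *)
Definition zode (j : nat) c g := forall n,
  mulp q (deriv1 c) n + j%:R * mulp ('X * qt) c n = c n + mulp 'X g n.

(** With c = (X - z) c', the Leibniz rule contributes the additional term q X c' = (X - z) X qt c',
    which accounts for the increment of j; the common factor X - z is then cancelled. *)
Lemma zode_divX j c g : zode j c g -> zode j.+1 (divX c) (divX g).
Proof.
set c' := divX c; set g' := divX g => h.
have hc : c = mulp ('X - z%:P) c' by rewrite divXK.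
have hg : g = mulp ('X - z%:P) g' by rewrite divXK.
suff hf : (fun n => mulp q (deriv1 c') n + j.+1%:R * mulp ('X * qt) c' n) =
          (fun n => c' n + mulp 'X g' n) by move=> n; exact: (congr1 (@^~ n) hf).
apply: (mulpX_inj z0).
rewrite [LHS]linD ?[RHS]linD; try exact: lin_mulp.
rewrite linZ; last exact: lin_mulp.
rewrite -!mulpM; apply/funext => n.
have := h n; rewrite hc hg deriv1_mulp (linD (mulp _ _)); last exact: lin_mulp.
rewrite -!mulpM.
rewrite (_ : q * ('X - z%:P) = ('X - z%:P) * q); last by ring.
rewrite (_ : q * 'X = ('X - z%:P) * ('X * qt)); last by rewrite /q; ring.
rewrite (_ : 'X * qt * ('X - z%:P) = ('X - z%:P) * ('X * qt)); last by ring.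
rewrite (_ : 'X * ('X - z%:P) = ('X - z%:P) * 'X); last by ring.
by move=> <-; rewrite -natr1; ring.
Qed.

(** Evaluation of the equation at z, where q vanishes and X qt takes the value sigma. The remainder
    is a multiple of X - z by a series of linear growth, so [lgr_psum] applies. *)
Lemma zode_psum j c g : zode j c g -> bds c ->
  ccvg (psum (fun n => (1 - j%:R * sigma) * c n + mulp 'X g n)) 0.
Proof.
move=> h bc.
have : root ('X * qt - sigma%:P) z by rewrite rootE !hornerE subrr.
move=> /factor_theorem[s hs].
rewrite (_ : (fun n => _) = mulp ('X - z%:P) (fun n => mulp qt (deriv1 c) n + j%:R * mulp s c n)).
  apply: lgr_psum => //; apply: lgrD; first exact/lgr_mulp/lgr_deriv1.
  exact/bds_lgr/bdsZ/bds_mulp.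
rewrite linD ?linZ; try exact: lin_mulp.
rewrite -!mulpM [_ * s]mulrC -hs mulpBl mulpC -/q; apply/funext => n.
by rewrite mulrBl mul1r addrAC -(h n); ring.
Qed.

Lemma iter_zode j c g : zode 0 c g -> zode j (iter j divX c) (iter j divX g).
Proof. by move=> h; elim: j => // j; rewrite !iterS; exact: zode_divX. Qed.

(* If z has order of vanishing m >= 1 forced by the residue 1/sigma = m, then the
   right-hand side (X - z)^m is obstructed. *)
Lemma zode_resonance m c : (0 < m)%N -> m%:R * sigma = 1 -> bds c ->
  ~ zode 0 c (fun n => (('X - z%:P) ^+ m)`_n).
Proof.
move=> m0 ms bc h.
set g := fun n => _ in h.
have hg j : (j <= m)%N -> iter j divX g = fun n => (('X - z%:P) ^+ (m - j))`_n.
  elim: j => [|j IH] jm; first by rewrite subn0.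
  rewrite iterS (IH (ltnW jm)) -[RHS](divX_mulp z0); congr divX.
  by rewrite mulp_poly -exprS subnSK.
(* While j < m, the factor 1 - j sigma is nonzero and (X - z)^(m - j) still vanishes at z, so the
   current quotient of c vanishes there and can be divided once more. *)
have cj j : (j <= m)%N -> bds (iter j divX c).
  elim: j => [//|j IH] jm; rewrite iterS.
  have bj := IH (ltnW jm).
  apply: divX_bds => //.
  apply: (@ccvg_psum_bounded _ (1 - j%:R * sigma)).
    apply/eqP => /eqP; rewrite subr_eq0 -{1}ms => /eqP e.
    have s0 : sigma != 0 by apply: contra_eq_neq ms => ->; rewrite mulr0 eq_sym oner_eq0.
    by have := mulIf s0 e => /eqP; rewrite eqr_nat gtn_eqF.
  have h1 := zode_psum (iter_zode j h) bj.
  have h2 : ccvg (psum (mulp 'X (iter j divX g))) 0.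
    rewrite (hg _ (ltnW jm)) mulp_poly -(subnSK jm) exprS mulrCA -mulp_poly.
    by apply: lgr_psum => //; apply/bds_lgr/bds_poly.
  have := ccvgD h1 (ccvgZ (-1) h2); rewrite mulr0 addr0; congr (ccvg _ _).
  by apply/funext => n; rewrite psumD mulN1r addrK.
(* After m divisions the factor in front of c is 0 and g has become 1, so evaluation at z yields z =
   0. *)
have := zode_psum (iter_zode m h) (cj _ (leqnn _)).
rewrite ms hg // subnn expr0 mulp_poly mulr1.
move=> h0; apply/negP: z0; rewrite negbK; apply/eqP.
apply: ccvg_unique h0.
apply: (@ccvg_le _ _ _ (fun n => if n is 0%N then cabs z else 0)).
  move=> [|n]; rewrite /psum.
    by rewrite big_ord1 subrr mul0r add0r coefX mul0r sub0r cabsN.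
  rewrite (bigD1 (Ordinal (isT : 1 < n.+2)%N)) //= big1.
    by rewrite subrr mul0r add0r coefX mul1r expr1 addr0 subrr cabs0.
  move=> i; rewrite -val_eqE /= => i1.
  by rewrite subrr mul0r add0r coefX (negbTE i1) mul0r.
apply/cvgrPdist_le => e e0; near=> n; rewrite sub0r normrN.
have : (0 < n)%N by near: n; exists 1%N.
by case: (n) => // ? _; rewrite normr0 ltW.
Unshelve. all: by end_near. Qed.

End ODE.

Section Blaschke.

(** Coefficient form of |rho - conj(z) X / rho| = |X - z| on the circle |X| = rho; cutting the sums
    at n leaves one boundary term. *)
Lemma blaschke_sum (rho : R) y n : 0 < rho ->
  let B := rho%:C%C%:P - (conjc z / rho%:C%C) *: 'X in
  \sum_(i < n.+1) rho ^+ (2 * i) * cabs (mulp B y i) ^+ 2 =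
  \sum_(i < n.+1) rho ^+ (2 * i) * cabs (mulp ('X - z%:P) y i) ^+ 2 +
  (rho ^+ 2 - cabs z ^+ 2) * rho ^+ (2 * n) * cabs (y n) ^+ 2.
Proof.
move=> r0 B.
have hB : mulp B y = fun n => rho%:C%C * y n - conjc z / rho%:C%C * (if n is m.+1 then y m else 0).
  by rewrite mulpBl mulpC mulpZl mulpX.
have rne : rho != 0 by rewrite gt_eqF.
have cdiv (u : C) : u / rho%:C%C = (complex.Re u / rho +i* (complex.Im u / rho))%C.
  apply/eqP; rewrite eq_complex -fmorphV /=.
  by case: u => a b /=; rewrite !mulr0 subr0 add0r !eqxx.
elim: n => [|n IH].
  rewrite !big_ord1 hB mulpXsub !mulr0 muln0 expr0 subr0 sub0r cabsN !cabsM cabs_real.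
  by rewrite gtr0_norm //; ring.
rewrite big_ord_recr IH [in RHS]big_ord_recr /= hB mulpXsub cdiv.
rewrite !cabs2 mulnS exprD.
case: (z) => z_r z_i; case: (y n) => u1 u2; case: (y n.+1) => v1 v2 /=.
by set s := rho ^+ (2 * n); field.
Qed.

(* Dividing by the Blaschke factor of z on the circle of radius rho preserves the
   l2 norm and multiplies the constant term by rho / |z| > 1. *)
Lemma infinite_divX c : (forall j, bds (iter j divX c)) -> c 0%N = 0.
Proof.
move=> bj; pose rho := (1 + cabs z) / 2.
have zr : cabs z < rho by rewrite /rho; move: (cabs z) z1 => ? ?; lra.
have r1 : rho < 1 by rewrite /rho; move: (cabs z) z1 => ? ?; lra.
have r0 : 0 < rho by apply: le_lt_trans zr; exact: cabs_ge0.
pose B := rho%:C%C%:P - (conjc z / rho%:C%C) *: 'X.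
pose w n := rho ^+ (2 * n).
pose d j := mulp (B ^+ j) (iter j divX c).
have [M hM] := bj 0%N.
have M0 : 0 <= M by apply: le_trans (cabs_ge0 _) (hM 0%N).
(* The boundary term at index N + k is at most rho^(2k) Y^2 and disappears as k grows. *)
have ddec j N K : (forall N, \sum_(i < N) w i * cabs (d j i) ^+ 2 <= K) ->
    \sum_(i < N) w i * cabs (d j.+1 i) ^+ 2 <= K.
  move=> hK.
  pose y := mulp (B ^+ j) (iter j.+1 divX c).
  have [Y hY] : bds y by apply: bds_mulp.
  have dj : d j = mulp ('X - z%:P) y.
    by rewrite /d /y -mulpM mulrC mulpM /= divXK.
  have dj1 : d j.+1 = mulp B y by rewrite /d /y -mulpM exprS.
  apply: (@le_geom _ _ _ (Y ^+ 2) (rho ^+ 2)).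
    by rewrite exprn_ge0 ?(ltW r0) // exprn_ilt1 // ltW.
  move=> k.
  apply: (@le_trans _ _ (\sum_(i < (N + k).+1) w i * cabs (d j.+1 i) ^+ 2)).
    rewrite -addnS big_split_ord /= lerDl sumr_ge0 // => i _.
    by rewrite mulr_ge0 ?sqr_ge0 // exprn_ge0 // ltW.
  rewrite dj1 /w blaschke_sum //; apply: lerD.
    by have := hK (N + k).+1; rewrite dj.
  apply: (@le_trans _ _ (1 * rho ^+ (2 * k) * Y ^+ 2)).
    apply: ler_pM.
    - rewrite mulr_ge0 ?exprn_ge0 ?(ltW r0) // subr_ge0.
      by rewrite ler_sqr ?nnegrE ?cabs_ge0 ?(ltW r0) // ltW.
    - exact: sqr_ge0.
    - apply: ler_pM; rewrite ?exprn_ge0 ?(ltW r0) //.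
      + by rewrite subr_ge0 ler_sqr ?nnegrE ?cabs_ge0 ?(ltW r0) // ltW.
      + have : rho ^+ 2 < 1 by rewrite exprn_ilt1 // ltW.
        by have := sqr_ge0 (cabs z); lra.
      + by rewrite mulnDr exprD ler_piMl ?exprn_ge0 ?(ltW r0) // exprn_ile1 ?(ltW r0) // ltW.
    - by rewrite ler_sqr ?nnegrE ?cabs_ge0 // (le_trans (cabs_ge0 _) (hY 0%N)).
  by rewrite mul1r mulrC exprM.
pose K := M ^+ 2 / (1 - rho ^+ 2).
have r2 : 0 <= rho ^+ 2 < 1 by rewrite exprn_ge0 ?(ltW r0) // exprn_ilt1 // ltW.
have hK j N : \sum_(i < N) w i * cabs (d j i) ^+ 2 <= K.
  elim: j N => [|j IH] N; last exact: ddec.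
  apply: (@le_trans _ _ (\sum_(i < N) M ^+ 2 * (rho ^+ 2) ^+ i)).
    apply: ler_sum => i _; rewrite /w exprM mulrC ler_wpM2r //.
      by rewrite exprn_ge0 //; lra.
    rewrite /d expr0 mulp1 ler_sqr ?nnegrE ?cabs_ge0 //; exact: hM.
  rewrite -mulr_sumr ler_wpM2l ?sqr_ge0 //.
  rewrite -[leRHS]mul1r ler_pdivlMr; last by lra.
  rewrite mulrC -opprB mulNr -subrX1 opprB.
  by rewrite gerBl exprn_ge0 //; lra.
have iter0 j : iter j divX c 0%N = (- z^-1) ^+ j * c 0%N.
  elim: j => [|j IH]; first by rewrite expr0 mul1r.
  by rewrite iterS divX_head IH exprS mulrA.
have d0 j : d j 0%N = (rho%:C%C * - z^-1) ^+ j * c 0%N.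
  rewrite /d /mulp big_ord1 subnn iter0 mulrA exprMn; congr (_ * _ * _).
  rewrite -horner_coef0 horner_exp; congr (_ ^+ _).
  by rewrite /B !(hornerE, mulr0, subr0).
apply/eqP/negPn/negP => c0.
have z0' : 0 < cabs z by rewrite cabs_gt0.
have c0' : 0 < cabs (c 0%N) ^+ 2 by rewrite exprn_gt0 // cabs_gt0.
have K0 : 0 <= K by rewrite /K divr_ge0 ?sqr_ge0 //; lra.
suff : cabs (c 0%N) ^+ 2 <= 0 by lra.
apply: (@le_geom _ _ _ K ((cabs z / rho) ^+ 2)).
  apply/andP; split; first exact: sqr_ge0.
  apply: exprn_ilt1 => //; first by rewrite divr_ge0 // ltW.
  by rewrite ltr_pdivrMr // mul1r.
move=> j; have := hK j 1%N; rewrite big_ord1 /w muln0 expr0 mul1r d0.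
rewrite cabsM cabsX cabsM cabsN cabsV cabs_real (gtr0_norm r0) exprMn => h.
rewrite add0r -ler_pdivrMr; last by rewrite !exprn_gt0 // divr_gt0.
apply: le_trans h; rewrite mulrC ler_wpM2r ?sqr_ge0 //.
by rewrite -[rho / cabs z]invf_div !exprVn -!exprM mulnC.
Qed.

End Blaschke.

(** As 1 - j sigma never vanishes, each quotient of c is zero at z and can be divided again without
    end. *)
Lemma zode_nonresonant qt c : (forall j, j%:R * (z * qt.[z]) != 1) -> bds c ->
  zode qt 0 c (fun=> 0) -> c 0%N = 0.
Proof.
move=> ns bc h; apply: infinite_divX.
suff hj j : bds (iter j divX c) by [].
have d0 i : iter i divX (fun=> 0) = fun=> 0.
  elim: i => // i IH; rewrite iterS IH; apply/funext => n.
  by rewrite /divX /psum big1 ?mulr0 // => k _; rewrite mul0r.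
elim: j => [//|j IH]; rewrite iterS; apply: divX_bds => //.
apply: (@ccvg_psum_bounded _ (1 - j%:R * (z * qt.[z]))).
  by rewrite subr_eq0 eq_sym.
have := zode_psum (iter_zode j h) IH; rewrite d0 mulp0; congr (ccvg (psum _) _).
by apply/funext => n; rewrite addr0.
Qed.

End RegularSingularPoint.

(** * The Toeplitz operator on Taylor coefficients *)

Section PolyRoots.
Variable R : realType.
Local Notation C := R[i].
Local Notation cabs := (cabs R).

(** If every root were at distance at least eta from t, the factorisation would give |P(t)| >=
    |lead_coef P| eta^d. This is a quantitative continuity of roots. *)
Lemma root_near (P : {poly C}) d (t : C) (eta : R) : size P = d.+1 -> 0 < eta ->
  cabs P.[t] < cabs (lead_coef P) * eta ^+ d ->
  exists2 x, P.[x] = 0 & cabs (x - t) < eta.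
Proof.
move=> sP eta0; have [r hP] := closed_field_poly_normal P.
have P0 : lead_coef P != 0 by rewrite lead_coef_eq0 -size_poly_eq0 sP.
have sr : size r = d.
  by move: sP; rewrite hP size_scale // size_prod_XsubC => -[].
move=> hlt; have [|hn] := pselect (exists2 x, x \in r & cabs (x - t) < eta).
  move=> [x xr hx]; exists x => //; apply/eqP.
  by rewrite -rootE hP rootZ // root_prod_XsubC.
exfalso; move: hlt; apply/negP; rewrite -leNgt hP hornerZ cabsM -hP.
rewrite ler_wpM2l ?cabs_ge0 // -sr horner_prod.
elim: r hn {hP sr} => [|x r IH] hn; first by rewrite big_nil cabs1.
rewrite big_cons cabsM /= exprS; apply: ler_pM; try exact: ltW.
    by rewrite ltW // exprn_gt0.
  rewrite !hornerE cabsB leNgt; apply/negP => h; apply: hn.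
  by exists x => //; rewrite mem_head.
apply: IH => -[y yr hy]; apply: hn; exists y => //.
by rewrite in_cons yr orbT.
Qed.

Lemma isolated_root (P : {poly C}) (t : C) : P != 0 ->
  exists2 eta : R, 0 < eta & forall x, x != t -> cabs (x - t) < eta -> P.[x] != 0.
Proof.
move=> P0; have [r hP] := closed_field_poly_normal P.
suff [eta e0 h] : exists2 eta : R, 0 < eta &
    forall x, x != t -> cabs (x - t) < eta -> x \notin r.
  exists eta => // x xt xe; have := h x xt xe.
  by rewrite hP -rootE rootZ ?lead_coef_eq0 // root_prod_XsubC.
elim: r {hP} => [|y r [eta e0 h]]; first by exists 1.
have [->|yt] := eqVneq y t.
  by exists eta => // x xt xe; rewrite in_cons negb_or xt h.
have yt0 : 0 < cabs (y - t) by rewrite cabs_gt0 subr_eq0.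
exists (Num.min eta (cabs (y - t))); first by rewrite lt_min e0.
move=> x xt; rewrite lt_min => /andP[xe xy]; rewrite in_cons negb_or h // andbT.
by apply: contraTneq xy => ->; rewrite ltxx.
Qed.

Lemma horner_bound (P : {poly C}) x : cabs x <= 1 ->
  cabs P.[x] <= \sum_(i < size P) cabs P`_i.
Proof.
move=> x1; rewrite horner_coef; apply: (le_trans (cabs_sum _ _ _)).
apply: ler_sum => i _; rewrite cabsM cabsX ler_piMr ?cabs_ge0 //.
by rewrite exprn_ile1 // cabs_ge0.
Qed.

End PolyRoots.

(** * The operator on sequences as a perturbation of an invertible one *)

Section ToeplitzSeq.
Variable R : realType.
Local Notation C := R[i].
Local Notation cabs := (cabs R).
Implicit Types (a b : nat -> C) (p q r : {poly C}).

(** K = 0 gives the Bergman weights. A larger K gives an equivalent norm in which the backward shift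
    has norm closer to 1. *)
Definition wt (K : nat) (n : nat) : R := (n + K.+1)%:R^-1.

Lemma wt_gt0 K n : 0 < wt K n.
Proof. by rewrite invr_gt0 ltr0n addnS. Qed.

Lemma wt_dec K n m : (n <= m)%N -> wt K m <= wt K n.
Proof. by move=> nm; rewrite lef_pV2 ?posrE ?ltr0n ?addnS // ler_nat ltnS leq_add2r. Qed.

Definition shiftL a : nat -> C := fun n => a n.+1.

(* The action of T_(conj z + p) - lam on Taylor coefficients: as the squared norm of z^n is
   proportional to [wt 0 n], the adjoint of multiplication by z has weights (n+1)/(n+2). *)
Definition toep p lam a : nat -> C :=
  fun n => n.+1%:R / n.+2%:R * a n.+1 + mulp p a n - lam * a n.

Lemma lin_shiftL : lin shiftL. Proof. by []. Qed.

(** Consecutive weights have ratio 1 + 1/(n+K+1), which is at most 1 + 1/(K+1). *)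
Lemma opb_shiftL K : opb (wt K) shiftL (Num.sqrt (1 + K.+1%:R^-1)).
Proof.
have s0 : 0 < 1 + K.+1%:R^-1 :> R by rewrite addr_gt0 // invr_gt0 ltr0n.
move=> a M [M0 ha]; split; first by rewrite mulr_gt0 // sqrtr_gt0.
move=> N; rewrite exprMn sqr_sqrtr ?(ltW s0) //.
apply: le_trans (ler_wpM2l (ltW s0) (ha N.+1)); rewrite mulr_sumr big_ord_recl.
apply: ler_wpDl.
  apply: mulr_ge0; first exact: ltW.
  by apply: mulr_ge0; [exact/ltW/wt_gt0|exact: sqr_ge0].
apply: ler_sum => n _; rewrite [leRHS]mulrA.
apply: ler_wpM2r; first exact: sqr_ge0.
rewrite /wt /= /bump add1n addSn.
have n0 : 0 < (n + K.+1)%:R :> R by rewrite ltr0n addnS.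
have K0 : 0 < K.+1%:R :> R by rewrite ltr0n.
rewrite ler_pdivlMr ?ltr0n // -natr1.
rewrite mulrDr mulr1 mulVf ?gt_eqF // lerD2l lef_pV2 ?posrE //.
by rewrite ler_nat leq_addl.
Qed.

Lemma opb_mulXn w k i K : (forall n, 0 < w n) -> (forall n m, (n <= m)%N -> w m <= w n) ->
  0 < K -> cabs k <= K -> opb w (mulp (k *: 'X^i)) K.
Proof.
move=> w0 wdec K0 kK a M ha; rewrite mulpZl; apply: nbZ => //; rewrite mulpXn.
case: ha => M0 ha; split=> // N; have [Ni|iN] := leqP N i.
  rewrite big1 ?sqr_ge0 // => j _.
  by rewrite (leq_trans (ltn_ord j) Ni) cabs0 expr0n mulr0.
rewrite -(subnKC (ltnW iN)) big_split_ord /= big1 ?add0r; last first.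
  by move=> j _; rewrite ltn_ord cabs0 expr0n mulr0.
apply: le_trans (ha (N - i)%N); apply: ler_sum => j _.
by rewrite ltnNge leq_addr /= addKn ler_wpM2r ?sqr_ge0 // wdec // leq_addl.
Qed.

(** All nonincreasing weights are allowed, because the weight is fixed later, depending on t. *)
Definition inv_mult r := forall w : nat -> R, (forall n, 0 < w n) ->
  (forall n m, (n <= m)%N -> w m <= w n) -> exists c, bij_bound w (mulp r) c.

Lemma inv_multM r q : inv_mult r -> inv_mult q -> inv_mult (r * q).
Proof.
move=> hr hq w w0 wd; have [c hc] := hr w w0 wd; have [c' hc'] := hq w w0 wd.
exists (c' * c); rewrite (_ : mulp (r * q) = fun a => mulp r (mulp q a)).
  exact: (bij_bound_comp hc hc').
by apply/funext => a; rewrite mulpM.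
Qed.

Lemma inv_mult_contr k i : cabs k < 1 -> inv_mult (1 - k *: 'X^i).
Proof.
move=> k1 w w0 wd; pose K := (1 + cabs k) / 2.
have kK : cabs k <= K by rewrite /K; lra.
have K1 : K < 1 by rewrite /K; lra.
have K0 : 0 < K by rewrite /K; have := cabs_ge0 k; lra.
rewrite (_ : mulp (1 - k *: 'X^i) = fun a n => a n - mulp (k *: 'X^i) a n).
  apply: (bij_perturb w0 (bij_bound_id w) (lin_mulp _) K0) => //; last by rewrite mul1r.
  exact: opb_mulXn.
by apply/funext => a; rewrite mulpBl mulp1.
Qed.

Section Symbol.
Variables (t : R) (r : {poly C}).
Hypotheses (t0 : 0 < t) (t1 : t < 1) (inv_r : inv_mult r).
Let q := (1 - (t^-1)%:C%C *: 'X) * r.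

(** For b = r a, the shift of (1 - X/t) b is - (1/t) (b - t shiftL b), a Neumann perturbation of the
    identity as soon as t^2 (1 + 1/(K+1)) < 1. *)
Lemma bij_principal : exists K c, bij_bound (wt K) (fun a => shiftL (mulp q a)) c.
Proof.
(* Any K > t^2 / (1 - t^2) will do. *)
have [K hK] : exists K : nat, t ^+ 2 * (1 + K.+1%:R^-1) < 1.
  have t2 : 0 < 1 - t ^+ 2 by rewrite subr_gt0 exprn_ilt1 // ltW.
  have := archi_boundP (ltW (divr_gt0 (exprn_gt0 2 t0) t2)).
  set k := Num.bound _ => hk; exists k.
  have k0 : 0 < k.+1%:R :> R by rewrite ltr0n.
  move: hk; rewrite ltr_pdivrMr // => hk.
  rewrite mulrDr mulr1 -ltrBrDl ltr_pdivrMr // mulrC; apply: (lt_le_trans hk).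
  by rewrite ler_wpM2r ?(ltW t2) // ler_nat.
exists K; have w0 := wt_gt0 K.
have [c hc] := inv_r w0 (@wt_dec K).
pose s : R := Num.sqrt (1 + K.+1%:R^-1).
have s0 : 0 < s by rewrite sqrtr_gt0 addr_gt0 // invr_gt0 ltr0n.
have ts0 : 0 < t * s by rewrite mulr_gt0.
have ts1 : t * s < 1.
  rewrite -[t * s]ger0_norm ?ltW // -sqrtr_sqr -sqrtr1 ltr_sqrt // exprMn sqr_sqrtr //.
have oS : opb (wt K) (fun a n => t%:C%C * shiftL a n) (t * s).
  move=> a M ha; rewrite -mulrA; apply: nbZ => //; first exact: opb_shiftL.
  by rewrite cabs_real gtr0_norm.
have ts1' : 1 * (t * s) < 1 by rewrite mul1r.
have [d hd] := bij_perturb w0 (bij_bound_id (wt K)) (lin_scale _ lin_shiftL) ts0 oS ts1'.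
have tn : - (t^-1)%:C%C != 0 :> C.
  by rewrite oppr_eq0 -cabs_eq0 cabs_real normr_eq0 invr_eq0 gt_eqF.
have := bij_bound_comp (bij_bound_scale tn hd) hc.
set L := (fun a => _); rewrite (_ : L = fun a => shiftL (mulp q a)); first by move=> h; eexists; exact: h.
apply/funext => a; rewrite /q mulpM /L; apply/funext => n.
rewrite /shiftL mulpBl mulp1 mulpZl mulpX.
have tt : (t^-1)%:C%C * t%:C%C = 1 :> C by rewrite -rmorphM /= mulVf ?gt_eqF.
by rewrite mulrBr !mulNr mulrA tt; ring.
Qed.

(** The Bergman correction a_(n+1)/(n+2) is cut at N into a part of small norm, [tailD], and a part
    of finite rank, [headD]. *)
Definition tailD N a : nat -> C := fun n => if (n < N)%N then 0 else n.+2%:R^-1 * a n.+1.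
Definition headD N a : nat -> C := fun n => if (n < N)%N then n.+2%:R^-1 * a n.+1 else 0.

Lemma lin_tailD N : lin (tailD N).
Proof. by move=> k a b; apply/funext => n; rewrite /tailD; case: ifP => _; ring. Qed.

Lemma lin_headD N : lin (headD N).
Proof. by move=> k a b; apply/funext => n; rewrite /headD; case: ifP => _; ring. Qed.

Lemma opb_mask K (N : nat) (P : pred nat) (k : nat -> C) e : 0 < e ->
  (forall n, P n -> cabs (k n) <= e) ->
  opb (wt K) (fun a n => if P n then k n * a n else 0) e.
Proof.
move=> e0 ke a M [M0 ha]; split; first exact: mulr_gt0.
move=> m; rewrite exprMn; apply: le_trans (ler_wpM2l (sqr_ge0 e) (ha m)).
rewrite mulr_sumr; apply: ler_sum => n _; rewrite [leRHS]mulrCA.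
apply: ler_wpM2l; first exact/ltW/wt_gt0.
case: ifP => [/ke kn|_]; last by rewrite cabs0 expr0n mulr_ge0 ?sqr_ge0.
by rewrite cabsM exprMn ler_wpM2r ?sqr_ge0 // ler_sqr ?nnegrE ?cabs_ge0 ?(ltW e0).
Qed.

Lemma toep_bij : exists K (delta : R), 0 < delta /\ forall p lam, 1 + 'X * p = q ->
  cabs lam < delta ->
  (forall a M, nb (wt K) a M -> toep p lam a = (fun=> 0) -> a = (fun=> 0)) ->
  exists c, bij_bound (wt K) (toep p lam) c.
Proof.
have [K [c hc]] := bij_principal; have w0 := wt_gt0 K.
have c0 : 0 < c by case: hc.
pose s : R := Num.sqrt (1 + K.+1%:R^-1).
have s0 : 0 < s by rewrite sqrtr_gt0 addr_gt0 // invr_gt0 ltr0n.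
(* Both the tail and lam have size at most e, so the Neumann ratio is 2 c e = 2/3. *)
pose e := (3 * c)^-1.
have e0 : 0 < e by rewrite invr_gt0 mulr_gt0.
exists K, e; split=> // p lam hq lamd inj.
(* N exceeds s/e, so that 1/(n+2) <= e/s from N on; the factor s is the bound for the shift. *)
have := archi_boundP (ltW (divr_gt0 s0 e0)); set N := Num.bound _ => hN.
have oT : opb (wt K) (tailD N) e.
  move=> a M ha; have hb := opb_shiftL ha.
  have := @opb_mask K N (fun n => (N <= n)%N) (fun n => n.+2%:R^-1) (e / s) (divr_gt0 e0 s0) _ _ _ hb.
  rewrite -/s mulrA divfK ?gt_eqF //.
  rewrite (_ : (fun n => _) = tailD N a); last first.
    by apply/funext => n; rewrite /tailD ltnNge; case: leqP.
  apply => n Nn; rewrite cabsV cabs_nat -[leRHS]invf_div lef_pV2 ?posrE ?ltr0n ?divr_gt0 //.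
  by apply: (le_trans (ltW hN)); rewrite ler_nat (leq_trans Nn) // leqW.
have [c' hc'] : exists c', bij_bound (wt K) (fun a n => shiftL (mulp q a) n - (tailD N a n + lam * a n)) c'.
  apply: (@bij_perturb R _ w0 _ (fun a n => tailD N a n + lam * a n) c (e + e)) => //.
  - by move=> k a b; apply/funext => n; rewrite lin_tailD; ring.
  - exact: addr_gt0.
  - move=> a M ha; rewrite mulrDl; apply: nbD => //; first exact: oT.
    by apply: nbZ => //; exact: ltW.
  - by rewrite (_ : c * (e + e) = 2 / 3) /e; [lra|field; rewrite gt_eqF].
have hT a n : toep p lam a n = shiftL (mulp q a) n - (tailD N a n + lam * a n) - headD N a n.
  rewrite /toep /shiftL -hq mulpDl mulp1 mulpM mulpX /tailD /headD.
  have n0 : n.+2%:R != 0 :> C by rewrite pnatr_eq0.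
  by case: ltnP => _; rewrite -[n.+2 in LHS]addn1 natrD; field; rewrite ?natr1.
rewrite (_ : toep p lam = fun a n => shiftL (mulp q a) n - (tailD N a n + lam * a n) - headD N a n); last first.
  by apply/funext => a; apply/funext => n; exact: hT.
apply: (bij_finite_rank w0 hc' (N := N)).
- exact: lin_headD.
- exists s; split=> // a M ha; have hb := opb_shiftL ha.
  have := @opb_mask K N (fun n => (n < N)%N) (fun n => n.+2%:R^-1) 1 ltr01 _ _ _ hb.
  rewrite mul1r; apply => n _; rewrite cabsV cabs_nat invf_le1 ?ltr0n //.
  by rewrite (_ : 1 = 1%:R) // ler_nat.
- by move=> a n Nn; rewrite /headD ltnNge Nn.
- move=> a M ha h; apply: (inj _ _ ha); rewrite -h.
  by apply/funext => n; rewrite hT.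
Qed.

End Symbol.
End ToeplitzSeq.

(** * Resonance at lam = 0 and invertibility for small nonzero lam *)

Section ToeplitzSeqSpectrum.
Variable R : realType.
Local Notation C := R[i].
Local Notation cabs := (cabs R).
Local Notation wt := (@wt R).
Implicit Types (a b : nat -> C) (p q r : {poly C}).

Lemma nb_wt_le K a M : nb (wt 0) a M -> nb (wt K) a M.
Proof.
move=> [M0 h]; split=> // N; apply: le_trans (h N); apply: ler_sum => n _.
rewrite ler_wpM2r ?sqr_ge0 // /wt lef_pV2 ?posrE ?ltr0n ?addnS //.
by rewrite ler_nat ltnS leq_add2l.
Qed.

Lemma nb_wt_ge K a M : nb (wt K) a M -> nb (wt 0) a (K.+1%:R * M).
Proof.
move=> [M0 h]; split; first by rewrite mulr_gt0.
move=> N; rewrite exprMn; apply: le_trans (ler_wpM2l (sqr_ge0 _) (h N)).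
rewrite mulr_sumr; apply: ler_sum => n _; rewrite [leRHS]mulrA.
apply: ler_wpM2r; first exact: sqr_ge0.
rewrite /wt addn1 ler_pdivlMr ?ltr0n ?addnS // mulrC ler_pdivrMr ?ltr0n //.
rewrite -natrX -natrM ler_nat -mulnn -mulnA.
apply: (@leq_trans (K.+1 * n.+1)); last exact: leq_pmull.
by rewrite -addSn mulSn leq_add2l leq_pmulr.
Qed.

Lemma bij_wt K L c : bij_bound (wt K) L c -> exists c', bij_bound (wt 0) L c'.
Proof.
have K0 : 0 < K.+1%:R :> R by [].
move=> [lL [l [l0 oL]] c0 iL sL]; exists (K.+1%:R * c); split=> //.
- exists (K.+1%:R * l); split; first exact: mulr_gt0.
  by move=> a M /nb_wt_le ha; rewrite -mulrA; exact/nb_wt_ge/oL.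
- exact: mulr_gt0.
- by move=> a M /(@nb_wt_le K); exact: iL.
- move=> a M /(@nb_wt_le K)/sL[b [hb Lb]]; exists b; split=> //.
  by rewrite -mulrA; exact: nb_wt_ge.
Qed.

(** By (n+1)/(n+2) = 1 - 1/(n+2): the term 1 joins p and lam in a single multiplication followed by
    a shift. *)
Lemma toep_mulp p lam a n : toep p lam a n =
  mulp (1 + 'X * p - lam *: 'X) a n.+1 - n.+2%:R^-1 * a n.+1.
Proof.
rewrite /toep mulpBl mulpDl mulp1 mulpM mulpX mulpZl mulpX.
have n0 : n.+2%:R != 0 :> C by rewrite pnatr_eq0.
by rewrite -[n.+2 in LHS]addn1 natrD; field; rewrite ?natr1.
Qed.

(** Coefficient n+1 of the differential equation is the n-th coordinate of the operator equation;
    coefficient 0 holds because q(0) = 1. *)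
Lemma toep_zode p lam a qt z g : 1 + 'X * p - lam *: 'X = ('X - z%:P) * qt ->
  toep p lam a = g -> zode z qt 0 (fun n => n.+1%:R^-1 * a n) g.
Proof.
move=> hq hg n; rewrite mul0r addr0 mulpX.
have -> : deriv1 (fun n => n.+1%:R^-1 * a n) = a.
  by apply/funext => i; rewrite /deriv1 mulVKf // pnatr_eq0.
rewrite -hq; case: n => [|n].
  rewrite /mulp big_ord1 subnn invr1 mul1r addr0 -horner_coef0 !hornerE.
  by rewrite subr0 mul1r.
by rewrite -hg toep_mulp; ring.
Qed.

Lemma nb_bds a M : nb (wt 0) a M -> bds (fun n => n.+1%:R^-1 * a n).
Proof.
move=> ha; exists M => n; have M0 := nb_gt0 ha.
rewrite cabsM cabsV cabs_nat mulrC ler_pdivrMr ?ltr0n //.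
apply: (le_trans (nb_coord (@wt_gt0 R 0) n ha)); rewrite ler_wpM2l ?(ltW M0) //.
rewrite /wt addn1 sqrtrV // invrK -[leRHS]ger0_norm // -sqrtr_sqr ler_wsqrtr //.
by rewrite expr2 ler_peMr // ler1n.
Qed.

(** Coordinate n of the kernel equation expresses a_(n+1) through earlier coefficients, its factor
    (n+1)/(n+2) being nonzero. *)
Lemma toep_kernel0 p lam a : toep p lam a = (fun=> 0) -> a 0%N = 0 -> a = fun=> 0.
Proof.
move=> h a0; apply/funext => n; elim/ltn_ind: n => -[//|n] IH.
have := congr1 (@^~ n) h; rewrite /toep /= (IH n) // mulr0 subr0.
rewrite /mulp big1 ?addr0 => [|i _]; last by rewrite IH ?mulr0 // ltnS leq_subr.
move=> /eqP; rewrite mulf_eq0 => /orP[|/eqP //].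
by rewrite mulf_eq0 invr_eq0 !pnatr_eq0.
Qed.

Section Symbol.
Variables (t : R) (r p : {poly C}) (m : nat).
Let q := (1 - (t^-1)%:C%C *: 'X) * r.
Hypotheses (t0 : 0 < t) (t1 : t < 1) (inv_r : inv_mult r).
Hypotheses (m0 : (0 < m)%N) (rt : r.[t%:C%C] = - m%:R^-1) (hq : 1 + 'X * p = q).
Hypothesis sq : (2 < size q)%N.

Let tC : C := t%:C%C.
Let tC0 : tC != 0.
Proof. by rewrite -cabs_eq0 cabs_real normr_eq0 gt_eqF. Qed.

Let tinv : (t^-1)%:C%C = tC^-1.
Proof. exact: fmorphV. Qed.

Let qE : q = ('X - tC%:P) * (- tC^-1 *: r).
Proof.
rewrite /q tinv -scalerAr scalerAl; congr (_ * r).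
rewrite scaleNr scalerBr opprB; congr (_ - _).
by rewrite -mul_polyC -polyCM mulVf.
Qed.

(** The residue is t q'(t) = - r(t) = 1/m, so [zode_resonance] applies to c_n = a_n/(n+1). *)
Lemma toep_not_surj a M : nb (wt 0) a M ->
  toep p 0 a <> fun n => (('X - tC%:P) ^+ m)`_n.
Proof.
move=> ha h.
have hz := @toep_zode p 0 a (- tC^-1 *: r) tC _ _ h.
apply: (@zode_resonance R tC tC0 _ (- tC^-1 *: r) m) (nb_bds ha) (hz _) => //.
- by rewrite cabs_real gtr0_norm.
- by rewrite hornerZ rt; field; rewrite pnatr_eq0 -lt0n m0.
- by rewrite scale0r subr0 hq qE.
Qed.

(** At a zero x of q - lam X, P(x) equals x times the derivative of q - lam X at x: the residue is a
    function of x in which lam no longer occurs. *)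
Let P : {poly C} := 'X * q^`() - q.

Let Pt : m%:R * P.[tC] = 1.
Proof.
rewrite /P qE derivM derivB derivX derivC subr0 mul1r.
rewrite hornerD hornerN hornerM hornerX hornerD !hornerM hornerXsubC subrr !mul0r.
by rewrite subr0 addr0 hornerZ rt; field; rewrite pnatr_eq0 -lt0n m0.
Qed.

(** Near t the value P(z) is close to 1/m, so j P(z) = 1 would force j = m; that case is excluded
    since the roots of m P - 1 are isolated. *)
Let nonresonant : exists2 eta : R, 0 < eta & forall z, z != tC -> cabs (z - tC) < eta ->
  forall j : nat, j%:R * P.[z] != 1.
Proof.
pose Q := m%:R *: P - 1.
(* P(0) = - q(0) = -1, hence Q(0) = - (m + 1). *)
have Q0 : Q != 0.
  have e : Q.[0] = - m.+1%:R by rewrite /Q /P -hq !hornerE -natr1; ring.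
  by apply/eqP => Q0; move/eqP: e; rewrite Q0 horner0 eq_sym oppr_eq0 pnatr_eq0.
have [eta1 e1 h1] := isolated_root tC Q0.
have QE z : Q.[z] = m%:R * P.[z] - 1 by rewrite hornerD hornerN hornerZ hornerC.
have : root Q tC by rewrite rootE QE Pt subrr.
move=> /factor_theorem[s hs].
pose S := \sum_(i < size s) cabs s`_i + 1.
have S0 : 0 < S by rewrite ltr_wpDl // sumr_ge0 // => i _; exact: cabs_ge0.
(* [S] bounds the cofactor [s] on the closed unit disk, 1 - t keeps z in that disk, and the last
   entry makes |Q(z)| < 1/(2(m+1)). *)
pose eta := Num.min eta1 (Num.min (1 - t) ((2 * m.+1%:R * S)^-1)).
have eta0 : 0 < eta.
  by rewrite !lt_min e1 subr_gt0 t1 invr_gt0 !mulr_gt0.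
exists eta => // z zt; rewrite !lt_min => /and3P[z1 z2 z3] j; apply/eqP => hj.
have zl1 : cabs z <= 1.
  have := cabsD (z - tC) tC; rewrite subrK cabs_real gtr0_norm // => h.
  by apply: (le_trans h); move: (cabs _) z2 => ? ?; lra.
have jm : j != m.
  apply/eqP => jm; by have := h1 z zt z1; rewrite QE -jm hj subrr eqxx.
have eps : cabs Q.[z] < (2 * m.+1%:R)^-1.
  rewrite hs hornerM cabsM hornerXsubC.
  apply: (@le_lt_trans _ _ (S * cabs (z - tC))).
    by rewrite ler_wpM2r ?cabs_ge0 // (le_trans (horner_bound _ zl1)) // lerDl.
  by rewrite -ltr_pdivlMl // mulrC -invfM.
(* From j P(z) = 1 follows j Q(z) = m - j. The smallness of Q gives first j <= 2m and then |m - j| <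
   1, against j != m. *)
have jme : cabs (m%:R - j%:R) = j%:R * cabs Q.[z].
  rewrite -[j%:R in RHS](cabs_nat R) -cabsM; congr (cabs _).
  by rewrite QE mulrBr mulr1 mulrCA hj mulr1.
have jlt : j%:R * cabs Q.[z] <= j%:R / (2 * m.+1%:R).
  by rewrite ler_wpM2l // ltW.
have m1 : 0 < m.+1%:R :> R by [].
have j2m : (j <= 2 * m)%N.
  rewrite -(ler_nat R) natrM.
  have h : cabs (j%:R) - cabs (m%:R) <= cabs (j%:R - m%:R) := cabsB_ge _ _.
  rewrite (cabsB j%:R) jme !cabs_nat in h.
  have : j%:R / (2 * m.+1%:R) <= j%:R / 2 :> R.
    rewrite ler_wpM2l // lef_pV2 ?posrE // ?mulr_gt0 // ler_peMr // ler1n //.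
  by move=> /(le_trans (le_trans h jlt)); lra.
have : cabs (m%:R - j%:R) < 1.
  rewrite jme; apply: (le_lt_trans jlt); rewrite ltr_pdivrMr ?mulr_gt0 // mul1r.
  by rewrite -natrM ltr_nat (leq_ltn_trans j2m) // ltn_pmul2l.
apply/negP; rewrite -leNgt.
have [h|h|h] := ltngtP j m; last by rewrite h eqxx in jm.
  by rewrite -natrB ?(ltnW h) // cabs_nat ler1n subn_gt0.
by rewrite cabsB -natrB ?(ltnW h) // cabs_nat ler1n subn_gt0.
Qed.

(** The zero t of q moves to a zero x of q - lam X with x != t, where no resonance occurs; the
    kernel is then trivial and [toep_bij] concludes. *)
Lemma toep_invertible : exists2 delta : R, 0 < delta &
  forall lam, lam != 0 -> cabs lam < delta -> exists c, bij_bound (wt 0) (toep p lam) c.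
Proof.
have [K [d1 [d10 hd1]]] := toep_bij t0 t1 inv_r.
have [eta0 e0 hnr] := nonresonant.
pose eta := Num.min eta0 (Num.min t (1 - t)).
have eta_gt0 : 0 < eta by rewrite !lt_min e0 t0 subr_gt0.
have [d hd] : exists d, size q = d.+3 by case: (size q) sq => [|[|[|d]]] // _; exists d.
have lq : 0 < cabs (lead_coef q) by rewrite cabs_gt0 lead_coef_eq0 -size_poly_eq0 hd.
(* The threshold of [root_near] for q - lam X, whose value at t is - lam t and whose leading
   coefficient is that of q because q has degree at least 2. *)
pose d2 := cabs (lead_coef q) * eta ^+ d.+2.
have d20 : 0 < d2 by rewrite mulr_gt0 // exprn_gt0.
exists (Num.min d1 d2); first by rewrite lt_min d10.
move=> lam lam0; rewrite lt_min => /andP[lam1 lam2].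
suff inj a M : nb (wt 0) a M -> toep p lam a = (fun=> 0) -> a = fun=> 0.
  have [|c hc] := hd1 p lam hq lam1; last exact: bij_wt hc.
  by move=> a M /nb_wt_ge; exact: inj.
move=> ha h.
pose ql := q - lam *: 'X.
have sl : (size (- (lam *: 'X)) < size q)%N.
  rewrite size_polyN; apply: (@leq_ltn_trans 2) => //.
  by apply: (leq_trans (size_scale_leq _ _)); rewrite size_polyX.
have sql : size ql = d.+3 by rewrite /ql size_polyDl.
have lql : lead_coef ql = lead_coef q by rewrite /ql lead_coefDl.
have qt0 : q.[tC] = 0 by rewrite qE hornerM hornerXsubC subrr mul0r.
have qlE x : ql.[x] = q.[x] - lam * x by rewrite hornerD hornerN hornerZ hornerX.
have [|x xr xt] := @root_near R ql d.+2 tC eta sql eta_gt0.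
  rewrite lql; apply: le_lt_trans lam2.
  rewrite qlE qt0 add0r cabsN cabsM cabs_real ler_piMr ?cabs_ge0 //.
  by rewrite gtr0_norm // ltW.
move: xt; rewrite !lt_min => /and3P[x1 x2 x3].
have [qt hqt] : exists qt, ql = ('X - x%:P) * qt.
  by move: xr => /rootP/factor_theorem[qt hqt]; exists qt; rewrite mulrC.
have xn0 : x != 0.
  apply/eqP => x0; move: xr; rewrite x0 qlE -hq hornerD hornerC hornerM hornerX mul0r mulr0 subr0 addr0.
  by move/eqP; rewrite oner_eq0.
have xl1 : cabs x < 1.
  have := cabsD (x - tC) tC; rewrite subrK cabs_real gtr0_norm //.
  by move: (cabs _) (cabs _) x3 => ? ? ? ?; lra.
have xtC : x != tC.
  apply/eqP => xe; move: xr; rewrite xe qlE qt0 add0r => /eqP.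
  by rewrite oppr_eq0 mulf_eq0 (negbTE lam0) (negbTE tC0).
have hs : x * qt.[x] = P.[x].
  have : ql^`().[x] = qt.[x].
    by rewrite hqt derivM derivB derivX derivC subr0 mul1r hornerD hornerM hornerXsubC subrr mul0r addr0.
  move=> <-; rewrite derivB derivZ derivX hornerD hornerN hornerZ hornerC mulr1.
  have PE : P.[x] = x * q^`().[x] - q.[x] by rewrite hornerD hornerN hornerM hornerX.
  move: xr; rewrite qlE PE => /eqP.
  by rewrite subr_eq0 => /eqP ->; rewrite mulrBr (mulrC x lam).
have hz : zode x qt 0 (fun n => n.+1%:R^-1 * a n) (fun=> 0).
  by apply: (toep_zode _ h); rewrite hq -hqt.
have := zode_nonresonant xn0 xl1 _ (nb_bds ha) hz.
rewrite invr1 mul1r => a0; apply: (toep_kernel0 h); apply: a0 => j.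
by rewrite hs; exact: hnr.
Qed.

End Symbol.
End ToeplitzSeqSpectrum.

(** * Approximate eigenvectors and the choice of the symbol *)

Section Examples.
Variable R : realType.
Local Notation C := R[i].
Local Notation cabs := (cabs R).
Local Notation wt := (@wt R).
Implicit Types (a b : nat -> C) (p q r : {poly C}).

Lemma nb_delta_le (w : nat -> R) i M : 0 < M -> w i <= M ^+ 2 ->
  nb w (fun n => (n == i)%:R : C) M.
Proof.
move=> M0 wM; split=> // N; apply: le_trans (_ : Num.max 0 (w i) <= _); last first.
  by rewrite ge_max sqr_ge0.
elim: N => [|N IH]; first by rewrite big_ord0 le_max lexx.
have [iN|iN] := ltnP i N.
  by rewrite big_ord_recr /= gtn_eqF // cabs0 expr0n mulr0 addr0.
rewrite big_ord_recr /= big1 ?add0r.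
  case: eqP => [->|_]; first by rewrite cabs1 expr1n mulr1 le_max lexx orbT.
  by rewrite cabs0 expr0n mulr0 le_max lexx.
move=> j _; rewrite ltn_eqF ?cabs0 ?expr0n ?mulr0 //.
exact: leq_trans (ltn_ord j) iN.
Qed.

Lemma opb_mulp K p : exists2 c, 0 < c & opb (wt K) (mulp p) c.
Proof.
elim/poly_ind: p => [|p k [c c0 IH]].
  exists 1 => // a M [M0 ha]; rewrite mul1r.
  rewrite (_ : mulp 0 a = fun=> 0); first exact: nb_zero.
  by apply/funext => n; rewrite /mulp big1 // => i _; rewrite coef0 mul0r.
exists (c + (cabs k + 1)); first by rewrite ltr_wpDr // addr_ge0 // cabs_ge0.
move=> a M ha; rewrite mulpDl mulpM mulpC mulrDl.
apply: nbD; first exact: wt_gt0.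
  apply: IH; have := @opb_mulXn R (wt K) 1 1 1 (@wt_gt0 R K) (@wt_dec R K) ltr01 _ _ _ ha.
  by rewrite scale1r expr1 mul1r cabs1; exact.
by apply: nbZ => //; rewrite ?lerDl // ltr_wpDl // cabs_ge0.
Qed.

(** The sum of 1/(n+1) over [N, 2N) lies between 1/2 and 1 for every N, while each of the two jumps
    has squared norm at most 1/N. *)
Definition block N : nat -> C := fun n => (N <= n < N + N)%N%:R.

Lemma block_count N m : (\sum_(n < m) (N <= n < N + N) = minn m (N + N) - N)%N.
Proof.
elim: m => [|m IH]; first by rewrite big_ord0; lia.
by rewrite big_ord_recr /= IH; lia.
Qed.

Lemma block_sum N m (c : R) :
  \sum_(n < m) c * cabs (block N n) ^+ 2 = c * (minn m (N + N) - N)%N%:R.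
Proof.
rewrite -mulr_sumr -block_count natr_sum; congr (_ * _); apply: eq_bigr => n _.
by rewrite /block cabs_nat; case: (_ <= _ < _)%N; rewrite ?expr1n ?expr0n.
Qed.

Lemma nb_block N : (0 < N)%N -> nb (wt 0) (block N) 1.
Proof.
move=> N0; split=> // m.
apply: (@le_trans _ _ (\sum_(n < m) N%:R^-1 * cabs (block N n) ^+ 2)).
  apply: ler_sum => n _; rewrite /block.
  have [/andP[Nn _]|_] := boolP (N <= n < N + N)%N; last by rewrite cabs0 expr0n !mulr0.
  rewrite cabs1 expr1n !mulr1 /wt addn1 lef_pV2 ?posrE ?ltr0n //.
  by rewrite ler_nat (leq_trans Nn).
rewrite block_sum expr1n mulrC ler_pdivrMr ?ltr0n // mul1r ler_nat; lia.
Qed.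

Lemma block_lower N : (0 < N)%N ->
  1 / 2 <= \sum_(n < N + N) wt 0 n * cabs (block N n) ^+ 2.
Proof.
move=> N0; apply: (@le_trans _ _ (\sum_(n < N + N) (N + N)%:R^-1 * cabs (block N n) ^+ 2)).
  rewrite block_sum minnn addnK natrD.
  have N0' : 0 < N%:R :> R by rewrite ltr0n.
  by rewrite [leRHS]mulrC ler_pdivlMr ?addr_gt0 //; lra.
apply: ler_sum => n _; rewrite ler_wpM2r ?sqr_ge0 // /wt addn1.
by rewrite lef_pV2 ?posrE ?ltr0n // ?addn_gt0 ?N0 // ler_nat.
Qed.

Lemma block_diff N : (0 < N)%N -> mulp ('X - 1%:P) (block N) =
  fun n => (n == N + N)%N%:R - (n == N)%N%:R.
Proof.
move=> N0; apply/funext => n; rewrite mulpXsub mul1r /block; case: n => [|n].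
  by rewrite !(ltn_eqF, addn_gt0, N0) // leqn0 eqn0Ngt N0 subr0.
have : ((N <= n < N + N) + (n.+1 == N) = (n.+1 == N + N) + (N <= n.+1 < N + N))%N by lia.
move=> /(congr1 (fun k : nat => k%:R : C)); rewrite !natrD => h.
by apply/eqP; rewrite subr_eq addrAC eq_sym subr_eq eq_sym h.
Qed.

(* Slowly varying sequences: since 1 + p(1) is the value of the symbol
   at the boundary point 1, the operator almost annihilates them. *)
Lemma toep_approx p (e : R) : 0 < e -> exists a, [/\ nb (wt 0) a 1,
  nb (wt 0) (toep p (1 + p.[1]) a) e &
  exists N, 1 / 2 <= \sum_(n < N) wt 0 n * cabs (a n) ^+ 2].
Proof.
move=> e0; have w0 := @wt_gt0 R 0.
(* Through this factorisation p - p(1) acts on the block only via its two jumps. *)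
have : root (p - p.[1]%:P) 1 by rewrite rootE !hornerE subrr.
move=> /factor_theorem[s hs]; have [c c0 oc] := opb_mulp 0 s.
pose S : R := Num.sqrt (1 + 1%:R^-1).
have S0 : 0 < S by rewrite sqrtr_gt0 invr1.
pose eta := e / (S * 2 + S + c * 2).
have D0 : 0 < S * 2 + S + c * 2 by rewrite !addr_gt0 // mulr_gt0.
have eta0 : 0 < eta by rewrite divr_gt0.
(* eta controls the correction 1/(n+2), and eta^2 the squared norms of the jumps. *)
pose eta' := Num.min eta (eta ^+ 2).
have eta'0 : 0 < eta' by rewrite lt_min eta0 exprn_gt0.
have [N hN] : exists N, N.+1%:R^-1 <= eta'.
  exists (Num.bound eta'^-1); rewrite -[leRHS]invrK lef_pV2 ?posrE ?invr_gt0 //.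
  have := archi_boundP (ltW (_ : 0 < eta'^-1)); rewrite invr_gt0 => /(_ eta'0) h.
  by apply: (le_trans (ltW h)); rewrite ler_nat.
move: hN; rewrite le_min => /andP[hN1 hN2].
exists (block N.+1); split; [exact: nb_block| |by exists (N.+1 + N.+1)%N; exact: block_lower].
pose d := mulp ('X - 1%:P) (block N.+1).
have hd : nb (wt 0) d (eta * 2).
  rewrite mulr_natr mulr2n /d block_diff //; apply: nbB => //; apply: nb_delta_le => //.
    apply: le_trans hN2; rewrite /wt lef_pV2 ?posrE ?ltr0n ?addn1 // ler_nat; lia.
  by apply: le_trans hN2; rewrite /wt lef_pV2 ?posrE ?ltr0n ?addn1 // ler_nat; lia.
(* The shifted block vanishes below N, so the cut changes nothing; it makes 1/(n+2) <= eta available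
   to [opb_mask]. *)
pose b n := if (N <= n)%N then n.+2%:R^-1 * shiftL (block N.+1) n else 0.
have hb : nb (wt 0) b (eta * S).
  have := opb_shiftL (nb_block (ltn0Sn N)); rewrite mulr1.
  apply: (@opb_mask R 0 0 (fun n => (N <= n)%N) (fun n => n.+2%:R^-1)) => // n Nn.
  rewrite cabsV cabs_nat; apply: le_trans hN1.
  by rewrite lef_pV2 ?posrE ?ltr0n // ler_nat; lia.
have -> : toep p (1 + p.[1]) (block N.+1) = fun n => (- shiftL d n - b n) + mulp s d n.
  apply/funext => n; rewrite /d -mulpM -hs mulpBl mulpC /shiftL mulpXsub /toep /b.
  have -> : (if (N <= n)%N then n.+2%:R^-1 * block N.+1 n.+1 else 0) = n.+2%:R^-1 * block N.+1 n.+1.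
    case: leqP => // nN; rewrite /block (_ : (N < n.+1)%N = false) ?mulr0 //; lia.
  have n0 : n.+2%:R != 0 :> C by rewrite pnatr_eq0.
  by rewrite -[n.+2 in LHS]addn1 natrD; field; rewrite ?natr1.
have -> : e = S * (eta * 2) + eta * S + c * (eta * 2).
  by rewrite /eta; field; rewrite gt_eqF.
apply: nbD => //; last exact: oc.
by apply: nbB => //; apply: nbN; exact: opb_shiftL.
Qed.

Lemma bernoulli_le (x : R) n : 0 <= x <= 1 -> 1 - n%:R * x <= (1 - x) ^+ n.
Proof.
move=> /andP[x0 x1]; elim: n => [|n IH]; first by rewrite mul0r subr0 expr0.
rewrite exprS -natr1; have := ler_wpM2l (_ : 0 <= 1 - x) IH; rewrite subr_ge0 => /(_ x1).
by have := mulr_ge0 (ler0n R n) (sqr_ge0 x); rewrite expr2; lra.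
Qed.

Lemma size_1subXn (k : C) j : k != 0 -> (0 < j)%N -> size (1 - k *: 'X^j) = j.+1.
Proof.
move=> k0 j0; rewrite addrC size_polyDl size_polyN size_scale // size_polyXn //.
by rewrite size_poly1 ltnS.
Qed.

Definition admissible p t r (m : nat) := [/\ 0 < t < 1, inv_mult r, (0 < m)%N,
  r.[t%:C%C] = - m%:R^-1 & 1 + 'X * p = (1 - (t^-1)%:C%C *: 'X) * r].

(* w satisfies (1 - w)^3 = -1/8 and |w| < t: with a = t / w outside the closed disk,
   r = (1 - z/a)^3 has r(t) = -1/8; for k > 3 the extra factor 1 + (z/t)^(k-3) / 7
   raises the degree and turns this value into -1/7. *)
Lemma admissible_exists k : (2 < k)%N -> exists p t r m,
  [/\ size p = k.+1, admissible p t r m & 1 + p.[1] != 0].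
Proof.
move=> hk; set j := (k - 3)%N; have kj : k = j.+3 by rewrite /j; lia.
pose s3 : R := Num.sqrt 3.
have s32 : s3 * s3 = 3 by rewrite -expr2 sqr_sqrtr.
(* 1 - w = exp(i pi/3)/2 is a non-real cube root of -1/8. The real one, -1/2, would give w = 3/2 and
   a zero of r inside the disk. *)
pose w : C := (3 / 4 +i* (- (s3 / 4)))%C.
(* Close enough to 1 that t exceeds |w| = sqrt(3)/2 and, by Bernoulli, 7 t^j > 1, so that the extra
   factor has its zeros outside the closed disk. *)
pose t : R := 1 - (20 * j.+1%:R)^-1.
have j1 : 1 <= j.+1%:R :> R by rewrite ler1n.
have x01 : 0 < (20 * j.+1%:R)^-1 :> R by rewrite invr_gt0 mulr_gt0.
have x1 : (20 * j.+1%:R)^-1 <= 20^-1 :> R by rewrite lef_pV2 ?posrE ?mulr_gt0 //; lra.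
have t01 : 0 < t < 1 by rewrite /t; move: x01 x1; set x := _^-1 => ? ?; lra.
have /andP[t0 t1] := t01.
have t95 : 19 / 20 <= t by rewrite /t; move: x01 x1; set x := _^-1 => ? ?; lra.
have tj : 19 / 20 <= t ^+ j.
  apply: le_trans (bernoulli_le _ _); last by move: x01 x1; set x := _^-1 => ? ?; lra.
  have : j%:R * (20 * j.+1%:R)^-1 <= 20^-1 :> R.
    rewrite ler_pdivrMr ?mulr_gt0 // mulrA mulVf ?pnatr_eq0 // mul1r ler_nat.
    exact: leqW.
  by move: (_ / _) => u; lra.
pose tC : C := t%:C%C.
have tC0 : tC != 0 by rewrite -cabs_eq0 cabs_real normr_eq0 gt_eqF.
have w3 : (1 - w) ^+ 3 = - 8%:R^-1.
  have -> : 8%:R^-1 = (8^-1)%:C%C :> C by rewrite fmorphV rmorph_nat.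
  have w1 : 1 - w = (1 / 4 +i* (s3 / 4))%C.
    by apply/eqP; rewrite eq_complex /=; apply/andP; split; apply/eqP; lra.
  have w2 : (1 - w) * (1 - w) = (- (1 / 8) +i* (s3 / 8))%C.
    by rewrite w1; apply/eqP; rewrite eq_complex /=; apply/andP; split; apply/eqP; lra.
  rewrite exprS expr2 w2 w1; apply/eqP; rewrite eq_complex /=.
  by apply/andP; split; apply/eqP; lra.
have wt1 : cabs (w / tC) < 1.
  rewrite cabsM cabsV cabs_real gtr0_norm // ltr_pdivrMr // mul1r.
  rewrite -ltr_sqr ?nnegrE ?cabs_ge0 ?(ltW t0) // cabs2 /= sqrrN !expr2.
  have : 19 / 20 * (19 / 20) <= t * t by apply: ler_pM => //; lra.
  by lra.
have wn0 : w / tC != 0.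
  rewrite mulf_neq0 ?invr_eq0 // eq_complex /= negb_and; apply/orP; left.
  by apply/eqP; lra.
pose A : {poly C} := 1 - (w / tC) *: 'X^1.
pose kk : C := - (7%:R^-1 * tC ^- j).
(* For j = 0 the formula would give the constant 8/7 and destroy q(0) = 1. *)
pose B : {poly C} := if j is 0 then 1 else 1 - kk *: 'X^j.
pose m := if j is 0 then 8%N else 7%N.
pose r := A * A * A * B.
have kk0 : kk != 0 by rewrite oppr_eq0 mulf_neq0 // invr_eq0 ?expf_neq0 // pnatr_eq0.
have kk1 : cabs kk < 1.
  rewrite cabsN cabsM !cabsV cabs_nat cabsX cabs_real gtr0_norm //.
  rewrite -invfM invf_lt1 ?mulr_gt0 ?exprn_gt0 //; lra.
have iA : inv_mult A by exact: inv_mult_contr.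
have iB : inv_mult B.
  rewrite /B; case: (j) => [|i]; last exact: inv_mult_contr.
  by rewrite (_ : 1 = 1 - 0 *: 'X^0); [apply: inv_mult_contr; rewrite cabs0|rewrite scale0r subr0].
have hA x : A.[x] = 1 - w / tC * x by rewrite hornerD hornerN hornerZ hornerC hornerXn expr1.
have hB x : B.[x] = if j is 0 then 1 else 1 - kk * x ^+ j.
  by rewrite /B; case: (j) => [|i]; rewrite ?hornerC // hornerD hornerN hornerZ hornerC hornerXn.
have rt : r.[tC] = - m%:R^-1.
  have A3 : (1 - w) * (1 - w) * (1 - w) = - 8^-1 by rewrite -w3; ring.
  rewrite !hornerM hA divfK // A3 hB /m /kk; case: (j) => [|i].
    by rewrite mulr1.
  have := expf_neq0 i.+1 tC0; set u := tC ^+ _ => u0.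
  by field.
have nzw : 1 - w / tC != 0.
  apply/eqP => /(congr1 (fun u => cabs (1 - u))); rewrite subr0 cabs1 opprB addrC subrK.
  by move=> h; move: wt1; rewrite h ltxx.
pose q := (1 - (t^-1)%:C%C *: 'X) * r.
have q0 : q.[0] = 1.
  rewrite !hornerM hA hB !mulr0 subr0 hornerD hornerN hornerZ hornerX hornerC mulr0 subr0 !mul1r.
  by case: (j) => [|i] //; rewrite expr0n mulr0 subr0.
(* As q(0) = 1, the polynomial p is obtained as (q - 1)/X. *)
have : root (q - 1) 0 by rewrite rootE hornerD hornerN hornerC q0 subrr.
move=> /factor_theorem[p]; rewrite polyC0 (subr0 'X) => hp.
have hq : 1 + 'X * p = q by rewrite mulrC -hp addrC subrK.
have nzA : A != 0 by rewrite -size_poly_eq0 size_1subXn.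
have sB : size B = j.+1.
  rewrite /B; case: (j) kk0 => [|i] kk0; first by rewrite size_poly1.
  by rewrite size_1subXn.
have nzB : B != 0 by rewrite -size_poly_eq0 sB.
have tinv0 : (t^-1)%:C%C != 0 :> C by rewrite -cabs_eq0 cabs_real normr_eq0 invr_eq0 gt_eqF.
have sT : size (1 - (t^-1)%:C%C *: 'X : {poly C}) = 2 by rewrite -['X]expr1 size_1subXn.
have nzT : 1 - (t^-1)%:C%C *: 'X != 0 :> {poly C} by rewrite -size_poly_eq0 sT.
have sq : size q = j.+4.+1.
  rewrite /q /r !size_mul ?mulf_neq0 // sT sB size_1subXn //.
exists p, t, r, m; split.
- have : size (q - 1) = j.+4.+1 by rewrite size_polyDl ?sq // size_polyN size_poly1.
  have [p0|pn0] := eqVneq p 0; first by rewrite hp p0 mul0r size_poly0.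
  by rewrite hp size_mulX // kj => -[].
- by split => //; [do ! apply: inv_multM|rewrite /m; case: (j)].
- have -> : 1 + p.[1] = q.[1] by rewrite -hq hornerD hornerC hornerM hornerX mul1r.
  rewrite /q !hornerM hA mulr1 !mulf_neq0 //.
    rewrite hornerD hornerN hornerZ hornerX hornerC mulr1 subr_eq0 eq_sym.
    apply/eqP => /(congr1 cabs); rewrite cabs_real cabs1 gtr0_norm ?invr_gt0 // => h.
    by move: t1; rewrite -invf_gt1 // h ltxx.
  rewrite hB; case: (j) kk1 => [|i] kk1; first by rewrite oner_eq0.
  rewrite expr1n mulr1 subr_eq0; apply/eqP => h.
  by move: kk1; rewrite -h cabs1 ltxx.
Qed.

End Examples.

(** * Cauchy's formula *)

Section Goursat.
Variable R : realType.
Local Notation C := R[i].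
Local Notation cabs := (cabs R).

(** Nested quarters with the property [P], chosen one after another; monotonicity of their corners
    and completeness of the reals provide a common point. *)
Lemma bisection (P : R -> R -> R -> R -> Prop) (a b c d : R) : a <= b -> c <= d ->
  P a b c d ->
  (forall a b c d, a <= b -> c <= d -> P a b c d ->
    let m := (a + b) / 2 in let n := (c + d) / 2 in
    P a m c n \/ P m b c n \/ P a m n d \/ P m b n d) ->
  exists x y, [/\ a <= x <= b, c <= y <= d & forall k : nat, exists a' b' c' d',
    P a' b' c' d' /\ [/\ a <= a' <= x, x <= b' <= b, c <= c' <= y, y <= d' <= d &
        b' - a' = (b - a) / 2 ^+ k /\ d' - c' = (d - c) / 2 ^+ k]].
Proof.
move=> ab cd Pabcd step.
pose Q (r : R * R * R * R) := let: (a, b, c, d) := r in [/\ a <= b, c <= d & P a b c d].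
(* The relation is vacuous on rectangles without the property, so that it is total and [choice]
   applies. *)
pose Rel (r r' : R * R * R * R) := Q r -> let: (a, b, c, d) := r in
   let: (a', b', c', d') := r' in
   [/\ Q r', a <= a' /\ b' <= b, c <= c', d' <= d & b' - a' = (b - a) / 2 /\ d' - c' = (d - c) / 2].
have hRel r : exists r', Rel r r'.
  case: r => -[[a1 b1] c1] d1; rewrite /Rel /=.
  have [[ab1 cd1 P1]|nQ] := pselect (Q (a1, b1, c1, d1)); last by exists (a1, b1, c1, d1).
  have [h|[h|[h|h]]] := step _ _ _ _ ab1 cd1 P1.
  - by exists (a1, (a1 + b1) / 2, c1, (c1 + d1) / 2) => _; split=> //; do ?split=> //; lra.
  - by exists ((a1 + b1) / 2, b1, c1, (c1 + d1) / 2) => _; split=> //; do ?split=> //; lra.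
  - by exists (a1, (a1 + b1) / 2, (c1 + d1) / 2, d1) => _; split=> //; do ?split=> //; lra.
  - by exists ((a1 + b1) / 2, b1, (c1 + d1) / 2, d1) => _; split=> //; do ?split=> //; lra.
have [s hs] := choice hRel.
pose r k := iter k s (a, b, c, d).
pose pa k := (r k).1.1.1; pose pb k := (r k).1.1.2; pose pc k := (r k).1.2; pose pd k := (r k).2.
have Qr k : Q (r k).
  elim: k => [|k IH]; first by split.
  by have := hs _ IH; rewrite -/(r k.+1) /=; case: (r k) => [[[? ?] ?] ?]; case: (s _) => [[[? ?] ?] ?] [].
have QP k : [/\ pa k <= pb k, pc k <= pd k & P (pa k) (pb k) (pc k) (pd k)].
  by have := Qr k; rewrite /pa /pb /pc /pd; case: (r k) => [[[? ?] ?] ?].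
have S k : [/\ pa k <= pa k.+1 /\ pb k.+1 <= pb k, pc k <= pc k.+1, pd k.+1 <= pd k,
   pb k.+1 - pa k.+1 = (pb k - pa k) / 2 & pd k.+1 - pc k.+1 = (pd k - pc k) / 2].
  have := hs _ (Qr k); rewrite /pa /pb /pc /pd /= -/(r k).
  by case: (r k) => [[[? ?] ?] ?]; case: (s _) => [[[? ?] ?] ?] [_ [? ?] ? ? [? ?]].
have mono (u : nat -> R) : (forall k, u k <= u k.+1) -> forall n m, (n <= m)%N -> u n <= u m.
  move=> h n m /subnKC <-; elim: (m - n)%N => [|i IH]; first by rewrite addn0.
  by rewrite addnS (le_trans IH).
have ma : forall n m, (n <= m)%N -> pa n <= pa m by apply: mono => k; case: (S k) => -[].
have mc : forall n m, (n <= m)%N -> pc n <= pc m by apply: mono => k; case: (S k).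
have mb n m : (n <= m)%N -> pb m <= pb n.
  move=> nm; rewrite -lerN2; apply: (mono (fun k => - pb k)) => // k.
  by rewrite lerN2; case: (S k) => -[].
have md n m : (n <= m)%N -> pd m <= pd n.
  move=> nm; rewrite -lerN2; apply: (mono (fun k => - pd k)) => // k.
  by rewrite lerN2; case: (S k).
have between (u v : nat -> R) : (forall n m, (n <= m)%N -> u n <= u m) ->
    (forall n m, (n <= m)%N -> v m <= v n) -> (forall k, u k <= v k) ->
    exists x, forall k, u k <= x <= v k.
  move=> hu hv huv.
  have ub n m : u n <= v m.
    apply: (le_trans (hu n (maxn n m) (leq_maxl _ _))); apply: (le_trans (huv _)).
    exact: hv (leq_maxr _ _).
  exists (sup (range u)) => k; apply/andP; split.
    apply: ub_le_sup; last by exists k.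
    by exists (v 0%N) => _ [n _ <-].
  by apply: ge_sup; [exists (u 0%N), 0%N|move=> _ [n _ <-]].
have [x hx] : exists x, forall k, pa k <= x <= pb k by apply: between => // k; case: (QP k).
have [y hy] : exists x, forall k, pc k <= x <= pd k by apply: between => // k; case: (QP k).
exists x, y; split; [exact: (hx 0%N)|exact: (hy 0%N)|].
move=> k; exists (pa k), (pb k), (pc k), (pd k).
have /andP[x1 x2] := hx k; have /andP[y1 y2] := hy k.
split; first by case: (QP k).
split.
- by rewrite x1 andbT; exact: ma 0%N k (leq0n _).
- by rewrite x2 /=; exact: mb 0%N k (leq0n _).
- by rewrite y1 andbT; exact: mc 0%N k (leq0n _).
- by rewrite y2 /=; exact: md 0%N k (leq0n _).
elim: k {x1 x2 y1 y2} => [|k [IH1 IH2]]; first by rewrite expr0 !divr1.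
have [_ _ _ -> ->] := S k.
by rewrite IH1 IH2 exprS invfM mulrAC -!mulrA [2^-1 * _]mulrC.
Qed.

(* [I] plays the role of the integral of a holomorphic form along the boundary of a
   rectangle. *)
Lemma goursat (I : R -> R -> R -> R -> C) (a b c d : R) : a < b -> c < d ->
  (forall a' m b' c' d', a <= a' <= m -> m <= b' <= b -> c <= c' <= d' -> d' <= d ->
     I a' b' c' d' = I a' m c' d' + I m b' c' d') ->
  (forall a' b' c' m d', a <= a' <= b' -> b' <= b -> c <= c' <= m -> m <= d' <= d ->
     I a' b' c' d' = I a' b' c' m + I a' b' m d') ->
  (forall x y, a <= x <= b -> c <= y <= d -> forall e, 0 < e ->
    exists2 delta, 0 < delta & forall a' b' c' d',
    a <= a' <= x -> x <= b' <= b -> c <= c' <= y -> y <= d' <= d ->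
    b' - a' < delta -> d' - c' < delta ->
    cabs (I a' b' c' d') <= e * ((b' - a') + (d' - c')) ^+ 2) ->
  I a b c d = 0.
Proof.
move=> ab cd add1 add2 loc; apply/eqP; rewrite -cabs_eq0; apply/negPn/negP => I0.
set eta := cabs (I a b c d) in I0.
have eta0 : 0 < eta by rewrite lt_def I0 cabs_ge0.
pose S := (b - a) + (d - c); have S0 : 0 < S by rewrite /S; lra.
(* |I| is compared with the square of the half-perimeter. Halving the sides divides that square by
   4, so one of the four quarters inherits the inequality. *)
pose P a' b' c' d' := [/\ a <= a' <= b', b' <= b, c <= c' <= d', d' <= d &
  eta * ((b' - a') + (d' - c')) ^+ 2 <= cabs (I a' b' c' d') * S ^+ 2].
have P0 : P a b c d by split; rewrite ?lexx //= ?ltW.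
have [x [y [xab ycd hk]]] : exists x y, [/\ a <= x <= b, c <= y <= d & forall k : nat, exists a' b' c' d',
    P a' b' c' d' /\ [/\ a <= a' <= x, x <= b' <= b, c <= c' <= y, y <= d' <= d &
        b' - a' = (b - a) / 2 ^+ k /\ d' - c' = (d - c) / 2 ^+ k]].
  apply: (bisection (ltW ab) (ltW cd) P0).
  move=> a1 b1 c1 d1 ab1 cd1 [/andP[aa1 _] bb1 /andP[cc1 _] dd1 h] m n.
have m1 : a1 <= m by rewrite /m; lra.
  have m2 : m <= b1 by rewrite /m; lra.
  have n1 : c1 <= n by rewrite /n; lra.
  have n2 : n <= d1 by rewrite /n; lra.
  have am : a <= m by exact: le_trans m1.
  have cn : c <= n by exact: le_trans n1.
  have mb : m <= b by exact: le_trans bb1.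
  have nd : n <= d by exact: le_trans dd1.
  have hI : I a1 b1 c1 d1 = I a1 m c1 n + I m b1 c1 n + (I a1 m n d1 + I m b1 n d1).
    rewrite (add2 a1 b1 c1 n d1) ?aa1 ?ab1 ?cc1 ?n2 //.
    by rewrite !(add1 a1 m b1) ?aa1 ?m1 ?m2 ?cc1 ?n1 ?cn ?n2.
  apply: contrapT => /not_orP[h1 /not_orP[h2 /not_orP[h3 h4]]].
  have key a2 b2 c2 d2 : a <= a2 <= b2 -> b2 <= b -> c <= c2 <= d2 -> d2 <= d ->
      (b2 - a2) + (d2 - c2) = ((b1 - a1) + (d1 - c1)) / 2 -> ~ P a2 b2 c2 d2 ->
      cabs (I a2 b2 c2 d2) * S ^+ 2 < eta * ((b1 - a1) + (d1 - c1)) ^+ 2 / 4.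
    move=> u1 u2 u3 u4 u5 nP; rewrite ltNge; apply/negP => hh; apply: nP; split=> //.
    by rewrite u5; move: hh; rewrite !expr2; lra.
  have := key a1 m c1 n; rewrite aa1 m1 cc1 n1 => /(_ isT mb isT nd _ h1).
  have := key m b1 c1 n; rewrite am m2 cc1 n1 => /(_ isT bb1 isT nd _ h2).
  have := key a1 m n d1; rewrite aa1 m1 cn n2 => /(_ isT mb isT dd1 _ h3).
  have := key m b1 n d1; rewrite am m2 cn n2 => /(_ isT bb1 isT dd1 _ h4).
  move=> k1 k2 k3 k4.
  have {}k1 := k1 ltac:(rewrite /m /n; lra).
  have {}k2 := k2 ltac:(rewrite /m /n; lra).
  have {}k3 := k3 ltac:(rewrite /m /n; lra).
  have {}k4 := k4 ltac:(rewrite /m /n; lra).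
  have : cabs (I a1 b1 c1 d1) * S ^+ 2 <= (cabs (I a1 m c1 n) + cabs (I m b1 c1 n) + (cabs (I a1 m n d1) + cabs (I m b1 n d1))) * S ^+ 2.
    rewrite ler_wpM2r ?sqr_ge0 // hI; apply: (le_trans (cabsD _ _)); apply: lerD; exact: cabsD.
  rewrite !mulrDl; move: h k1 k2 k3 k4.
  set u := _ * S ^+ 2; set u1 := _ * S ^+ 2; set u2 := _ * S ^+ 2; set u3 := _ * S ^+ 2; set u4 := _ * S ^+ 2.
  by set v := eta * _; lra.
have S1 : 0 < S ^+ 2 + 1 by rewrite ltr_wpDl // sqr_ge0.
(* With this precision, the local estimate on a small rectangle of the sequence contradicts [P] by a
   factor S^2 / (2 (S^2 + 1)) < 1. *)
have [delta d0 hd] := loc x y xab ycd (eta / (2 * (S ^+ 2 + 1))) (divr_gt0 eta0 (mulr_gt0 (ltr0n _ 2) S1)).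
have [k hk'] : exists k, (S + 1) / 2 ^+ k < delta.
  have := archi_boundP (ltW (divr_gt0 (_ : 0 < S + 1) d0)).
  set k := Num.bound _ => hh; exists k.
  have : (S + 1) / delta < k%:R by apply: hh; lra.
  rewrite ltr_pdivrMr // => h2; rewrite ltr_pdivrMr ?exprn_gt0 //; apply: (lt_le_trans h2).
  by rewrite mulrC ler_wpM2l ?(ltW d0) // -natrX ler_nat ltnW // ltn_expl.
have [a1 [b1 [c1 [d1 [[_ _ _ _ hP] [xa xb yc yd [e1 e2]]]]]]] := hk k.
have p2 : 0 < 2 ^- k :> R by rewrite invr_gt0 exprn_gt0.
have ba : (b - a) / 2 ^+ k <= (S + 1) / 2 ^+ k by rewrite ler_wpM2r ?(ltW p2) // /S; lra.
have dc : (d - c) / 2 ^+ k <= (S + 1) / 2 ^+ k by rewrite ler_wpM2r ?(ltW p2) // /S; lra.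
have := hd a1 b1 c1 d1 xa xb yc yd; rewrite e1 e2 => /(_ (le_lt_trans ba hk') (le_lt_trans dc hk')).
move: hP; rewrite e1 e2 -mulrDl -/S exprMn => hP hI.
have := le_trans hP (ler_wpM2r (sqr_ge0 S) hI).
set q := (2 ^- k) ^+ 2; have q0 : 0 < q by rewrite exprn_gt0.
have S2 : 0 < S ^+ 2 by rewrite exprn_gt0.
rewrite (_ : eta * _ = 1 * (eta * (S ^+ 2 * q))); last by ring.
rewrite (_ : _ * S ^+ 2 = S ^+ 2 / (2 * (S ^+ 2 + 1)) * (eta * (S ^+ 2 * q))); last by ring.
rewrite ler_pM2r ?mulr_gt0 // ler_pdivlMr ?mulr_gt0 //; lra.
Qed.

End Goursat.

(** * Integrals of complex functions of a real variable *)

Section CurveIntegral.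
Variable R : realType.
Local Notation C := R[i].
Local Notation cabs := (cabs R).
Local Notation mu := (@lebesgue_measure R).
Implicit Types (g G : R -> R) (h : R -> C).

Lemma continuous_epsP g x : {for x, continuous g} <->
  forall e, 0 < e -> exists2 d : R, 0 < d & forall y, `|y - x| < d -> `|g y - g x| < e.
Proof.
split=> [cg e e0|H].
  move: cg => /cvgrPdist_lt/(_ e e0)/nbhs_ballP[d /= d0 hd].
  exists d => // y xy; rewrite distrC; apply: hd.
  by rewrite /ball /= distrC.
apply/cvgrPdist_lt => e e0; have [d d0 hd] := H e e0.
apply/nbhs_ballP; exists d => //= y; rewrite /ball /= distrC => xy.
by rewrite distrC; exact: hd.
Qed.

Definition ccont h := continuous (fun x => complex.Re (h x)) /\
                      continuous (fun x => complex.Im (h x)).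

Lemma cReD (u v : C) : complex.Re (u + v) = complex.Re u + complex.Re v.
Proof. by case: u v => ? ? []. Qed.
Lemma cImD (u v : C) : complex.Im (u + v) = complex.Im u + complex.Im v.
Proof. by case: u v => ? ? []. Qed.
Lemma cReN (u : C) : complex.Re (- u) = - complex.Re u.
Proof. by case: u. Qed.
Lemma cImN (u : C) : complex.Im (- u) = - complex.Im u.
Proof. by case: u. Qed.
Lemma cReM (u v : C) : complex.Re (u * v) = complex.Re u * complex.Re v - complex.Im u * complex.Im v.
Proof. by case: u v => ? ? []. Qed.
Lemma cImM (u v : C) : complex.Im (u * v) = complex.Re u * complex.Im v + complex.Im u * complex.Re v.
Proof. by case: u v => ? ? []. Qed.

Lemma cReJ (u : C) : complex.Re (conjc u) = complex.Re u.
Proof. by case: u. Qed.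
Lemma cImJ (u : C) : complex.Im (conjc u) = - complex.Im u.
Proof. by case: u. Qed.

Lemma ccont_epsP h : ccont h <-> forall x e, 0 < e ->
  exists2 d : R, 0 < d & forall y, `|y - x| < d -> cabs (h y - h x) < e.
Proof.
split=> [[cr ci] x e e0|H].
  have e2 : 0 < e / 2 by rewrite divr_gt0.
  have [d1 d10 h1] := (continuous_epsP _ _).1 (cr x) _ e2.
  have [d2 d20 h2] := (continuous_epsP _ _).1 (ci x) _ e2.
  exists (Num.min d1 d2); first by rewrite lt_min d10.
  move=> y; rewrite lt_min => /andP[y1 y2]; apply: (le_lt_trans (cabs_le _)).
  by have := h1 y y1; have := h2 y y2; rewrite cReD cImD cReN cImN; lra.
split=> x; apply/continuous_epsP => e e0; have [d d0 hd] := H x e e0; exists d => // y yx.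
  by have := le_lt_trans (cabs_Re _) (hd y yx); rewrite cReD cReN.
by have := le_lt_trans (cabs_Im _) (hd y yx); rewrite cImD cImN.
Qed.

Lemma ccont_cst (c : C) : ccont (fun=> c).
Proof. by split=> x; exact: cvg_cst. Qed.

Lemma ccont_real g : continuous g -> ccont (fun x => (g x)%:C%C).
Proof. by move=> cg; split=> x //=; exact: cvg_cst. Qed.

Lemma ccontD h k : ccont h -> ccont k -> ccont (fun x => h x + k x).
Proof.
move=> [h1 h2] [k1 k2]; split=> x.
  by under eq_fun do rewrite cReD; apply: cvgD; [exact: h1|exact: k1].
by under eq_fun do rewrite cImD; apply: cvgD; [exact: h2|exact: k2].
Qed.

Lemma ccontM h k : ccont h -> ccont k -> ccont (fun x => h x * k x).
Proof.
move=> [h1 h2] [k1 k2]; split=> x.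
  under eq_fun do rewrite cReM.
  by apply: cvgB; apply: cvgM; [exact: h1|exact: k1|exact: h2|exact: k2].
under eq_fun do rewrite cImM.
by apply: cvgD; apply: cvgM; [exact: h1|exact: k2|exact: h2|exact: k1].
Qed.

Lemma ccontZ c h : ccont h -> ccont (fun x => c * h x).
Proof. by move=> ch; apply: ccontM => //; exact: ccont_cst. Qed.

Lemma ccontN h : ccont h -> ccont (fun x => - h x).
Proof. by move=> /(ccontZ (-1)); under [fun x => -1 * _]eq_fun do rewrite mulN1r. Qed.

Definition cfun_cont_at (f : C -> C) (z : C) := forall e, 0 < e ->
  exists2 d : R, 0 < d & forall y, cabs (y - z) < d -> cabs (f y - f z) < e.

Lemma ccont_comp (f : C -> C) h : ccont h -> (forall x, cfun_cont_at f (h x)) ->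
  ccont (fun x => f (h x)).
Proof.
move=> /ccont_epsP ch cf; apply/ccont_epsP => x e e0.
have [d d0 hd] := cf x e e0; have [d' d'0 hd'] := ch x d d0.
by exists d' => // y yx; apply: hd; exact: hd'.
Qed.

Lemma cfun_cont_inv (z : C) : z != 0 -> cfun_cont_at (fun y => y^-1) z.
Proof.
move=> z0 e e0; have zp : 0 < cabs z by rewrite cabs_gt0.
exists (Num.min (cabs z / 2) (e * cabs z ^+ 2 / 2)).
  by rewrite lt_min !divr_gt0 // mulr_gt0 // exprn_gt0.
move=> y; rewrite lt_min => /andP[y1 y2].
have yz : cabs z / 2 < cabs y.
  by have := cabsB_ge z (z - y); rewrite subKr (cabsB z y); lra.
have yp : 0 < cabs y by apply: lt_trans yz; rewrite divr_gt0.
have y0 : y != 0 by rewrite -cabs_gt0.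
rewrite (_ : y^-1 - z^-1 = (z - y) / (y * z)); last by field; rewrite y0 z0.
rewrite cabsM cabsV cabsM (cabsB z) ltr_pdivrMr ?mulr_gt0 //.
apply: (lt_le_trans y2); rewrite -mulrA ler_wpM2l ?(ltW e0) //.
rewrite (_ : _ / 2 = cabs z / 2 * cabs z); last by rewrite expr2 mulrAC.
by rewrite ler_wpM2r ?(ltW zp) // ltW.
Qed.

Lemma ccont_inv h : ccont h -> (forall x, h x != 0) -> ccont (fun x => (h x)^-1).
Proof. by move=> ch h0; apply: (@ccont_comp (fun y => y^-1)) => // x; exact: cfun_cont_inv. Qed.

Definition cI (a b : R) h : C :=
  ((\int[mu]_(x in `[a, b]) complex.Re (h x)) +i* (\int[mu]_(x in `[a, b]) complex.Im (h x)))%C.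

Lemma cont_integrable g a b : continuous g -> mu.-integrable `[a, b] (EFin \o g).
Proof.
move=> cg; apply: continuous_compact_integrable; first exact: segment_compact.
exact: continuous_subspaceT.
Qed.

Lemma Rint_split g a c b : continuous g -> a <= c <= b ->
  \int[mu]_(x in `[a, b]) g x = \int[mu]_(x in `[a, c]) g x + \int[mu]_(x in `[c, b]) g x.
Proof.
move=> cg /andP[ac cb].
rewrite -(@Rintegral_itv_obnd_cbnd _ c (BRight b)); last first.
  apply: (integrableS _ _ _ (cont_integrable c b cg)) => //.
  by apply: subset_itvr; rewrite bnd_simp.
rewrite -(@Rintegral_itvB _ g (BLeft a) (BRight b) c) ?bnd_simp //; last exact: cont_integrable.
by rewrite addrC subrK.
Qed.

Lemma cI_split h a c b : ccont h -> a <= c <= b -> cI a b h = cI a c h + cI c b h.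
Proof. by move=> [hr hi] acb; rewrite /cI (Rint_split hr acb) (Rint_split hi acb). Qed.

Lemma cID h k a b : ccont h -> ccont k -> cI a b (fun x => h x + k x) = cI a b h + cI a b k.
Proof.
move=> [h1 h2] [k1 k2]; rewrite /cI.
under eq_Rintegral do rewrite cReD.
under [X in Complex _ X]eq_Rintegral do rewrite cImD.
by rewrite !RintegralD //; exact: cont_integrable.
Qed.

Lemma cIZ c h a b : ccont h -> cI a b (fun x => c * h x) = c * cI a b h.
Proof.
move=> [h1 h2]; rewrite /cI.
have cM (k : R) g : continuous g -> continuous (fun x => k * g x).
  by move=> cg x; apply: cvgMr; exact: cg.
under eq_Rintegral do rewrite cReM.
under [X in Complex _ X]eq_Rintegral do rewrite cImM.
rewrite RintegralB ?RintegralD ?RintegralZl //; try (by apply: cont_integrable => //; exact: cM); try exact: cont_integrable.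
by case: c.
Qed.

Lemma Rint_cst (k a b : R) : a <= b -> \int[mu]_(x in `[a, b]) k = k * (b - a).
Proof.
move=> ab; rewrite Rintegral_cst //= lebesgue_measure_itv /= lte_fin.
by move: ab; rewrite le_eqVlt => /orP[/eqP->|->] //; rewrite ltxx subrr.
Qed.

Lemma Rint_bound g a b M : a <= b -> continuous g -> (forall x, a <= x <= b -> `|g x| <= M) ->
  `|\int[mu]_(x in `[a, b]) g x| <= M * (b - a).
Proof.
move=> ab cg gM; apply: (le_trans (le_normr_Rintegral _ _)) => //; first exact: cont_integrable.
rewrite -(Rint_cst M ab); apply: le_Rintegral => //.
- by apply: cont_integrable => x; apply: cvg_norm; exact: cg.
- by apply: cont_integrable => x; exact: cvg_cst.
Qed.

(** The factor 2 comes from bounding the real and imaginary parts separately. *)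
Lemma cI_bound h a b M : a <= b -> ccont h -> (forall x, a <= x <= b -> cabs (h x) <= M) ->
  cabs (cI a b h) <= 2 * M * (b - a).
Proof.
move=> ab [hr hi] hM; apply: (le_trans (cabs_le _)) => /=.
have := Rint_bound ab hr (fun x xab => le_trans (cabs_Re _) (hM x xab)).
have := Rint_bound ab hi (fun x xab => le_trans (cabs_Im _) (hM x xab)).
lra.
Qed.

Lemma Rint_FTC g G (a b : R) : a <= b -> continuous g -> (forall x : R, is_derive x 1 G (g x)) ->
  \int[mu]_(x in `[a, b]) g x = G b - G a.
Proof.
rewrite le_eqVlt => /orP[/eqP<- _ _|ab cg dG].
  by rewrite set_itv1 Rintegral_set1 subrr.
rewrite /Rintegral (@continuous_FTC2 _ g G) //.
- exact: continuous_subspaceT.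
- have cG : continuous G.
    by move=> x; apply: differentiable_continuous; apply/derivable1_diffP; case: (dG x).
  split.
  + by move=> x _; case: (dG x).
  + by apply: cvg_at_right_filter; exact: cG.
  + by apply: cvg_at_left_filter; exact: cG.
- by move=> x _; rewrite derive1E; case: (dG x).
Qed.

Lemma cI_cst c a b : a <= b -> cI a b (fun=> c) = c * (b - a)%:C%C.
Proof.
by move=> ab; rewrite /cI !Rint_cst //; case: c => u v; simpc.
Qed.

End CurveIntegral.

(** * Cauchy's formula by contraction of the circle *)

Section Cauchy.
Variable R : realType.
Local Notation C := R[i].
Local Notation cabs := (cabs R).
Implicit Types (f : C -> C) (g : R -> R -> C).

Definition cdiff f z := exists d : C, forall e, 0 < e ->
  exists2 delta : R, 0 < delta & forall y, cabs (y - z) < delta ->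
    cabs (f y - f z - d * (y - z)) <= e * cabs (y - z).

Lemma cdiff_cont f z : cdiff f z -> cfun_cont_at f z.
Proof.
move=> [d hd] e e0; have [delta d0 h] := hd 1 ltr01.
have dp : 0 < cabs d + 1 by rewrite ltr_wpDl // cabs_ge0.
exists (Num.min delta (e / (cabs d + 1))); first by rewrite lt_min d0 divr_gt0.
move=> y; rewrite lt_min => /andP[y1 y2].
rewrite (_ : f y - f z = (f y - f z - d * (y - z)) + d * (y - z)); last by rewrite subrK.
apply: (le_lt_trans (cabsD _ _)); rewrite cabsM.
have := h y y1; rewrite mul1r => h1; move: y2; rewrite ltr_pdivlMr // => y2.
by move: (cabs (_ - _)) (cabs (y - z)) (cabs d) h1 y2 => u v w h1 y2; lra.
Qed.

Definition circ (rho th : R) : C := (rho * cos th +i* (rho * sin th))%C.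

Lemma cabs_circ rho th : 0 <= rho -> cabs (circ rho th) = rho.
Proof.
move=> r0; rewrite /Defs.cabs /= !exprMn -mulrDr cos2Dsin2 mulr1 sqrtr_sqr.
by rewrite ger0_norm.
Qed.

Lemma ccont_circ rho : ccont (circ rho).
Proof.
split=> x /=; apply: cvgMr; [exact: continuous_cos|exact: continuous_sin].
Qed.

Lemma circ_2pi rho : circ rho (2 * pi) = circ rho 0.
Proof. by rewrite /circ mulr_natl cos2pi sin2pi cos0 sin0. Qed.

Lemma cI_circ rho (a b : R) : a <= b ->
  cI a b (circ rho) = - 'i%C * (circ rho b - circ rho a).
Proof.
move=> ab; rewrite /cI /=.
have -> : \int[lebesgue_measure]_(x in `[a, b]) (rho * cos x) = rho * sin b - rho * sin a.
  apply: (@Rint_FTC _ _ (fun x => rho * sin x)) => // x.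
  by apply: cvgMr; exact: continuous_cos.
have -> : \int[lebesgue_measure]_(x in `[a, b]) (rho * sin x) = (- rho) * cos b - (- rho) * cos a.
  apply: (@Rint_FTC _ _ (fun x => (- rho) * cos x)) => // x.
    by apply: cvgMr; exact: continuous_sin.
  by rewrite -[rho * _]opprK -mulNr -mulrN; apply: is_deriveZ.
by simpc; congr Complex; ring.
Qed.

Lemma circ_lipschitz rho (a b : R) : 0 <= rho -> a <= b ->
  cabs (circ rho b - circ rho a) <= 2 * rho * (b - a).
Proof.
move=> r0 ab.
have h x : a <= x <= b -> cabs (circ rho x) <= rho by rewrite cabs_circ.
have := cI_bound ab (ccont_circ rho) h.
rewrite cI_circ // cabsM cabsN (_ : cabs 'i%C = 1) ?mul1r //.
by rewrite /Defs.cabs /= expr0n expr1n add0r sqrtr1.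
Qed.

Section CauchyFormula.
Variables (f : C -> C) (rho : R) (z0 : C).
Hypotheses (z0r : cabs z0 < rho) (df : forall z, cabs z <= rho -> cdiff f z).

Let rho0 : 0 < rho. Proof. exact: le_lt_trans (cabs_ge0 _) z0r. Qed.
Let zeta := circ rho.
(** Cauchy kernel in the angle: on the circle, dw / (w - z0) = i kappa dth. *)
Let kappa th := zeta th / (zeta th - z0).

Let zeta_z0 th : rho - cabs z0 <= cabs (zeta th - z0).
Proof. by rewrite -[X in X - _](cabs_circ th (ltW rho0)) cabsB_ge. Qed.

Let zeta_ne th : zeta th - z0 != 0.
Proof. by rewrite -cabs_gt0; apply: lt_le_trans (zeta_z0 th); rewrite subr_gt0. Qed.

Let ccont_kappa : ccont kappa.
Proof.
apply: ccontM; first exact: ccont_circ.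
by apply: ccont_inv => //; apply: ccontD; [exact: ccont_circ|exact: ccont_cst].
Qed.

Let K := rho / (rho - cabs z0).
Let K0 : 0 < K. Proof. by rewrite divr_gt0 // subr_gt0. Qed.

Let kappaK th : cabs (kappa th) <= K.
Proof.
rewrite cabsM cabsV cabs_circ ?(ltW rho0) //; apply: ler_wpM2l; first exact: ltW.
rewrite lef_pV2 ?posrE ?subr_gt0 //.
by rewrite cabs_gt0.
Qed.

Let zeta_z0_le th : cabs (zeta th - z0) <= 2 * rho.
Proof.
apply: (le_trans (cabsD _ _)); rewrite cabsN cabs_circ ?(ltW rho0) //.
by move: z0r; lra.
Qed.

Section Homotopy.
Variable t0 : R.
Hypotheses (t00 : 0 < t0) (t01 : t0 < 1).

(** Clamping t to [t0, 1] makes all functions of t continuous on the whole line and keeps 1/t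
    bounded. *)
Let cl (t : R) := Num.max t0 (Num.min t 1).

Let clE t : t0 <= t <= 1 -> cl t = t.
Proof. by move=> /andP[h1 h2]; rewrite /cl (min_idPl h2) (max_idPr h1). Qed.

Let cl_bound t : t0 <= cl t <= 1.
Proof. by rewrite /cl le_max lexx /= ge_max (ltW t01) ge_min lexx orbT. Qed.

Let cl_cont : continuous cl.
Proof.
move=> x; apply/continuous_epsP => e e0; exists e => // y; apply: le_lt_trans.
have lmax u v : `|Num.max t0 u - Num.max t0 v| <= `|u - v|.
  case: (leP t0 u) => hu; case: (leP t0 v) => hv //; rewrite ?subrr ?normr0 ?normr_ge0 //.
    by rewrite !ger0_norm ?subr_ge0 // ?(le_trans (ltW hv)) //; lra.
  by rewrite distrC [leRHS]distrC !ger0_norm ?subr_ge0 // ?(le_trans (ltW hu)) //; lra.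
have lmin (u v : R) : `|Num.min u 1 - Num.min v 1| <= `|u - v|.
  case: (leP u 1) => hu; case: (leP v 1) => hv //; rewrite ?subrr ?normr0 ?normr_ge0 //.
    by rewrite distrC [leRHS]distrC !ger0_norm ?subr_ge0 //; lra.
  by rewrite !ger0_norm ?subr_ge0 //; lra.
exact: le_trans (lmax _ _) (lmin _ _).
Qed.

Let clC t : (cl t)%:C%C != 0 :> C.
Proof.
rewrite -cabs_eq0 cabs_real normr_eq0 gt_eqF //.
by have /andP[h _] := cl_bound t; exact: lt_le_trans h.
Qed.

Let sc g := (forall t, ccont (g t)) /\ (forall th, ccont (g^~ th)).

(** Pulled back by (t, th) -> z0 + t (zeta th - z0), the form dw / (i (w - z0)) becomes P0 dt +
    kappa dth. *)
Let P0 t : C := ((cl t)%:C%C * 'i%C)^-1.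

Let ine : 'i%C != 0 :> C.
Proof. by rewrite eq_complex /= oner_eq0 andbF. Qed.

Let ccont_P0 : ccont P0.
Proof.
apply: ccont_inv; last by move=> x; rewrite mulf_neq0.
by apply: ccontM; [exact: (ccont_real cl_cont)|exact: ccont_cst].
Qed.

Let P0_le t : cabs (P0 t) <= t0^-1.
Proof.
rewrite cabsV cabsM cabs_real (_ : cabs 'i%C = 1); last first.
  by rewrite /Defs.cabs /= expr0n expr1n add0r sqrtr1.
have /andP[h _] := cl_bound t; have clp : 0 < cl t by exact: lt_le_trans h.
by rewrite mulr1 gtr0_norm // lef_pV2.
Qed.

(** The integral of g (P0 dt + kappa dth) along the boundary of the rectangle [a, b] x [c, d]. *)
Let I g (a b c d : R) : C :=
  cI c d (fun th => g b th * kappa th) - cI c d (fun th => g a th * kappa th) -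
  (cI a b (fun t => g t d * P0 t) - cI a b (fun t => g t c * P0 t)).

Let I_lin k g1 g2 a b c d : sc g1 -> sc g2 ->
  I (fun t th => k * g1 t th + g2 t th) a b c d = k * I g1 a b c d + I g2 a b c d.
Proof.
move=> [u1 v1] [u2 v2]; rewrite /I.
have lin1 t : cI c d (fun th => (k * g1 t th + g2 t th) * kappa th) =
    k * cI c d (fun th => g1 t th * kappa th) + cI c d (fun th => g2 t th * kappa th).
  rewrite -cIZ; last exact: ccontM.
  rewrite -cID; [|by apply: ccontZ; exact: ccontM|exact: ccontM].
  by congr cI; apply/funext => th; ring.
have lin2 th : cI a b (fun t => (k * g1 t th + g2 t th) * P0 t) =
    k * cI a b (fun t => g1 t th * P0 t) + cI a b (fun t => g2 t th * P0 t).
  rewrite -cIZ; last by apply: ccontM; [exact: v1|].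
  rewrite -cID; [|by apply: ccontZ; apply: ccontM; [exact: v1|]|by apply: ccontM; [exact: v2|]].
  by congr cI; apply/funext => t; ring.
by rewrite !lin1 !lin2; ring.
Qed.

Let I_one a b c d : I (fun _ _ => 1) a b c d = 0.
Proof. by rewrite /I !subrr. Qed.

Let G t th : C := (cl t)%:C%C * (zeta th - z0).

Let sc_G : sc G.
Proof.
split=> [t|th].
  by apply: ccontZ; apply: ccontD; [exact: ccont_circ|exact: ccont_cst].
by apply: ccontM; [exact: (ccont_real cl_cont)|exact: ccont_cst].
Qed.

(** The form G (P0 dt + kappa dth) = dG / i is exact. *)
Let I_G a b c d : t0 <= a -> a <= b -> b <= 1 -> c <= d -> I G a b c d = 0.
Proof.
move=> t0a ab b1 cd; rewrite /I.
have h1 t : cI c d (fun th => G t th * kappa th) = (cl t)%:C%C * cI c d zeta.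
  rewrite -cIZ; last exact: ccont_circ.
  by congr cI; apply/funext => th; rewrite /G /kappa; field; exact: zeta_ne.
have h2 th : cI a b (fun t => G t th * P0 t) = (zeta th - z0) / 'i%C * (b - a)%:C%C.
  rewrite -cI_cst //; congr cI; apply/funext => t; rewrite /G /P0.
  by field; rewrite ine clC.
rewrite !h1 !h2 cI_circ // !clE ?t0a ?b1 ?ab ?(le_trans t0a ab) ?(le_trans ab b1) //.
have -> : 'i%C^-1 = - 'i%C :> C.
  by apply: (mulfI ine); rewrite mulfV // mulrN -expr2 sqr_i opprK.
by rewrite rmorphB /=; rewrite -/zeta; ring.
Qed.

Let I_bound g M a b c d : sc g -> a <= b -> c <= d -> 0 <= M ->
  (forall t th, a <= t <= b -> c <= th <= d -> cabs (g t th) <= M) ->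
  cabs (I g a b c d) <= 4 * M * (K + t0^-1) * ((b - a) + (d - c)).
Proof.
move=> [s1 s2] ab cd M0 gM.
have b1 t : a <= t <= b -> cabs (cI c d (fun th => g t th * kappa th)) <= 2 * (M * K) * (d - c).
  move=> tab; apply: cI_bound => //; first exact: ccontM.
  by move=> th thcd; rewrite cabsM; apply: ler_pM; rewrite ?cabs_ge0 //; exact: gM.
have b2 th : c <= th <= d -> cabs (cI a b (fun t => g t th * P0 t)) <= 2 * (M / t0) * (b - a).
  move=> tab; apply: cI_bound => //; first by apply: ccontM; [exact: s2|].
  by move=> t tcd; rewrite cabsM; apply: ler_pM; rewrite ?cabs_ge0 //; exact: gM.
apply: (@le_trans _ _ (2 * (M * K) * (d - c) + 2 * (M * K) * (d - c) +
    (2 * (M / t0) * (b - a) + 2 * (M / t0) * (b - a)))).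
  apply: (le_trans (cabsD _ _)); rewrite cabsN; apply: lerD;
    apply: (le_trans (cabsD _ _)); rewrite cabsN; apply: lerD.
  - by apply: b1; rewrite ab lexx.
  - by apply: b1; rewrite ab lexx.
  - by apply: b2; rewrite cd lexx.
  - by apply: b2; rewrite cd lexx.
have MK : 0 <= M * K by rewrite mulr_ge0 // ltW.
have Mt : 0 <= M / t0 by rewrite mulr_ge0 // invr_ge0 ltW.
have := mulr_ge0 MK (_ : 0 <= b - a); rewrite subr_ge0 => /(_ ab).
have := mulr_ge0 Mt (_ : 0 <= d - c); rewrite subr_ge0 => /(_ cd).
rewrite (_ : 4 * M * (K + t0^-1) = 4 * (M * K) + 4 * (M / t0)); last by ring.
move: (M * K) (M / t0) MK Mt => u v u0 v0; nra.
Qed.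

Let F t th := f (z0 + G t th).

Let inside t th : cabs (z0 + G t th) <= rho.
Proof.
rewrite (_ : z0 + _ = (1 - cl t)%:C%C * z0 + (cl t)%:C%C * zeta th); last first.
  by rewrite /G rmorphB rmorph1; ring.
apply: (le_trans (cabsD _ _)); rewrite !cabsM !cabs_real cabs_circ ?(ltW rho0) //.
have /andP[h1 h2] := cl_bound t.
have clp : 0 < cl t by exact: lt_le_trans h1.
rewrite !ger0_norm ?(ltW clp) ?subr_ge0 //.
have : (1 - cl t) * cabs z0 <= (1 - cl t) * rho by rewrite ler_wpM2l ?subr_ge0 // ltW.
lra.
Qed.

Let sc_F : sc F.
Proof.
have [s1 s2] := sc_G.
split=> [t|th]; apply: (@ccont_comp _ f).
- by apply: ccontD; [exact: ccont_cst|exact: s1].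
- by move=> x; exact/cdiff_cont/df.
- by apply: ccontD; [exact: ccont_cst|exact: s2].
- by move=> x; exact/cdiff_cont/df.
Qed.

(** Near a point, F is an affine function of G up to a small multiple of the distance. The affine
    part integrates to 0 by [I_one] and [I_G]; the remainder gives one factor of the half-perimeter,
    the length of the boundary the other. *)
Let I_loc (x y : R) : t0 <= x <= 1 -> forall e, 0 < e ->
    exists2 delta, 0 < delta & forall a' b' c' d',
    t0 <= a' <= x -> x <= b' <= 1 -> c' <= y -> y <= d' ->
    b' - a' < delta -> d' - c' < delta ->
    cabs (I F a' b' c' d') <= e * ((b' - a') + (d' - c')) ^+ 2.
Proof.
move=> hx e e0; have [D hD] := df (inside x y).
pose L := 2 * rho; have L0 : 0 < L by rewrite mulr_gt0.
have Kt : 0 < K + t0^-1 by rewrite addr_gt0 // invr_gt0.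
pose e' := e / (4 * L * (K + t0^-1)).
have e'0 : 0 < e' by rewrite divr_gt0 // !mulr_gt0.
have [delta d0 hd] := hD e' e'0.
exists (delta / (2 * L)); first by rewrite divr_gt0 // mulr_gt0.
move=> a b c d /andP[t0a ax] /andP[xb b1] cy yd ba dc.
have ab : a <= b by exact: le_trans xb.
have cd : c <= d by exact: le_trans yd.
have Gdist t th : a <= t <= b -> c <= th <= d -> cabs (G t th - G x y) <= L * ((b - a) + (d - c)).
  move=> /andP[at_ tb] /andP[ct td].
  rewrite (_ : _ - _ = (t - x)%:C%C * (zeta th - z0) + x%:C%C * (zeta th - zeta y)); last first.
    by rewrite /G !clE // ?rmorphB /= ?(le_trans t0a) ?(le_trans tb) //; ring.
  apply: (le_trans (cabsD _ _)); rewrite !cabsM !cabs_real mulrDr; apply: lerD.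
    rewrite [leRHS]mulrC; apply: ler_pM; rewrite ?normr_ge0 ?cabs_ge0 //.
    by rewrite ler_norml; apply/andP; split; lra.
  have /andP[x0 x1] := hx; have xp : 0 < x by exact: lt_le_trans x0.
  rewrite gtr0_norm // -[leRHS]mul1r; apply: ler_pM; rewrite ?(ltW xp) ?cabs_ge0 //.
  have [thy|thy] := leP y th.
    by apply: (le_trans (circ_lipschitz (ltW rho0) thy)); rewrite ler_wpM2l ?(ltW L0) //; lra.
  rewrite cabsB; apply: (le_trans (circ_lipschitz (ltW rho0) (ltW thy))).
  by rewrite ler_wpM2l ?(ltW L0) //; lra.
pose E t th := F t th - F x y - D * (G t th - G x y).
have FE : F = fun t th => D * G t th + ((F x y - D * G x y) * 1 + E t th).
  by apply/funext => t; apply/funext => th; rewrite /E; ring.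
have sc1 (k : C) : sc (fun _ _ => k) by split=> ?; exact: ccont_cst.
have scE : sc E.
  have [u1 u2] := sc_F; have [v1 v2] := sc_G.
  split=> [t|th].
    apply: ccontD; first by apply: ccontD; [exact: u1|exact: ccont_cst].
    by apply/ccontN/ccontZ/ccontD; [exact: v1|exact: ccont_cst].
  apply: ccontD; first by apply: ccontD; [exact: u2|exact: ccont_cst].
  by apply/ccontN/ccontZ/ccontD; [exact: v2|exact: ccont_cst].
have scE' : sc (fun t th => (F x y - D * G x y) * 1 + E t th).
  have [u1 u2] := scE.
  by split=> ?; apply: ccontD; [exact: ccont_cst|exact: u1|exact: ccont_cst|exact: u2].
have -> : I F a b c d = I E a b c d.
  by rewrite FE I_lin // I_G // mulr0 add0r I_lin // I_one mulr0 add0r.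
set W := (b - a) + (d - c); have W0 : 0 <= W by rewrite /W; lra.
have LW : L * W < delta.
  rewrite mulrC -ltr_pdivlMr //; move: ba dc; rewrite /W invfM mulrA.
  rewrite (_ : delta / L = delta / 2 / L + delta / 2 / L); last by field; rewrite gt_eqF.
  by move: (delta / 2 / L) => u; lra.
have EM t th : a <= t <= b -> c <= th <= d -> cabs (E t th) <= e' * (L * W).
  move=> tab thcd; have Gd := Gdist t th tab thcd.
  have := hd (z0 + G t th).
  rewrite (_ : z0 + G t th - (z0 + G x y) = G t th - G x y); last by ring.
  move=> /(_ (le_lt_trans Gd LW)) h; apply: (le_trans h).
  by rewrite ler_wpM2l // ltW.
have := I_bound scE ab cd (mulr_ge0 (ltW e'0) (mulr_ge0 (ltW L0) W0)) EM.
rewrite -/W (_ : 4 * (e' * (L * W)) * (K + t0^-1) * W = e * W ^+ 2) //.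
by rewrite /e'; move: (K + t0^-1) (lt0r_neq0 Kt) => T T0; field; rewrite T0 (lt0r_neq0 L0).
Qed.

(** By periodicity the sides th = 0 and th = 2 pi of the rectangle cancel, which leaves the outer
    circle and the contracted one. *)
Lemma cI_homotopy : cI 0 (2 * pi) (fun th => f (zeta th) * kappa th) =
  cI 0 (2 * pi) (fun th => f (z0 + t0%:C%C * (zeta th - z0)) * kappa th).
Proof.
have pi2 : 0 < 2 * pi :> R by rewrite mulr_gt0 // pi_gt0.
have [s1 s2] := sc_F.
have I0 : I F t0 1 0 (2 * pi) = 0.
  apply: goursat => //.
  - move=> a m b c d /andP[t0a am] /andP[mb b1] _ _.
    rewrite /I (@cI_split _ _ a m b) ?am //; last by apply: ccontM; [exact: s2|].
    rewrite (@cI_split _ (fun t => F t c * P0 t) a m b) ?am //; last by apply: ccontM; [exact: s2|].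
    by ring.
  - move=> a b c m d _ _ /andP[_ cm] /andP[md _].
    rewrite /I (@cI_split _ (fun th => F b th * kappa th) c m d) ?cm //; last exact: ccontM.
    rewrite (@cI_split _ (fun th => F a th * kappa th) c m d) ?cm //; last exact: ccontM.
    by ring.
  - move=> x y hx hy e e0; have [delta d0 h] := I_loc y hx e0; exists delta => // a b c d ha hb.
    by move=> /andP[_ h1] /andP[h2 _]; exact: h.
move/eqP: I0; rewrite /I {3 4}/F /G /zeta circ_2pi subrr subr0 subr_eq0 => /eqP.
rewrite {1 2}/F /G !clE ?lexx ?(ltW t01) //.
by under eq_fun do rewrite mul1r addrC subrK.
Qed.

End Homotopy.

(** As the circle contracts to z0, continuity of f replaces it by f(z0). The integral of kappa stays
    as a factor and is computed in [cI_kappa]. *)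
Lemma cauchy_winding : cI 0 (2 * pi) (fun th => f (zeta th) * kappa th) = f z0 * cI 0 (2 * pi) kappa.
Proof.
have pi2 : 0 < 2 * pi :> R by rewrite mulr_gt0 // pi_gt0.
apply/eqP; rewrite -subr_eq0 -cabs_eq0; apply/negPn/negP => h.
have {}h : 0 < cabs (cI 0 (2 * pi) (fun th => f (zeta th) * kappa th) - f z0 * cI 0 (2 * pi) kappa).
  by rewrite lt_def h cabs_ge0.
set w := cabs _ in h.
pose e := w / (2 * (2 * K * (2 * pi))).
have e0 : 0 < e by apply: divr_gt0 => //; do 2 (apply: mulr_gt0 => //); exact: mulr_gt0.
have [delta d0 hd] := cdiff_cont (df (ltW z0r)) e0.
pose t0 := Num.min (1 / 2) (delta / (4 * rho)).
have t00 : 0 < t0 by rewrite lt_min !divr_gt0 // mulr_gt0.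
have t01 : t0 < 1 by rewrite gt_min; apply/orP; left; lra.
have t0d : t0 * (2 * rho) < delta.
  have : t0 <= delta / (4 * rho) by rewrite ge_min lexx orbT.
  by rewrite ler_pdivlMr ?mulr_gt0 //; lra.
have : w <= 2 * (e * K) * (2 * pi - 0).
  have cF : ccont (fun th => f (z0 + t0%:C%C * (zeta th - z0))).
    apply: (@ccont_comp _ f).
      by apply: ccontD; [exact: ccont_cst|apply: ccontZ; apply: ccontD; [exact: ccont_circ|exact: ccont_cst]].
    move=> th; apply/cdiff_cont/df.
    rewrite (_ : z0 + _ = (1 - t0)%:C%C * z0 + t0%:C%C * zeta th); last first.
      by rewrite rmorphB rmorph1; ring.
    apply: (le_trans (cabsD _ _)); rewrite !cabsM !cabs_real cabs_circ ?(ltW rho0) //.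
    rewrite !ger0_norm ?(ltW t00) ?subr_ge0 ?(ltW t01) //.
    have : (1 - t0) * cabs z0 <= (1 - t0) * rho by rewrite ler_wpM2l ?subr_ge0 ?(ltW t01) // ltW.
    lra.
  rewrite /w (cI_homotopy t00 t01) -cIZ // -[- cI _ _ _]mulN1r -cIZ; last exact: ccontZ.
  rewrite -cID; [|exact: ccontM|by do 2 apply: ccontZ].
  apply: cI_bound; first exact: ltW.
    by apply: ccontD; [exact: ccontM|do 2 apply: ccontZ].
  move=> th _; rewrite mulN1r -mulrBl cabsM ler_pM ?cabs_ge0 // ltW //.
  apply: hd; rewrite addrAC subrr add0r cabsM cabs_real gtr0_norm //.
  by apply: le_lt_trans t0d; rewrite ler_wpM2l ?(ltW t00).
rewrite subr0 /e (_ : 2 * _ * _ = w / 2); first by lra.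
by move: (2 * pi) pi2 => T T0; field; rewrite (gt_eqF T0) (gt_eqF K0).
Qed.

End CauchyFormula.
End Cauchy.

(** * Taylor expansion on a disk *)

Section Taylor.
Variable R : realType.
Local Notation C := R[i].
Local Notation cabs := (cabs R).
Implicit Types (f : C -> C) (a b : nat -> C).

Lemma cI_conj (h : R -> C) (a b : R) : ccont h -> cI a b (fun x => conjc (h x)) = conjc (cI a b h).
Proof.
move=> [hr hi]; rewrite /cI /=.
have -> : (fun x => complex.Re (conjc (h x))) = (fun x => complex.Re (h x)).
  by apply/funext => x; case: (h x).
have -> : (fun x => complex.Im (conjc (h x))) = (fun x => -1 * complex.Im (h x)).
  by apply/funext => x; case: (h x) => ? ? /=; rewrite mulN1r.
by rewrite RintegralZl ?mulN1r //; exact: cont_integrable.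
Qed.

(** The remainder is exactly k c^2 (y - z)^2 / ((k - c y) u^2) with u = k - c z, and |k - c y| stays
    above |u|/2 near z. *)
Lemma cdiff_recip (k c z : C) : k - c * z != 0 -> cdiff (fun y => k / (k - c * y)) z.
Proof.
move=> nz; exists (k * c / (k - c * z) ^+ 2) => e e0.
set u := k - c * z in nz *; have u0 : 0 < cabs u by rewrite cabs_gt0.
pose B := cabs k * cabs c ^+ 2 * 2 / cabs u ^+ 3 + 1.
have B0 : 0 < B.
  by rewrite ltr_wpDl // divr_ge0 ?exprn_ge0 ?mulr_ge0 ?cabs_ge0 ?exprn_ge0 ?cabs_ge0.
exists (Num.min (e / B) (cabs u / 2 / (cabs c + 1))).
  by rewrite lt_min !divr_gt0 // ltr_wpDl // cabs_ge0.
move=> y; rewrite lt_min => /andP[y1 y2].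
have c1 : 0 < cabs c + 1 by rewrite ltr_wpDl // cabs_ge0.
have hv : cabs u / 2 < cabs (k - c * y).
  have := cabsB_ge u (c * (y - z)).
  rewrite (_ : u - c * (y - z) = k - c * y); last by rewrite /u; ring.
  move: y2; rewrite ltr_pdivlMr // cabsM.
  have := cabs_ge0 (y - z); move: (cabs (y - z)) (cabs c) (cabs u) (cabs (_ - _)) => p q s t.
  by move=> p0; rewrite mulrDr mulr1; lra.
have v0 : 0 < cabs (k - c * y) by apply: lt_trans hv; rewrite divr_gt0.
have vn : k - c * y != 0 by rewrite -cabs_gt0.
rewrite (_ : _ - _ = k * c ^+ 2 * (y - z) ^+ 2 / ((k - c * y) * u ^+ 2)); last first.
  have -> : k - c * y = u - c * (y - z) by rewrite /u; ring.
  have vn' : u - c * (y - z) != 0 by rewrite (_ : u - c * (y - z) = k - c * y) // /u; ring.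
  by field; rewrite nz vn'.
rewrite cabsM cabsV [cabs (k * _ * _)]cabsM [cabs (k * _)]cabsM [cabs (_ * u ^+ 2)]cabsM !cabsX.
rewrite [cabs (y - z) ^+ 2]expr2.
apply: (@le_trans _ _ (B * cabs (y - z) * cabs (y - z))); last first.
  rewrite ler_wpM2r ?cabs_ge0 // mulrC -ler_pdivlMr //; exact: ltW.
rewrite (_ : _ / _ = cabs k * cabs c ^+ 2 / (cabs (k - c * y) * cabs u ^+ 2) * cabs (y - z) * cabs (y - z)); last by ring.
do 2 (rewrite ler_wpM2r ?cabs_ge0 //).
apply: (@le_trans _ _ (cabs k * cabs c ^+ 2 * 2 / cabs u ^+ 3)); last by rewrite /B lerDl.
rewrite -!mulrA; apply: ler_wpM2l; first exact: cabs_ge0.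
do 2 (apply: ler_wpM2l; first exact: cabs_ge0).
have u3 : 0 < cabs u ^+ 3 by rewrite exprn_gt0.
have u2 : 0 < cabs u ^+ 2 by rewrite exprn_gt0.
rewrite ler_pdivlMr // [leLHS]mulrC ler_pdivrMr ?mulr_gt0 // [cabs u ^+ 3]exprS [leRHS]mulrA.
apply: ler_wpM2r; first exact: ltW.
by rewrite mulrC -ler_pdivrMr //; exact: ltW.
Qed.

(** On the circle the conjugate of kappa is rho^2 / (rho^2 - conj(z0) w), differentiable on the
    closed disk with value 1 at the centre. [cauchy_winding] at 0, where the kernel is constantly 1,
    evaluates its integral. *)
Lemma cI_kappa (rho : R) (z0 : C) : cabs z0 < rho ->
  cI 0 (2 * pi) (fun th => circ rho th / (circ rho th - z0)) = (2 * pi)%:C%C.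
Proof.
move=> z0r; have r0 : 0 < rho by exact: le_lt_trans (cabs_ge0 _) z0r.
have pi2 : 0 < 2 * pi :> R by rewrite mulr_gt0 // pi_gt0.
have zn th : circ rho th != 0 by rewrite -cabs_gt0 cabs_circ // ltW.
have zzn th : circ rho th - z0 != 0.
  rewrite -cabs_gt0; apply: lt_le_trans (cabsB_ge _ _).
  by rewrite cabs_circ ?subr_gt0 // ltW.
pose k : C := (rho ^+ 2)%:C%C.
have kz th : k = circ rho th * conjc (circ rho th).
  rewrite -sqr_normc normr_cabs cabs_circ ?(ltW r0) // -rmorphXn //.
have hk z : cabs z <= rho -> k - conjc z0 * z != 0.
  move=> zr; rewrite -cabs_gt0; apply: lt_le_trans (cabsB_ge _ _).
  rewrite subr_gt0 cabsM cabsJ cabs_real ger0_norm ?sqr_ge0 // expr2.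
  have [->|nz0] := eqVneq z0 0; first by rewrite cabs0 mul0r mulr_gt0.
  apply: (@le_lt_trans _ _ (cabs z0 * rho)); first by rewrite ler_wpM2l ?cabs_ge0.
  by rewrite ltr_pM2r.
have df z : cabs z <= rho -> cdiff (fun y => k / (k - conjc z0 * y)) z.
  by move=> zr; apply: cdiff_recip; exact: hk.
have := @cauchy_winding R _ rho 0 _ df; rewrite cabs0 => /(_ r0).
rewrite mulr0 subr0 divff; last first.
  by have := hk 0; rewrite mulr0 subr0; apply; rewrite cabs0 ltW.
have -> : (fun th => circ rho th / (circ rho th - 0)) = fun=> 1.
  by apply/funext => th; rewrite subr0 divff.
rewrite cI_cst ?(ltW pi2) // !mul1r subr0 => h.
apply: (can_inj (@conjcK R)); rewrite conjc_real -h -cI_conj; last first.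
  apply: ccontM; first exact: ccont_circ.
  by apply: ccont_inv => //; apply: ccontD; [exact: ccont_circ|exact: ccont_cst].
congr cI; apply/funext => th; rewrite subr0 divff // mulr1.
have -> : conjc (circ rho th / (circ rho th - z0)) =
    conjc (circ rho th) / (conjc (circ rho th) - conjc z0) by rewrite rmorphM fmorphV rmorphB.
have cz : conjc (circ rho th) - conjc z0 != 0 by rewrite -rmorphB conjc_eq0.
rewrite {1 2}(kz th).
have kzn : circ rho th * conjc (circ rho th) - conjc z0 * circ rho th != 0.
  by rewrite (mulrC _ (circ _ _)) -mulrBr mulf_neq0.
by field; rewrite cz kzn.
Qed.

Lemma ccont_bounded (h : R -> C) (a b : R) : a <= b -> ccont h ->
  exists M, forall x, a <= x <= b -> cabs (h x) <= M.
Proof.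
move=> ab [hr hi].
have bd (g : R -> R) : continuous g -> exists M, forall x, a <= x <= b -> `|g x| <= M.
  move=> cg; have [|c _ hc] := @EVT_max _ (fun x => `|g x|) a b ab.
    by apply: continuous_subspaceT => x; apply: cvg_norm; exact: cg.
  by exists `|g c| => x xab; apply: hc; rewrite in_itv.
have [M hM] := bd _ hr; have [M' hM'] := bd _ hi.
exists (M + M') => x xab; apply: (le_trans (cabs_le _)).
by apply: lerD; [exact: hM|exact: hM'].
Qed.

Lemma taylor_disc f (rho : R) : 0 < rho -> (forall z, cabs z <= rho -> cdiff f z) ->
  exists a M, (forall n, cabs (a n) * rho ^+ n <= M) /\
  forall z, cabs z < rho -> ccvg (fun N => \sum_(n < N) a n * z ^+ n) (f z).
Proof.
move=> r0 df; have pi2 : 0 < 2 * pi :> R by rewrite mulr_gt0 // pi_gt0.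
have zn th : circ rho th != 0 by rewrite -cabs_gt0 cabs_circ // ltW.
pose F th := f (circ rho th).
have cF : ccont F.
  apply: (@ccont_comp _ f); first exact: ccont_circ.
  by move=> th; apply/cdiff_cont/df; rewrite cabs_circ // ltW.
have [M hM] := ccont_bounded (ltW pi2) cF.
have M0 : 0 <= M by apply: le_trans (cabs_ge0 _) (hM 0 _); rewrite lexx ltW.
have cpow n : ccont (fun th => (circ rho th)^-1 ^+ n).
  elim: n => [|n IH]; first by under eq_fun do rewrite expr0; exact: ccont_cst.
  under eq_fun do rewrite exprS; apply: ccontM => //.
  by apply: ccont_inv => //; exact: ccont_circ.
pose c : C := (2 * pi)%:C%C.
have c0 : c != 0 by rewrite -cabs_eq0 cabs_real normr_eq0 gt_eqF.
pose a n := c^-1 * cI 0 (2 * pi) (fun th => F th * (circ rho th)^-1 ^+ n).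
have cFp n : ccont (fun th => F th * (circ rho th)^-1 ^+ n) by exact: ccontM.
have rest n (k : R -> C) B : ccont k -> 0 <= B -> (forall th, cabs (k th) <= B) ->
    cabs (c^-1 * cI 0 (2 * pi) (fun th => F th * (circ rho th)^-1 ^+ n * k th)) <= 2 * (M * B) * rho ^- n.
  move=> ck B0 hk; rewrite cabsM cabsV cabs_real gtr0_norm // mulrC ler_pdivrMr //.
  have := @cI_bound _ (fun th => F th * (circ rho th)^-1 ^+ n * k th) 0 (2 * pi) (M * rho ^- n * B) (ltW pi2).
  rewrite subr0 => h; apply: (le_trans (h _ _)).
  - exact: ccontM.
  - move=> th hth; rewrite !cabsM cabsX cabsV cabs_circ ?(ltW r0) // exprVn.
    apply: ler_pM; rewrite ?mulr_ge0 ?cabs_ge0 ?invr_ge0 ?exprn_ge0 ?(ltW r0) //.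
    by apply: ler_wpM2r; [rewrite invr_ge0 exprn_ge0 // ltW|exact: hM].
  - by rewrite le_eqVlt; apply/orP; left; apply/eqP; ring.
exists a, (2 * (M * 1)); split.
  move=> n; rewrite -ler_pdivlMr ?exprn_gt0 //.
  have := @rest n (fun=> 1) 1 (ccont_cst _) ler01 (fun=> _); rewrite cabs1 => /(_ (fun=> lexx _)).
  by under eq_fun do rewrite mulr1.
move=> z zr.
pose kap th := circ rho th / (circ rho th - z).
have zzn th : circ rho th - z != 0.
  rewrite -cabs_gt0; apply: lt_le_trans (cabsB_ge _ _).
  by rewrite cabs_circ ?subr_gt0 // ltW.
have ckap : ccont kap.
  apply: ccontM; first exact: ccont_circ.
  by apply: ccont_inv => //; apply: ccontD; [exact: ccont_circ|exact: ccont_cst].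
pose K := rho / (rho - cabs z).
have K0 : 0 <= K by rewrite divr_ge0 ?subr_ge0 ?ltW.
have kapK th : cabs (kap th) <= K.
  rewrite cabsM cabsV cabs_circ ?(ltW r0) //; apply: ler_wpM2l; first exact: ltW.
  rewrite lef_pV2 ?posrE ?subr_gt0 ?cabs_gt0 //.
  by rewrite -[X in X - _](cabs_circ th (ltW r0)) cabsB_ge.
(* Induction on N with w/(w - z) = 1 + (z/w) w/(w - z): an exact remainder, so that no sum is
   exchanged with an integral. *)
have main N : f z = \sum_(n < N) a n * z ^+ n +
    z ^+ N * (c^-1 * cI 0 (2 * pi) (fun th => F th * (circ rho th)^-1 ^+ N * kap th)).
  elim: N => [|N IH].
    rewrite big_ord0 add0r expr0 mul1r; under [X in cI _ _ X]eq_fun do rewrite expr0 mulr1.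
    by rewrite cauchy_winding // cI_kappa // mulrC mulfK.
  rewrite IH big_ord_recr /= -addrA; congr (_ + _).
  have -> : cI 0 (2 * pi) (fun th => F th * (circ rho th)^-1 ^+ N * kap th) =
      cI 0 (2 * pi) (fun th => F th * (circ rho th)^-1 ^+ N) +
      z * cI 0 (2 * pi) (fun th => F th * (circ rho th)^-1 ^+ N.+1 * kap th); last by rewrite /a exprS; ring.
  rewrite -cIZ; last exact: ccontM.
  rewrite -cID //; last by apply: ccontZ; exact: ccontM.
  congr cI; apply/funext => th; rewrite /kap exprS.
  set p := _ ^+ N; by field; rewrite zzn zn.
apply: (@ccvg_le _ _ _ (fun N => 2 * (M * K) * (cabs z / rho) ^+ N)).
  move=> N; rewrite (main N) opprD addrA subrr add0r cabsN cabsM cabsX.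
  rewrite expr_div_n mulrCA ler_wpM2l ?exprn_ge0 ?cabs_ge0 //.
  exact: rest.
rewrite -[X in _ --> X](mulr0 (2 * (M * K))); apply: cvgMr; apply: cvg_expr.
by rewrite ger0_norm ?divr_ge0 ?cabs_ge0 ?(ltW r0) // ltr_pdivrMr // mul1r.
Qed.

End Taylor.

(** * Analytic functions on the disk *)

Section PowerSeries.
Variable R : realType.
Local Notation C := R[i].
Local Notation cabs := (cabs R).
Implicit Types (f : C -> C) (a b : nat -> C) (z : C).

Definition psc a z l := ccvg (fun N => \sum_(n < N) a n * z ^+ n) l.

Lemma ccvg_bound (u : nat -> C) l (B : R) : ccvg u l -> (forall n, cabs (u n) <= B) -> cabs l <= B.
Proof.
move=> /ccvg_cabs ul uB; rewrite -(cvg_lim _ ul) //; apply: limr_le.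
  by apply/cvg_ex; eexists; exact: ul.
by near=> k; exact: uB.
Unshelve. all: by end_near. Qed.

Lemma ps_geom a z (r M : R) : 0 < r -> (forall n, cabs (a n) * r ^+ n <= M) -> cabs z < r ->
  forall n, cabs (a n * z ^+ n) <= M * (cabs z / r) ^+ n.
Proof.
move=> r0 aM zr n; rewrite cabsM cabsX expr_div_n mulrA ler_pdivlMr ?exprn_gt0 // mulrAC.
by rewrite ler_wpM2r // exprn_ge0 // cabs_ge0.
Qed.

Lemma ps_tail a z l (r M : R) : 0 < r -> (forall n, cabs (a n) * r ^+ n <= M) -> cabs z < r ->
  psc a z l -> forall n, cabs (l - \sum_(i < n) a i * z ^+ i) <= M / (1 - cabs z / r) * (cabs z / r) ^+ n.
Proof.
move=> r0 aM zr hl.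
have th01 : 0 <= cabs z / r < 1.
  by rewrite divr_ge0 ?cabs_ge0 ?(ltW r0) //= ltr_pdivrMr // mul1r.
have [l' hl'] := geom_series th01 (ps_geom r0 aM zr).
suff -> : l = l' by [].
apply: (ccvg_unique hl).
apply: (ccvg_le (e := fun n => M / (1 - cabs z / r) * (cabs z / r) ^+ n)).
  by move=> n; rewrite cabsB.
rewrite -[X in _ --> X](mulr0 (M / (1 - cabs z / r))); apply: cvgMr; apply: cvg_expr.
by rewrite ger0_norm; case/andP: th01.
Qed.

Lemma ps_exists a z (r M : R) : 0 < r -> (forall n, cabs (a n) * r ^+ n <= M) -> cabs z < r ->
  exists l, psc a z l.
Proof.
move=> r0 aM zr.
have th01 : 0 <= cabs z / r < 1.
  by rewrite divr_ge0 ?cabs_ge0 ?(ltW r0) //= ltr_pdivrMr // mul1r.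
have [l hl] := geom_series th01 (ps_geom r0 aM zr); exists l.
apply: (ccvg_le (e := fun n => M / (1 - cabs z / r) * (cabs z / r) ^+ n)).
  by move=> n; rewrite cabsB.
rewrite -[X in _ --> X](mulr0 (M / (1 - cabs z / r))); apply: cvgMr; apply: cvg_expr.
by rewrite ger0_norm; case/andP: th01.
Qed.

(** At a small real x, the first nonzero term |a_k| x^k would be at most D x^(k+1), which fails for
    x <= |a_k| / (2 D). *)
Lemma ps_zero a (r M : R) : 0 < r -> (forall n, cabs (a n) * r ^+ n <= M) ->
  (forall z, cabs z < r -> psc a z 0) -> forall n, a n = 0.
Proof.
move=> r0 aM h; apply: ltn_ind => k IH; apply/eqP; rewrite -cabs_eq0; apply/negPn/negP => ak.
have {}ak : 0 < cabs (a k) by rewrite lt_def ak cabs_ge0.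
have M0 : 0 <= M by apply: le_trans (aM 0%N); rewrite mulr_ge0 ?cabs_ge0 ?exprn_ge0 ?ltW.
pose D := M / (1 - 1 / 2) / r ^+ k.+1 + 1.
have D0 : 0 < D.
  by rewrite ltr_wpDl // !divr_ge0 // ?exprn_ge0 ?(ltW r0) //; lra.
pose x := Num.min (r / 2) (cabs (a k) / (2 * D)).
have x0 : 0 < x by rewrite lt_min !divr_gt0 // mulr_gt0.
have xr : x <= r / 2 by rewrite ge_min lexx.
have xa : x <= cabs (a k) / (2 * D) by rewrite ge_min lexx orbT.
have cx : cabs x%:C%C = x by rewrite cabs_real gtr0_norm.
have zr : cabs (x%:C%C : C) < r by rewrite cx; lra.
have := ps_tail r0 aM zr (h _ zr) k.+1.
rewrite sub0r cabsN big_ord_recr /= big1 ?add0r => [|i _]; last by rewrite IH ?mul0r.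
rewrite cabsM cabsX cx => hk.
have xk : 0 < x ^+ k by rewrite exprn_gt0.
have : cabs (a k) * x ^+ k <= D * x * x ^+ k.
  apply: (le_trans hk).
  rewrite (_ : M / (1 - x / r) * (x / r) ^+ k.+1 = M / r ^+ k.+1 / (1 - x / r) * x * x ^+ k); last first.
    by rewrite expr_div_n (exprS x); move: (r ^+ k.+1)^-1 (1 - x / r)^-1 => ? ?; ring.
  rewrite ler_pM2r // ler_pM2r //.
  apply: (@le_trans _ _ (M / (1 - 1 / 2) / r ^+ k.+1)); last by rewrite /D lerDl.
  rewrite [leRHS]mulrAC ler_wpM2l //; first by rewrite divr_ge0 ?exprn_ge0 ?(ltW r0).
  have : x / r <= 1 / 2 by rewrite ler_pdivrMr //; lra.
  by move=> xr2; rewrite lef_pV2 ?posrE; lra.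
rewrite ler_pM2r // => h1.
have : D * x <= cabs (a k) / 2.
  apply: (le_trans (ler_wpM2l (ltW D0) xa)).
  by rewrite [leLHS](_ : _ = cabs (a k) / 2) //; field; rewrite gt_eqF.
lra.
Qed.

(** Radius of convergence at least 1, stated as Cauchy estimates. *)
Definition hseq a := forall r : R, 0 < r < 1 -> exists M, forall n, cabs (a n) * r ^+ n <= M.

(** The sum of the series, extended by 0 off the disk as in [L2a], so that Bergman functions are
    equal as functions on all of [C]. *)
Definition fnD a z : C := if cabs z < 1 then xget 0 [set l | psc a z l] else 0.

Lemma between01 z : cabs z < 1 -> exists2 r : R, 0 < r < 1 & cabs z < r.
Proof.
move=> z1; exists ((1 + cabs z) / 2); last by lra.
by have := cabs_ge0 z; lra.
Qed.

Lemma fnD_cvg a z : hseq a -> cabs z < 1 -> psc a z (fnD a z).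
Proof.
move=> ha z1; rewrite /fnD z1.
have [r r01 zr] := between01 z1; have [M hM] := ha r r01.
have r0 : 0 < r by case/andP: r01.
have [l hl] := ps_exists r0 hM zr.
by case: xgetP => [y _ //|/(_ l)].
Qed.

Lemma fnD_unique a z l : hseq a -> cabs z < 1 -> psc a z l -> fnD a z = l.
Proof. by move=> ha z1; apply: ccvg_unique; exact: fnD_cvg. Qed.

Lemma fnD_out a z : 1 <= cabs z -> fnD a z = 0.
Proof. by rewrite /fnD ltNge => ->. Qed.

Lemma fnD_lin c a b : hseq a -> hseq b ->
  fnD (fun n => c * a n + b n) = fun z => c * fnD a z + fnD b z.
Proof.
move=> ha hb.
have hab : hseq (fun n => c * a n + b n).
  move=> r r01; have [M hM] := ha r r01; have [M' hM'] := hb r r01.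
  have r0 : 0 <= r by case/andP: r01 => /ltW.
  exists (cabs c * M + M') => n; apply: (@le_trans _ _ (cabs c * (cabs (a n) * r ^+ n) + cabs (b n) * r ^+ n)).
    by rewrite mulrA -cabsM -mulrDl ler_wpM2r ?exprn_ge0 // cabsD.
  by apply: lerD => //; rewrite ler_wpM2l // cabs_ge0.
apply/funext => z; have [z1|z1] := ltP (cabs z) 1; last by rewrite !fnD_out // mulr0 addr0.
apply: fnD_unique => //; rewrite /psc.
rewrite (_ : (fun N => _) = fun N => c * (\sum_(n < N) a n * z ^+ n) + \sum_(n < N) b n * z ^+ n).
  by apply: ccvgD; [apply: ccvgZ|]; exact: fnD_cvg.
apply/funext => N; rewrite mulr_sumr -big_split; apply: eq_bigr => n _.
by rewrite mulrDl mulrA.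
Qed.

Lemma fnD_inj a b : hseq a -> hseq b -> (forall z, cabs z < 1 -> fnD a z = fnD b z) -> a = b.
Proof.
move=> ha hb ab; apply/funext => n; apply/eqP; rewrite -subr_eq0; apply/eqP.
have r01 : 0 < (1 / 2 : R) < 1 by lra.
have [M hM] := ha _ r01; have [M' hM'] := hb _ r01.
apply: (@ps_zero (fun n => a n - b n) (1 / 2) (M + M')).
- by lra.
- move=> k; apply: le_trans (lerD (hM k) (hM' k)); rewrite -mulrDl.
  apply: ler_wpM2r; first by rewrite exprn_ge0 // divr_ge0.
  by apply: (le_trans (cabsD _ _)); rewrite cabsN.
- move=> z z12; have z1 : cabs z < 1 by lra.
  rewrite /psc (_ : (fun N => _) = fun N => \sum_(n < N) a n * z ^+ n - \sum_(n < N) b n * z ^+ n).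
    by have := ccvgD (fnD_cvg ha z1) (ccvgN (fnD_cvg hb z1)); rewrite ab // subrr.
  by apply/funext => N; rewrite -sumrB; apply: eq_bigr => i _; rewrite mulrBl.
Qed.

(** Expansions obtained at different radii agree by [ps_zero], so a single sequence satisfies the
    estimates at every radius. *)
Lemma taylor f : (forall z, cabs z < 1 -> cdiff f z) -> (forall z, 1 <= cabs z -> f z = 0) ->
  exists2 a, hseq a & f = fnD a.
Proof.
move=> df f0.
have ex (r : R) : 0 < r < 1 -> exists a M, (forall n, cabs (a n) * r ^+ n <= M) /\
    forall z, cabs z < r -> psc a z (f z).
  move=> /andP[r0 r1]; apply: taylor_disc => // z zr; apply: df; exact: le_lt_trans r1.
have h01 : 0 < (1 / 2 : R) < 1 by lra.
have [a [M0 [aM0 ha0]]] := ex _ h01.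
have aE (r : R) b M : 0 < r < 1 -> (forall n, cabs (b n) * r ^+ n <= M) ->
    (forall z, cabs z < r -> psc b z (f z)) -> a = b.
  move=> r01 bM hb; apply/funext => n; apply/eqP; rewrite -subr_eq0; apply/eqP.
  pose s := Num.min r (1 / 2).
  have s0 : 0 < s by rewrite lt_min; apply/andP; split; lra.
  have sr : s <= r by rewrite ge_min lexx.
  have sh : s <= 1 / 2 by rewrite ge_min lexx orbT.
  apply: (@ps_zero (fun n => a n - b n) s (M0 + M)) => //.
    move=> k; apply: le_trans (lerD (aM0 k) (bM k)).
    apply: (@le_trans _ _ (cabs (a k) * s ^+ k + cabs (b k) * s ^+ k)).
      rewrite -mulrDl ler_wpM2r ?exprn_ge0 ?(ltW s0) //.
      by apply: (le_trans (cabsD _ _)); rewrite cabsN.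
    by apply: lerD; (apply: ler_wpM2l; first exact: cabs_ge0);
      apply: lerXn2r => //; rewrite ?nnegrE ?(ltW s0) //; lra.
  move=> z zs; rewrite /psc.
  rewrite (_ : (fun N => _) = fun N => \sum_(n < N) a n * z ^+ n - \sum_(n < N) b n * z ^+ n).
    have h1 := ha0 z (lt_le_trans zs sh); have h2 := hb z (lt_le_trans zs sr).
    by have := ccvgD h1 (ccvgN h2); rewrite subrr.
  by apply/funext => N; rewrite -sumrB; apply: eq_bigr => i _; rewrite mulrBl.
have ha : hseq a.
  by move=> r r01; have [b [M [bM hb]]] := ex r r01; exists M; rewrite (aE _ _ _ r01 bM hb).
exists a => //; apply/funext => z; have [z1|z1] := ltP (cabs z) 1; last by rewrite fnD_out // f0.
apply/esym/fnD_unique => //; have [r r01 zr] := between01 z1.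
by have [b [M [bM hb]]] := ex r r01; rewrite (aE _ _ _ r01 bM hb); exact: hb.
Qed.

(** Second-order remainder of a power; both sides carry a factor r so that the exponent n - 1 does
    not occur. *)
Lemma pow_taylor2 (y z : C) (r : R) n : 0 < r -> cabs y <= r -> cabs z <= r ->
  cabs (y ^+ n.+1 - z ^+ n.+1 - n.+1%:R * z ^+ n * (y - z)) * r <=
    n.+1%:R * n.+1%:R * r ^+ n * cabs (y - z) ^+ 2.
Proof.
move=> r0 yr zr.
have pw k : cabs (y ^+ k.+1 - z ^+ k.+1) <= k.+1%:R * r ^+ k * cabs (y - z).
  elim: k => [|k IH]; first by rewrite !expr1 expr0 !mul1r.
  rewrite (_ : _ - _ = y ^+ k.+1 * (y - z) + (y ^+ k.+1 - z ^+ k.+1) * z); last by rewrite !(exprS _ k.+1); ring.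
  apply: (le_trans (cabsD _ _)); rewrite !cabsM cabsX.
  rewrite -[k.+2]addn1 natrD mulrDl mulrDl addrC; apply: lerD.
    apply: (@le_trans _ _ (k.+1%:R * r ^+ k * cabs (y - z) * r)).
      by apply: ler_pM; rewrite ?cabs_ge0.
    by rewrite exprS le_eqVlt; apply/orP; left; apply/eqP; ring.
  rewrite mul1r ler_wpM2r ?cabs_ge0 //; apply: lerXn2r; rewrite ?nnegrE ?cabs_ge0 //; exact: ltW.
elim: n => [|n IH].
  by rewrite !expr1 !expr0 !mul1r subrr cabs0 mul0r sqr_ge0.
rewrite (_ : y ^+ n.+2 - _ - _ = z * (y ^+ n.+1 - z ^+ n.+1 - n.+1%:R * z ^+ n * (y - z)) +
    (y - z) * (y ^+ n.+1 - z ^+ n.+1)); last first.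
  rewrite (_ : n.+2%:R = n.+1%:R + 1 :> C); last by rewrite natr1.
  by rewrite (exprS _ n.+1) (exprS z n.+1) (exprS z n); ring.
set E := y ^+ n.+1 - _ - _ in IH *.
apply: (@le_trans _ _ ((cabs z * cabs E + cabs (y - z) * cabs (y ^+ n.+1 - z ^+ n.+1)) * r)).
  by rewrite ler_wpM2r ?(ltW r0) // -!cabsM cabsD.
apply: (@le_trans _ _ (r * (n.+1%:R * n.+1%:R * r ^+ n * cabs (y - z) ^+ 2) +
    cabs (y - z) * (n.+1%:R * r ^+ n * cabs (y - z)) * r)).
  rewrite mulrDl; apply: lerD.
    by rewrite -mulrA; apply: ler_pM; rewrite ?cabs_ge0 // mulr_ge0 ?cabs_ge0 // ltW.
  by rewrite ler_wpM2r ?(ltW r0) // ler_wpM2l ?cabs_ge0.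
rewrite (_ : _ + _ = (n.+1%:R * n.+1%:R + n.+1%:R) * (r ^+ n.+1 * cabs (y - z) ^+ 2)); last first.
  by rewrite (exprS r); ring.
rewrite -[leRHS]mulrA ler_wpM2r ?mulr_ge0 ?exprn_ge0 ?cabs_ge0 ?(ltW r0) //.
rewrite -[n.+2]addn1 natrD.
by have : (0 : R) <= n.+1%:R by []; move: (n.+1%:R) => x x0; lra.
Qed.

Lemma hseq_nat a : hseq a -> hseq (fun n => n%:R * a n).
Proof.
move=> ha r r01; have /andP[r0 r1] := r01.
have s01 : 0 < (1 + r) / 2 < 1 by lra.
have [M hM] := ha _ s01; move: s01 hM; set s := (1 + r) / 2 => s01 hM.
have s0 : 0 < s by case/andP: s01.
have rs : r < s by rewrite /s; lra.
have [K hK] : exists K, forall n, n%:R * (r / s) ^+ n <= K.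
  have q01 : 0 <= r / s < 1 by rewrite divr_ge0 ?(ltW r0) ?(ltW s0) //= ltr_pdivrMr // mul1r.
  have [K [q [K0 /andP[qq0 qq1] hK]]] := nat_geom q01.
  by exists K => n; apply: (le_trans (hK n)); rewrite ler_piMr // exprn_ile1 // ltW.
have M0 : 0 <= M by apply: le_trans (hM 0%N); rewrite mulr_ge0 ?cabs_ge0 ?exprn_ge0 ?ltW.
exists (K * M) => n; rewrite cabsM cabs_nat.
rewrite (_ : _ * _ = n%:R * (r / s) ^+ n * (cabs (a n) * s ^+ n)); last first.
  by rewrite expr_div_n; field; rewrite gt_eqF // exprn_gt0.
have qn : 0 <= (r / s) ^+ n by rewrite exprn_ge0 // divr_ge0 // ltW.
apply: ler_pM => //; first exact: mulr_ge0.
by rewrite mulr_ge0 ?cabs_ge0 ?exprn_ge0 ?(ltW s0).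
Qed.

Lemma hseq_deriv a : hseq a -> hseq (fun n => n.+1%:R * a n.+1).
Proof.
move=> /hseq_nat ha r r01; have [M hM] := ha r r01; exists (M / r) => n.
have r0 : 0 < r by case/andP: r01.
by rewrite ler_pdivlMr // -mulrA -exprSr.
Qed.

Lemma psc_shift a z l : psc a z l -> ccvg (fun N => \sum_(n < N.+1) a n * z ^+ n) l.
Proof. by rewrite /psc /ccvg => h; have := h; rewrite -(cvg_shiftS (fun N => cabs (\sum_(n < N) a n * z ^+ n - l))). Qed.

(** Termwise second-order remainders are summed; they are of order n^2 |a_n| r^n, summable by
    [hseq_nat] used twice at a larger radius. *)
Lemma cdiff_fnD a z : hseq a -> cabs z < 1 -> cdiff (fnD a) z.
Proof.
move=> ha z1; have hb := hseq_deriv ha.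
have [r r01 zr] := between01 z1; have /andP[r0 r1] := r01.
have s01 : 0 < (1 + r) / 2 < 1 by lra.
have [M hM] := hseq_nat (hseq_nat ha) s01; move: s01 hM; set s := (1 + r) / 2 => s01 hM.
have s0 : 0 < s by case/andP: s01.
have rs : r < s by rewrite /s; lra.
have q1 : r / s < 1 by rewrite ltr_pdivrMr // mul1r.
have q0 : 0 <= r / s by rewrite divr_ge0 ?ltW.
pose K := M / (1 - r / s).
have M0 : 0 <= M by apply: le_trans (hM 0%N); rewrite mulr_ge0 ?cabs_ge0 ?exprn_ge0 ?ltW.
have K0 : 0 <= K by rewrite divr_ge0 // subr_ge0 ltW.
pose d := fnD (fun n => n.+1%:R * a n.+1) z.
have main y : cabs y < r -> cabs (fnD a y - fnD a z - d * (y - z)) * r ^+ 2 <= K * cabs (y - z) ^+ 2.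
  move=> yr; rewrite -ler_pdivlMr ?exprn_gt0 //.
  pose u N := (\sum_(n < N.+1) a n * y ^+ n) - (\sum_(n < N.+1) a n * z ^+ n) -
    (y - z) * (\sum_(n < N) n.+1%:R * a n.+1 * z ^+ n).
  apply: (@ccvg_bound u).
    rewrite /u; apply: ccvgD; first apply: ccvgD.
    - by apply: psc_shift; apply: fnD_cvg => //; apply: lt_trans r1.
    - by apply: ccvgN; apply: psc_shift; exact: fnD_cvg.
    - by apply: ccvgN; rewrite (mulrC d); apply: ccvgZ; exact: fnD_cvg.
  move=> N; rewrite ler_pdivlMr ?exprn_gt0 //.
  have -> : u N = \sum_(n < N) a n.+1 * (y ^+ n.+1 - z ^+ n.+1 - n.+1%:R * z ^+ n * (y - z)).
    rewrite /u !big_ord_recl /= !expr0 opprD addrACA subrr add0r -sumrB mulr_sumr -sumrB.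
    by apply: eq_bigr => i _; ring.
  apply: (@le_trans _ _ (\sum_(n < N) cabs (a n.+1 * (y ^+ n.+1 - z ^+ n.+1 - n.+1%:R * z ^+ n * (y - z))) * r ^+ 2)).
    by rewrite -mulr_suml ler_wpM2r ?exprn_ge0 ?(ltW r0) // cabs_sum.
  apply: (@le_trans _ _ (\sum_(n < N) M * cabs (y - z) ^+ 2 * (r / s) ^+ n)).
    apply: ler_sum => n _.
    have h := pow_taylor2 n r0 (ltW yr) (ltW zr).
    rewrite cabsM -mulrA expr2 (mulrA (cabs (_ - _))).
    apply: (@le_trans _ _ (cabs (a n.+1) * (n.+1%:R * n.+1%:R * r ^+ n * cabs (y - z) ^+ 2 * r))).
      by rewrite ler_wpM2l ?cabs_ge0 // ler_wpM2r // ltW.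
    have := hM n.+1; rewrite !cabsM cabs_nat -ler_pdivlMr ?exprn_gt0 // => h2.
    rewrite (_ : cabs (a n.+1) * _ = n.+1%:R * (n.+1%:R * cabs (a n.+1)) * (r ^+ n.+1 * cabs (y - z) ^+ 2)); last first.
      by rewrite (exprS r); ring.
    apply: (le_trans (ler_wpM2r _ h2)); first by rewrite mulr_ge0 ?exprn_ge0 ?cabs_ge0 ?(ltW r0).
    rewrite (_ : M / _ * _ = M * cabs (y - z) ^+ 2 * (r / s) ^+ n.+1); last first.
      by rewrite (expr_div_n r s); ring.
    rewrite ler_wpM2l ?mulr_ge0 ?exprn_ge0 ?cabs_ge0 // exprS ler_piMl ?exprn_ge0 //.
    exact: ltW.
  rewrite -mulr_sumr /K [leRHS]mulrAC ler_wpM2l ?mulr_ge0 ?cabs_ge0 //.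
  rewrite -[leRHS]mul1r ler_pdivlMr ?subr_gt0 // mulrC -opprB mulNr -subrX1.
  by rewrite opprB gerBl exprn_ge0.
exists d => e e0.
exists (Num.min (r - cabs z) (e * r ^+ 2 / (K + 1))).
  by rewrite lt_min subr_gt0 zr divr_gt0 ?mulr_gt0 ?exprn_gt0 // ltr_wpDl.
move=> y; rewrite lt_min => /andP[y1 y2].
have yr : cabs y < r.
  by have := cabsD z (y - z); rewrite addrC subrK; lra.
have := main y yr; rewrite -ler_pdivlMr ?exprn_gt0 // => h; apply: (le_trans h).
move: y2; rewrite ltr_pdivlMr ?ltr_wpDl // mulrDr mulr1 => y2.
rewrite ler_pdivrMr ?exprn_gt0 //; have := cabs_ge0 (y - z).
move: y2; move: (cabs (y - z)) => x y2 x0.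
rewrite [leLHS](_ : _ = K * x * x) ?[leRHS](_ : _ = e * r ^+ 2 * x); [|ring..].
by rewrite ler_wpM2r // mulrC; move: (x * K) (e * r ^+ 2) y2 => A B; lra.
Qed.

End PowerSeries.

Section Derivable.
Variable R : realType.
Local Notation C := R[i].
Local Notation cabs := (cabs R).

Lemma ltcR0 (e : C) : 0 < e -> e = (complex.Re e)%:C%C /\ 0 < complex.Re e.
Proof.
case: e => x y; rewrite ltcE /= => /andP[/eqP y0 x0]; split => //.
by rewrite [y]y0.
Qed.

(** Positive elements of [R[i]] are the positive reals, so balls for the complex-valued norm are
    balls for [cabs]. *)
Lemma derivable_cdiff (f : C -> C) (z : C) : derivable (f : C^o -> C^o) z 1 <-> cdiff f z.
Proof.
split.
  move=> /cvg_ex[/= d hd]; exists d => e e0.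
  have e0' : 0 < (e%:C%C : C) by rewrite ltcR.
  have /cvgrPdist_le/(_ _ e0') := hd.
  move=> /nbhs_ballP[/= D D0 hD].
  have [DE D0'] := ltcR0 D0; exists (complex.Re D) => // y yz.
  have [->|ny] := eqVneq y z; first by rewrite !subrr mulr0 subr0 cabs0 mulr0.
  have nyz : y - z != 0 by rewrite subr_eq0.
  have := hD (y - z) _ nyz; rewrite /ball /= sub0r normrN DE normr_cabs ltcR => /(_ yz).
  rewrite /= scaler1 /= subrK !normr_cabs lecR => h.
  have -> : f y - f z - d * (y - z) = (y - z) * - (d - (y - z)^-1 * (f y - f z)).
    by rewrite opprB (mulrBr (y - z)) /GRing.scale /= (mulVKf nyz) (mulrC d).
  by rewrite cabsM cabsN mulrC ler_wpM2r ?cabs_ge0.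
move=> [d hd]; apply/cvg_ex; exists d; apply/cvgrPdist_le => /= e e0.
have [eE e0'] := ltcR0 e0.
have [D D0 hD] := hd _ e0'.
have D0' : 0 < (D%:C%C : C) by rewrite ltcR.
apply/nbhs_ballP; exists D%:C%C => //= h.
rewrite /ball /= sub0r normrN normr_cabs ltcR => hD' hn.
rewrite scaler1 eE normr_cabs lecR.
have := hD (h + z); rewrite addrK => /(_ hD') H.
have -> : d - h^-1 *: (f (h + z) - f z) = h^-1 * - (f (h + z) - f z - d * h).
  by rewrite opprB mulrBr mulrCA mulVf // mulr1.
by rewrite cabsM cabsN cabsV mulrC ler_pdivrMr ?cabs_gt0.
Qed.

End Derivable.

(** * Integrals over disks *)

Section DiskIntegral.
Variable R : realType.
Local Notation C := R[i].
Local Notation cabs := (cabs R).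
Local Notation toC := (toC R).
Local Notation T := (measurableTypeR R * measurableTypeR R)%type.
Local Notation mu1 := (@lebesgue_measure R).
Implicit Types (F G : T -> C) (D : set T).

Definition mu2 : {measure set T -> \bar R} := @lam2 R.

Definition cmeas D F := measurable_fun D (fun p => complex.Re (F p) : R) /\
  measurable_fun D (fun p => complex.Im (F p) : R).

Definition cintg D F := mu2.-integrable D (EFin \o (fun p => complex.Re (F p) : R)) /\
  mu2.-integrable D (EFin \o (fun p => complex.Im (F p) : R)).

Definition cint D F : C :=
  (Rintegral mu2 D (fun p => complex.Re (F p)) +i* Rintegral mu2 D (fun p => complex.Im (F p)))%C.

Lemma cmeas_cst D c : cmeas D (fun=> c).
Proof. by split; exact: measurable_cst. Qed.

Lemma cmeasD D F G : cmeas D F -> cmeas D G -> cmeas D (fun p => F p + G p).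
Proof.
move=> [F1 F2] [G1 G2]; split.
  by under eq_fun do rewrite cReD; exact: measurable_funD.
by under eq_fun do rewrite cImD; exact: measurable_funD.
Qed.

Lemma cmeasM D F G : cmeas D F -> cmeas D G -> cmeas D (fun p => F p * G p).
Proof.
move=> [F1 F2] [G1 G2]; split.
  by under eq_fun do rewrite cReM; apply: measurable_funB; exact: measurable_funM.
by under eq_fun do rewrite cImM; apply: measurable_funD; exact: measurable_funM.
Qed.

Lemma cmeas_conj D F : cmeas D F -> cmeas D (fun p => conjc (F p)).
Proof.
move=> [F1 F2]; split.
  by under eq_fun do rewrite cReJ.
by under eq_fun do rewrite cImJ; exact: measurable_funN.
Qed.

Lemma cmeasX D F n : cmeas D F -> cmeas D (fun p => F p ^+ n).
Proof.
move=> mF; elim: n => [|n IH]; first by under eq_fun do rewrite expr0; exact: cmeas_cst.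
by under eq_fun do rewrite exprS; exact: cmeasM.
Qed.

Lemma cmeas_sum D n (F : nat -> T -> C) : (forall i, cmeas D (F i)) ->
  cmeas D (fun p => \sum_(i < n) F i p).
Proof.
move=> mF; elim: n => [|n IH]; first by under eq_fun do rewrite big_ord0; exact: cmeas_cst.
by under eq_fun do rewrite big_ord_recr /=; exact: cmeasD.
Qed.

Lemma cmeas_toC D : cmeas D toC.
Proof. by split; [exact: (measurable_funTS measurable_fst)|exact: (measurable_funTS measurable_snd)]. Qed.

Lemma cmeas_cabs2 D F : cmeas D F -> measurable_fun D (fun p => cabs (F p) ^+ 2 : R).
Proof.
move=> [F1 F2]; under eq_fun do rewrite cabs2.
by apply: measurable_funD; apply: measurable_funX.
Qed.

Lemma cmeas_cvg D (F : nat -> T -> C) G : (forall n, cmeas D (F n)) ->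
  (forall p, D p -> ccvg (fun n => F n p) (G p)) -> cmeas D G.
Proof.
move=> mF FG; split.
  apply: (@measurable_fun_cvg _ _ _ D (fun n p => complex.Re (F n p))) => [n|p Dp].
    by have [] := mF n.
  apply/cvgrPdist_le => /= e e0; have /cvgrPdist_le/(_ _ e0) := FG p Dp.
  apply: filterS => n /=; rewrite sub0r normrN ger0_norm ?cabs_ge0 // => h.
  by apply: le_trans h; rewrite -cReN -cReD cabsB cabs_Re.
apply: (@measurable_fun_cvg _ _ _ D (fun n p => complex.Im (F n p))) => [n|p Dp].
  by have [] := mF n.
apply/cvgrPdist_le => /= e e0; have /cvgrPdist_le/(_ _ e0) := FG p Dp.
apply: filterS => n /=; rewrite sub0r normrN ger0_norm ?cabs_ge0 // => h.
by apply: le_trans h; rewrite -cImN -cImD cabsB cabs_Im.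
Qed.

Lemma cintg_le D F (g : T -> R) : measurable D -> cmeas D F -> mu2.-integrable D (EFin \o g) ->
  (forall p, D p -> cabs (F p) <= g p) -> cintg D F.
Proof.
move=> mD [F1 F2] ig Fg; split.
  apply: le_integrable ig => //; first exact/measurable_EFinP.
  move=> p Dp /=; rewrite lee_fin (le_trans _ (ler_norm _)) //; apply: le_trans (Fg p Dp); exact: cabs_Re.
apply: le_integrable ig => //; first exact/measurable_EFinP.
move=> p Dp /=; rewrite lee_fin (le_trans _ (ler_norm _)) //; apply: le_trans (Fg p Dp); exact: cabs_Im.
Qed.

Lemma cint_le D F (g : T -> R) : measurable D -> cmeas D F -> mu2.-integrable D (EFin \o g) ->
  (forall p, D p -> cabs (F p) <= g p) -> cabs (cint D F) <= 2 * Rintegral mu2 D g.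
Proof.
move=> mD mF ig Fg; have [i1 i2] := cintg_le mD mF ig Fg.
apply: (le_trans (cabs_le _)); rewrite /cint /= mulr_natl mulr2n.
apply: lerD; apply: le_trans (le_normr_Rintegral _ _) _ => //.
  apply: le_Rintegral => // [|p Dp]; first exact: integrable_norm.
  apply: le_trans (Fg p Dp); exact: cabs_Re.
apply: le_Rintegral => // [|p Dp]; first exact: integrable_norm.
apply: le_trans (Fg p Dp); exact: cabs_Im.
Qed.

Lemma cintgD D F G : measurable D -> cintg D F -> cintg D G -> cintg D (fun p => F p + G p).
Proof.
move=> mD [F1 F2] [G1 G2]; split.
  by rewrite /comp; under eq_fun do rewrite cReD EFinD; exact: integrableD.
by rewrite /comp; under eq_fun do rewrite cImD EFinD; exact: integrableD.
Qed.

Lemma cintgZ D c F : measurable D -> cintg D F -> cintg D (fun p => c * F p).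
Proof.
move=> mD [F1 F2]; split; rewrite /comp.
  by under eq_fun do rewrite cReM EFinB !EFinM; apply: integrableB => //; exact: integrableZl.
by under eq_fun do rewrite cImM EFinD !EFinM; apply: integrableD => //; exact: integrableZl.
Qed.

Lemma cintD D F G : measurable D -> cintg D F -> cintg D G ->
  cint D (fun p => F p + G p) = cint D F + cint D G.
Proof.
move=> mD [F1 F2] [G1 G2]; rewrite /cint.
under [X in Rintegral _ _ X]eq_fun do rewrite cReD.
under [X in (_ +i* Rintegral _ _ X)%C]eq_fun do rewrite cImD.
by rewrite !RintegralD //; simpc.
Qed.

Lemma cintZ D c F : measurable D -> cintg D F -> cint D (fun p => c * F p) = c * cint D F.
Proof.
move=> mD [F1 F2]; rewrite /cint.
under [X in Rintegral _ _ X]eq_fun do rewrite cReM.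
under [X in (_ +i* Rintegral _ _ X)%C]eq_fun do rewrite cImM.
have Zl (a : R) (f : T -> R) : mu2.-integrable D (EFin \o f) -> mu2.-integrable D (EFin \o (fun p => a * f p)).
  by move=> fi; rewrite /comp; under eq_fun do rewrite EFinM; exact: integrableZl.
rewrite RintegralB ?RintegralD ?RintegralZl //; try exact: Zl.
by case: c => a b; simpc.
Qed.

Lemma cint_conj D F : measurable D -> cintg D F -> cint D (fun p => conjc (F p)) = conjc (cint D F).
Proof.
move=> mD [F1 F2]; rewrite /cint /=.
under [X in Rintegral _ _ X]eq_fun do rewrite cReJ.
under [X in (_ +i* Rintegral _ _ X)%C]eq_fun do rewrite cImJ -mulN1r.
by rewrite RintegralZl // mulN1r.
Qed.

Lemma cintg_sum D n (F : nat -> T -> C) : measurable D -> (forall i, cintg D (F i)) ->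
  cintg D (fun p => \sum_(i < n) F i p) /\ cint D (fun p => \sum_(i < n) F i p) = \sum_(i < n) cint D (F i).
Proof.
move=> mD iF; elim: n => [|n [IH1 IH2]].
  under eq_fun do rewrite big_ord0; rewrite big_ord0; split; first by split; exact: integrable0.
  by rewrite /cint /= /Rintegral !integral0.
under eq_fun do rewrite big_ord_recr /=; rewrite big_ord_recr /=; split; first exact: cintgD.
by rewrite cintD // IH2.
Qed.

Definition dsk (r : R) : set T := [set p | p.1 ^+ 2 + p.2 ^+ 2 < r ^+ 2].

Lemma measurable_dsk r : measurable (dsk r).
Proof.
have m : measurable_fun setT (fun p : T => p.1 ^+ 2 + p.2 ^+ 2 : R).
  by apply: measurable_funD; apply: measurable_funX; [exact: measurable_fst|exact: measurable_snd].
rewrite (_ : dsk r = setT `&` (fun p : T => p.1 ^+ 2 + p.2 ^+ 2 : R) @^-1` `]-oo, r ^+ 2[).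
  by apply: m => //; exact: measurable_itv.
by rewrite setTI; apply/seteqP; split => p /=; rewrite /dsk /= in_itv.
Qed.

Lemma dskP r p : 0 <= r -> dsk r p = (cabs (toC p) < r).
Proof.
move=> r0; have -> : (cabs (toC p) < r) = (cabs (toC p) ^+ 2 < r ^+ 2).
  by rewrite ltr_pXn2r // nnegrE // cabs_ge0.
by rewrite cabs2.
Qed.

Lemma mu2_dsk_fin r : (mu2 (dsk r) < +oo)%E.
Proof.
pose A : set (measurableTypeR R) := `[- `|r|, `|r|]%classic.
have mA : measurable A by exact: measurable_itv.
apply: (@le_lt_trans _ _ (mu2 (A `*` A))).
  apply: le_measure; rewrite ?inE; [exact: measurable_dsk|exact: measurableX|].
  have sq (x y : R) : x ^+ 2 + y ^+ 2 < r ^+ 2 -> - `|r| <= x <= `|r|.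
    move=> h; rewrite -ler_norml -(@ler_pXn2r _ 2) ?nnegrE // !real_normK ?num_real //.
    by have := sqr_ge0 y; lra.
  move=> [x y]; rewrite /dsk /A /= !in_itv /= => h; split; first exact: sq h.
  by move: h; rewrite addrC; exact: sq.
have -> : mu2 (A `*` A) = (mu1 A * mu1 A)%E by exact: product_measure1E.
have : (mu1 A < +oo)%E.
  have -> : mu1 A = _ := lebesgue_measure_itv `[- `|r|, `|r|]%O.
  by rewrite /= lte_fin; case: ifP => _; rewrite -?EFinB ltry.
by move=> Afin; rewrite lte_mul_pinfty // ge0_fin_numE.
Qed.

Lemma cintg_bound D F M : measurable D -> (mu2 D < +oo)%E -> cmeas D F ->
  (forall p, D p -> cabs (F p) <= M) -> cintg D F.
Proof.
move=> mD fD mF FM; apply: (@cintg_le _ _ (fun=> M)) => //.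
apply: measurable_bounded_integrable => //; exists `|M|; split; first exact: num_real.
by move=> x Mx p _ /=; exact: ltW.
Qed.

End DiskIntegral.

(** * Green's formula and recursion for the moments of disks *)

Section Stokes.
Variable R : realType.
Local Notation C := R[i].
Local Notation cabs := (cabs R).
Local Notation toC := (toC R).
Local Notation T := (measurableTypeR R * measurableTypeR R)%type.
Local Notation mu1 := (@lebesgue_measure R).
Local Notation mu2 := (@mu2 R).

(** The slice is empty or an open chord whose ends lie on the circle, where the primitive
    vanishes. *)
Lemma integral_chord (r y : R) (h P : R -> R) : continuous h -> (forall x : R, is_derive x 1 P (h x)) ->
  (forall x, x ^+ 2 + y ^+ 2 = r ^+ 2 -> P x = 0) ->
  (\int[mu1]_x ((EFin \o h) \_ [set x | (x ^+ 2 + y ^+ 2 < r ^+ 2)%R]) x = 0)%E.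
Proof.
move=> ch dP P0; have [yr|yr] := ltP (y ^+ 2) (r ^+ 2); last first.
  rewrite (_ : [set _ | _] = set0); first by rewrite patch_set0 integral0.
  apply/seteqP; split => x //= h1; have := sqr_ge0 x; lra.
pose s := Num.sqrt (r ^+ 2 - y ^+ 2).
have s2 : s ^+ 2 = r ^+ 2 - y ^+ 2 by rewrite sqr_sqrtr // subr_ge0 ltW.
have s0 : 0 < s by rewrite sqrtr_gt0 subr_gt0.
have -> : [set x | x ^+ 2 + y ^+ 2 < r ^+ 2] = `]- s, s[%classic.
  apply/seteqP; split => x /=; rewrite in_itv /=.
    by move=> xr; rewrite -ltr_norml -(@ltr_pXn2r _ 2) ?nnegrE ?(ltW s0) // real_normK ?num_real // s2; lra.
  by rewrite -ltr_norml -(@ltr_pXn2r _ 2) ?nnegrE ?(ltW s0) // real_normK ?num_real // s2; lra.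
rewrite -integral_mkcond -(integral_itv_bndoo true false); last first.
  by apply/measurable_EFinP/measurable_funTS; exact: continuous_measurable_fun.
have := Rint_FTC (_ : - s <= s) ch dP; rewrite !P0; [|rewrite ?sqrrN s2; ring..].
move=> /(_ ltac:(lra)); rewrite subrr => F.
rewrite -[LHS]fineK; first by congr EFin.
by apply: integrable_fin_num => //; exact: cont_integrable.
Qed.

Lemma stokes_x (r : R) (g : T -> R) : mu2.-integrable (dsk r) (EFin \o g) ->
  (forall y, exists P, [/\ continuous (fun x : R => g (x, y)), (forall x : R, is_derive x 1 P (g (x, y))) &
    forall x, x ^+ 2 + y ^+ 2 = r ^+ 2 -> P x = 0]) ->
  Rintegral mu2 (dsk r) g = 0.
Proof.
move=> ig hP; rewrite /Rintegral integral_mkcond.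
set f := (_ \_ _).
have fi : mu2.-integrable setT f by rewrite -integrable_mkcond //; exact: measurable_dsk.
have -> : (\int[mu2]_x f x = \int[mu1]_y \int[mu1]_x f (x, y))%E.
  by apply/esym; exact: (@integral21_prod_meas1 _ _ _ _ _ mu1 mu1).
rewrite (eq_integral (cst 0%E)) ?integral0 // => y _.
have [P [cg dP P0]] := hP y.
rewrite -[RHS](integral_chord cg dP P0); apply: eq_integral => x _.
by rewrite /f !patchE; congr (if _ then _ else _); apply/idP/idP; rewrite !inE.
Qed.

Lemma stokes_y (r : R) (g : T -> R) : mu2.-integrable (dsk r) (EFin \o g) ->
  (forall x, exists P, [/\ continuous (fun y : R => g (x, y)), (forall y : R, is_derive y 1 P (g (x, y))) &
    forall y, x ^+ 2 + y ^+ 2 = r ^+ 2 -> P y = 0]) ->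
  Rintegral mu2 (dsk r) g = 0.
Proof.
move=> ig hP; rewrite /Rintegral integral_mkcond.
set f := (_ \_ _).
have fi : mu2.-integrable setT f by rewrite -integrable_mkcond //; exact: measurable_dsk.
have -> : (\int[mu2]_x f x = \int[mu1]_x \int[mu1]_y f (x, y))%E.
  by apply/esym; exact: (@integral12_prod_meas1 _ _ _ _ _ mu1 mu1).
rewrite (eq_integral (cst 0%E)) ?integral0 // => x _.
have [P [cg dP P0]] := hP x.
have P0' y : y ^+ 2 + x ^+ 2 = r ^+ 2 -> P y = 0 by rewrite addrC; exact: P0.
rewrite -[RHS](integral_chord cg dP P0'); apply: eq_integral => y _.
by rewrite /f !patchE; congr (if _ then _ else _); apply/idP/idP; rewrite !inE /dsk /= addrC.
Qed.

Definition cder (h h' : R -> C) := forall t : R,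
  is_derive t 1 (fun x => complex.Re (h x)) (complex.Re (h' t)) /\
  is_derive t 1 (fun x => complex.Im (h x)) (complex.Im (h' t)).

Lemma cder_cst c : cder (fun=> c) (fun=> 0).
Proof. by move=> t; split; exact: is_derive_cst. Qed.

Lemma cderD h h' k k' : cder h h' -> cder k k' -> cder (fun t => h t + k t) (fun t => h' t + k' t).
Proof.
move=> hh kk t; have [h1 h2] := hh t; have [k1 k2] := kk t; split.
  by under [fun x => complex.Re _]eq_fun do rewrite cReD; rewrite cReD; exact: is_deriveD.
by under [fun x => complex.Im _]eq_fun do rewrite cImD; rewrite cImD; exact: is_deriveD.
Qed.

Lemma cderM h h' k k' : cder h h' -> cder k k' ->
  cder (fun t => h t * k t) (fun t => h' t * k t + h t * k' t).
Proof.
move=> hh kk t; have [h1 h2] := hh t; have [k1 k2] := kk t; split.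
  under [fun x => complex.Re _]eq_fun do rewrite cReM.
  apply: (is_derive_eq (is_deriveB (is_deriveM h1 k1) (is_deriveM h2 k2))).
  by rewrite cReD !cReM /GRing.scale /=; ring.
under [fun x => complex.Im _]eq_fun do rewrite cImM.
apply: (is_derive_eq (is_deriveD (is_deriveM h1 k2) (is_deriveM h2 k1))).
by rewrite cImD !cImM /GRing.scale /=; ring.
Qed.

Lemma cderX h h' n : cder h h' -> cder (fun t => h t ^+ n.+1) (fun t => n.+1%:R * h t ^+ n * h' t).
Proof.
move=> hh; elim: n => [|n IH].
  by rewrite [X in cder _ X](_ : _ = h') //; apply/funext => t; rewrite expr0 !mul1r.
rewrite [X in cder X _](_ : _ = fun t => h t * h t ^+ n.+1) //.
rewrite [X in cder _ X](_ : _ = fun t => h' t * h t ^+ n.+1 + h t * (n.+1%:R * h t ^+ n * h' t)); first exact: cderM.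
by apply/funext => t; rewrite -[n.+2%:R]natr1 exprS; ring.
Qed.

Lemma cder_cont h h' : cder h h' -> ccont h.
Proof.
move=> hh; split => t; have [h1 h2] := hh t; apply: differentiable_continuous;
  apply/derivable1_diffP; [exact: (@ex_derive _ _ _ _ _ _ _ h1)|exact: (@ex_derive _ _ _ _ _ _ _ h2)].
Qed.

Lemma cder_conj h h' : cder h h' -> cder (fun t => conjc (h t)) (fun t => conjc (h' t)).
Proof.
move=> hh t; have [h1 h2] := hh t; split.
  by under [fun x => complex.Re _]eq_fun do rewrite cReJ; rewrite cReJ.
by under [fun x => complex.Im _]eq_fun do rewrite cImJ; rewrite cImJ; exact: is_deriveN.
Qed.

Lemma cder_x (y : R) : cder (fun x => toC (x, y)) (fun=> 1).
Proof. by move=> t; split => /=; [exact: is_derive_id|exact: is_derive_cst]. Qed.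

Lemma cder_y (x : R) : cder (fun y => toC (x, y)) (fun=> 'i%C).
Proof. by move=> t; split => /=; [exact: is_derive_cst|exact: is_derive_id]. Qed.

Lemma cint_dx0 (r : R) (F F' : T -> C) : cintg (dsk r) F' ->
  (forall y, cder (fun x => F (x, y)) (fun x => F' (x, y))) ->
  (forall y, ccont (fun x => F' (x, y))) ->
  (forall p : T, p.1 ^+ 2 + p.2 ^+ 2 = r ^+ 2 -> F p = 0) -> cint (dsk r) F' = 0.
Proof.
move=> [i1 i2] dF cF F0; rewrite /cint !stokes_x // => y.
  exists (fun x => complex.Im (F (x, y))); split; [exact: (cF y).2|by move=> x; exact: (dF y x).2|].
  by move=> x xy; rewrite F0.
exists (fun x => complex.Re (F (x, y))); split; [exact: (cF y).1|by move=> x; exact: (dF y x).1|].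
by move=> x xy; rewrite F0.
Qed.

Lemma cint_dy0 (r : R) (F F' : T -> C) : cintg (dsk r) F' ->
  (forall x, cder (fun y => F (x, y)) (fun y => F' (x, y))) ->
  (forall x, ccont (fun y => F' (x, y))) ->
  (forall p : T, p.1 ^+ 2 + p.2 ^+ 2 = r ^+ 2 -> F p = 0) -> cint (dsk r) F' = 0.
Proof.
move=> [i1 i2] dF cF F0; rewrite /cint !stokes_y // => x.
  exists (fun y => complex.Im (F (x, y))); split; [exact: (cF x).2|by move=> y; exact: (dF x y).2|].
  by move=> y xy; rewrite F0.
exists (fun y => complex.Re (F (x, y))); split; [exact: (cF x).1|by move=> y; exact: (dF x y).1|].
by move=> y xy; rewrite F0.
Qed.

Lemma toC_conj (p : T) : toC p * conjc (toC p) = (p.1 ^+ 2 + p.2 ^+ 2)%:C%C.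
Proof. by rewrite /Defs.toC; case: p => x y; simpc; congr Complex; ring. Qed.

Definition zpow n m (p : T) : C := toC p ^+ n * conjc (toC p) ^+ m.

Lemma cmeas_zpow D n m : cmeas D (zpow n m).
Proof.
by apply: cmeasM; apply: cmeasX; [exact: cmeas_toC|apply: cmeas_conj; exact: cmeas_toC].
Qed.

Lemma cabs_zpow (r : R) n m p : 0 <= r -> dsk r p -> cabs (zpow n m p) <= r ^+ (n + m).
Proof.
move=> r0; rewrite dskP // => pr; rewrite /zpow cabsM !cabsX cabsJ -exprD.
by apply: lerXn2r; rewrite ?nnegrE ?cabs_ge0 // ltW.
Qed.

Lemma cintg_zpow (r : R) n m : 0 <= r -> cintg (dsk r) (zpow n m).
Proof.
move=> r0; apply: (@cintg_bound _ _ _ (r ^+ (n + m))).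
- exact: measurable_dsk.
- exact: mu2_dsk_fin.
- exact: cmeas_zpow.
- by move=> p; exact: cabs_zpow.
Qed.

(* Green's formula for [F = z^(n+1) conj(z)^m (r^2 - |z|^2)], which vanishes on the circle;
   [dz] and [dw] are its derivatives with respect to [z] and [conj z]. *)
Lemma moment_rec (r : R) n m : 0 <= r ->
  n.+1%:R * (r ^+ 2)%:C%C * cint (dsk r) (zpow n m) = n.+2%:R * cint (dsk r) (zpow n.+1 m.+1).
Proof.
move=> r0; have mD := @measurable_dsk R r.
pose dz (p : T) := n.+1%:R * (r ^+ 2)%:C%C * zpow n m p - n.+2%:R * zpow n.+1 m.+1 p.
(* For m = 0 the truncated exponent [m.-1] is harmless, its coefficient being 0. *)
pose dw (p : T) := m%:R * (r ^+ 2)%:C%C * zpow n.+1 m.-1 p - m.+1%:R * zpow n.+2 m p.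
have i1 : cintg (dsk r) (fun p => n.+1%:R * (r ^+ 2)%:C%C * zpow n m p).
  by apply: cintgZ => //; exact: cintg_zpow.
have i2 : cintg (dsk r) (fun p => - n.+2%:R * zpow n.+1 m.+1 p).
  by apply: cintgZ => //; exact: cintg_zpow.
have idz : cintg (dsk r) dz.
  by rewrite (_ : dz = fun p => n.+1%:R * (r ^+ 2)%:C%C * zpow n m p + - n.+2%:R * zpow n.+1 m.+1 p);
   [exact: cintgD|apply/funext => p; rewrite mulNr].
have idw : cintg (dsk r) dw.
  rewrite (_ : dw = fun p => m%:R * (r ^+ 2)%:C%C * zpow n.+1 m.-1 p + - m.+1%:R * zpow n.+2 m p).
    by apply: cintgD => //; apply: cintgZ => //; exact: cintg_zpow.
  by apply/funext => p; rewrite mulNr.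
pose F (p : T) := zpow n.+1 m p * ((r ^+ 2)%:C%C - toC p * conjc (toC p)).
have F0 (p : T) : p.1 ^+ 2 + p.2 ^+ 2 = r ^+ 2 -> F p = 0.
  by move=> pr; rewrite /F toC_conj pr subrr mulr0.
have dpow (h : R -> C) u k : cder h (fun=> u) -> cder (fun t => h t ^+ k) (fun t => k%:R * h t ^+ k.-1 * u).
  case: k => [|k] hu; last exact: cderX.
  rewrite [X in cder _ X](_ : _ = fun=> 0); first exact: cder_cst.
  by apply/funext => t; rewrite !mul0r.
have dF (h : R -> T) u : cder (fun t => toC (h t)) (fun=> u) ->
    cder (fun t => F (h t)) (fun t => dz (h t) * u + dw (h t) * conjc u).
  move=> hu; have hv := cder_conj hu.
  have := cderM (cderM (dpow _ _ n.+1 hu) (dpow _ _ m hv)) (cderD (cder_cst (r ^+ 2)%:C%C) (cderM (cder_cst (-1)) (cderM hu hv))).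
  rewrite [X in cder X _](_ : _ = fun t => F (h t)); last first.
    by apply/funext => t; rewrite mulN1r.
  congr cder; apply/funext => t; rewrite /dz /dw /zpow.
  move: (toC (h t)) (conjc (toC (h t))) (conjc u) ((r ^+ 2)%:C%C) => z w v k.
  case: (m) => [|m'].
    by rewrite /= -[n.+2%:R]natr1 (exprS _ n.+1) (exprS z n); ring.
  by rewrite /= -[n.+2%:R]natr1 -[m'.+2%:R]natr1 (exprS z n.+1) (exprS z n) (exprS w m'.+1) (exprS w m'); ring.
have cF (h : R -> T) u v : ccont (fun t => toC (h t)) -> ccont (fun t => dz (h t) * u + dw (h t) * v).
  move=> ch.
  have cch : ccont (fun t => conjc (toC (h t))).
    by case: ch => h1 h2; split; [under eq_fun do rewrite cReJ|
      under eq_fun do rewrite cImJ; move=> x; apply: cvgN; exact: h2].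
  have cX (k : R -> C) j : ccont k -> ccont (fun t => k t ^+ j).
    move=> ck; elim: j => [|j IH]; first by under eq_fun do rewrite expr0; exact: ccont_cst.
    by under eq_fun do rewrite exprS; exact: ccontM.
  have cz i j : ccont (fun t => zpow i j (h t)) by apply: ccontM; exact: cX.
  apply: ccontD; (apply: ccontM; last exact: ccont_cst).
    by apply: ccontD; [exact: ccontZ|apply: ccontN; exact: ccontZ].
  by apply: ccontD; [exact: ccontZ|apply: ccontN; exact: ccontZ].
have ci u v : cintg (dsk r) (fun p => dz p * u + dw p * v).
  by apply: cintgD => //; under eq_fun do rewrite mulrC; exact: cintgZ.
have E u v : cint (dsk r) (fun p => dz p * u + dw p * v) = u * cint (dsk r) dz + v * cint (dsk r) dw.
  rewrite cintD //; [|by under eq_fun do rewrite mulrC; exact: cintgZ..].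
  by congr (_ + _); under [X in cint _ X]eq_fun do rewrite mulrC; exact: cintZ.
(* The directions u = 1 and u = i give two equations for the integrals of dz and dw, whose only
   solution is zero. *)
have hx : cint (dsk r) (fun p => dz p * 1 + dw p * conjc 1) = 0.
  apply: (@cint_dx0 _ F) => //.
  - by move=> y; apply: (dF (fun x => (x, y))); exact: cder_x.
  - by move=> y; apply: (cF (fun x => (x, y))); apply: cder_cont; exact: cder_x.
have hy : cint (dsk r) (fun p => dz p * 'i%C + dw p * conjc 'i%C) = 0.
  apply: (@cint_dy0 _ F) => //.
  - by move=> x; apply: (dF (fun y => (x, y))); exact: cder_y.
  - by move=> x; apply: (cF (fun y => (x, y))); apply: cder_cont; exact: cder_y.
have : cint (dsk r) dz = 0.
  move: hx hy; rewrite !E; move: (cint _ dz) (cint _ dw) => [a b] [c d].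
  by simpc => - [h1 h2] [h3 h4]; congr Complex; lra.
rewrite (_ : dz = fun p => n.+1%:R * (r ^+ 2)%:C%C * zpow n m p + - n.+2%:R * zpow n.+1 m.+1 p); last first.
  by apply/funext => p; rewrite mulNr.
rewrite cintD // !cintZ //; try exact: cintg_zpow.
by rewrite mulNr => /eqP; rewrite subr_eq0 => /eqP.
Qed.

End Stokes.

(** * Orthogonality of monomials and energy of partial sums *)

Section Energy.
Variable R : realType.
Local Notation C := R[i].
Local Notation cabs := (cabs R).
Local Notation toC := (toC R).
Local Notation T := (measurableTypeR R * measurableTypeR R)%type.
Local Notation mu1 := (@lebesgue_measure R).
Local Notation mu2 := (@mu2 R).
Local Notation zp := (@zpow R).
Local Notation wt0 := (@wt R 0).
Implicit Types (a b : nat -> C) (r : R).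

Definition area r : R := fine (mu2 (dsk r)).

Lemma area_mu r : mu2 (dsk r) = (area r)%:E.
Proof. by rewrite fineK // ge0_fin_numE ?measure_ge0 ?mu2_dsk_fin. Qed.

Lemma area_ge0 r : 0 <= area r.
Proof. by rewrite -lee_fin -area_mu measure_ge0. Qed.

Lemma cint_one r : cint (dsk r) (zp 0 0) = (area r)%:C%C.
Proof.
rewrite /cint (_ : zp 0 0 = fun=> 1); last by apply/funext => p; rewrite /zpow !expr0 mulr1.
rewrite /= !Rintegral_cst; try exact: measurable_dsk.
by rewrite mul1r mul0r.
Qed.

(** On the diagonal, induction by [moment_rec]. Off it, the recursion and its conjugate relate the
    same two moments with different ratios, (n+1)/(n+2) and (m+1)/(m+2), so both vanish. *)
Lemma cint_zpow r n m : 0 < r ->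
  cint (dsk r) (zp n m) = if n == m then (area r * r ^+ (2 * n) * wt0 n)%:C%C else 0.
Proof.
move=> r0; have r0' := ltW r0.
have r2 : (r ^+ 2)%:C%C != 0 :> C by rewrite -cabs_eq0 cabs_real normr_eq0 gt_eqF // exprn_gt0.
have cj i j : cint (dsk r) (zp j i) = conjc (cint (dsk r) (zp i j)).
  rewrite -cint_conj; [|exact: measurable_dsk|exact: cintg_zpow].
  congr cint; apply/funext => p; rewrite /zpow; move: (toC p) => z.
  by rewrite rmorphM /= [X in _ = X * _]rmorphXn [X in _ = _ * X]rmorphXn /= conjcK mulrC.
case: eqVneq => [<-{m}|nm].
  elim: n => [|n IH].
    by rewrite cint_one muln0 expr0 /wt add0n invr1 !mulr1.
  have := moment_rec n n r0'; rewrite IH => h.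
  have n2 : (n.+2%:R : C) != 0 by rewrite pnatr_eq0.
  apply: (mulfI n2); rewrite -h.
  have -> : n.+2%:R = (n.+2%:R)%:C%C :> C by rewrite rmorph_nat.
  have -> : n.+1%:R = (n.+1%:R)%:C%C :> C by rewrite rmorph_nat.
  rewrite -!rmorphM; congr (_%:C)%C; rewrite /wt !addn1 mulnS exprD.
  have [u0 v0] : (n.+1%:R != 0 :> R) /\ (n.+2%:R != 0 :> R) by rewrite !pnatr_eq0.
  by move: (n.+1%:R : R) (n.+2%:R : R) u0 v0 => u v u0 v0; field; rewrite u0 v0.
have h1 := moment_rec n m r0'.
have h2 : m.+1%:R * (r ^+ 2)%:C%C * cint (dsk r) (zp n m) = m.+2%:R * cint (dsk r) (zp n.+1 m.+1).
  have := moment_rec m n r0'; rewrite (cj n m) (cj n.+1 m.+1) => /(congr1 (@conjc R)).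
  have cM (x y : C) : conjc (x * y) = conjc x * conjc y by exact: rmorphM.
  by rewrite !cM !conjcK !conjc_nat conjc_real.
move: (cint _ (zp n m)) (cint _ (zp n.+1 m.+1)) h1 h2 => x y h1 h2.
apply/eqP; have : (n%:R - m%:R) * (r ^+ 2)%:C%C * x = 0.
  move: (congr1 (fun t => m.+2%:R * t) h1) (congr1 (fun t => n.+2%:R * t) h2).
  rewrite -![_.+2%:R]natr1 -![_.+1%:R]natr1 => e1 e2.
  have : (m%:R + 1 + 1) * ((n%:R + 1) * (r ^+ 2)%:C%C * x) - (n%:R + 1 + 1) * ((m%:R + 1) * (r ^+ 2)%:C%C * x) = 0.
    by rewrite e1 e2; ring.
  by move=> <-; ring.
move/eqP; rewrite !mulf_eq0 (negPf r2) orbF subr_eq0 eqr_nat (negPf nm) /=.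
by [].
Qed.

Definition Sp a N (p : T) : C := \sum_(n < N) a n * toC p ^+ n.

Lemma cmeas_Sp D a N : cmeas D (Sp a N).
Proof.
apply: (@cmeas_sum _ D N (fun n p => a n * toC p ^+ n)) => n.
by apply: cmeasM; [exact: cmeas_cst|apply: cmeasX; exact: cmeas_toC].
Qed.

Definition en D (F : T -> C) := (\int[mu2]_(p in D) (cabs (F p) ^+ 2)%:E)%E.

Lemma cintg_zpowS r a b N K : 0 < r ->
  cintg (dsk r) (fun p => Sp a N p * conjc (Sp b K p)) /\
  cint (dsk r) (fun p => Sp a N p * conjc (Sp b K p)) =
    \sum_(i < N) \sum_(j < K) a i * conjc (b j) * cint (dsk r) (zp i j).
Proof.
move=> r0; have mD := @measurable_dsk R r; have iz i j := @cintg_zpow R r i j (ltW r0).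
have -> : (fun p => Sp a N p * conjc (Sp b K p)) =
    fun p => \sum_(i < N) (fun i p => \sum_(j < K) (fun j p => a i * conjc (b j) * zp i j p) j p) i p.
  apply/funext => p; rewrite /Sp rmorph_sum /= big_distrlr /=.
  apply: eq_bigr => i _; apply: eq_bigr => j _.
  by rewrite rmorphM rmorphXn /zpow mulrACA.
have ij i := cintg_sum K mD (fun j => cintgZ (a i * conjc (b j)) mD (iz i j)).
have [h1 ->] := cintg_sum N mD (fun i => (ij i).1); split => //.
apply: eq_bigr => i _; rewrite (ij i).2; apply: eq_bigr => j _; exact: cintZ.
Qed.

Lemma en_Sp r a N : 0 < r ->
  en (dsk r) (Sp a N) = (area r * \sum_(n < N) r ^+ (2 * n) * (wt0 n * cabs (a n) ^+ 2))%:E.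
Proof.
move=> r0; have mD := @measurable_dsk R r; have [[h1 _] h] := cintg_zpowS a a N N r0.
have E : en (dsk r) (Sp a N) = (complex.Re (cint (dsk r) (fun p => Sp a N p * conjc (Sp a N p))))%:E.
  rewrite /cint /= /Rintegral fineK; last exact: integrable_fin_num.
  apply: eq_integral => p _; congr EFin.
  by rewrite -sqr_normc normr_cabs -rmorphXn.
rewrite E h; congr EFin.
rewrite (_ : (\sum_(i < N) _) = (area r * \sum_(n < N) r ^+ (2 * n) * (wt0 n * cabs (a n) ^+ 2))%:C%C) //.
rewrite rmorphM rmorph_sum mulr_sumr; apply: eq_bigr => i _.
rewrite (bigD1 i) //= big1 ?addr0 => [|j ji]; last by rewrite cint_zpow // ifN ?mulr0 // eq_sym.
rewrite cint_zpow // eqxx -sqr_normc normr_cabs -rmorphXn -!rmorphM; congr (_%:C)%C.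
by ring.
Qed.

Lemma area1_gt0 : 0 < area 1.
Proof.
pose A : set (measurableTypeR R) := `[0, 1 / 2]%classic.
have mA : measurable A by exact: measurable_itv.
have AE : mu1 A = (1 / 2)%:E.
  have -> : mu1 A = _ := lebesgue_measure_itv `[0, 1 / 2]%O.
  by rewrite /= lte_fin ifT ?sube0 // divr_gt0.
rewrite -lte_fin -area_mu; apply: (@lt_le_trans _ _ (mu2 (A `*` A))).
  have -> : mu2 (A `*` A) = (mu1 A * mu1 A)%E by exact: product_measure1E.
  by rewrite AE -EFinM lte_fin; lra.
apply: le_measure; rewrite ?inE; [exact: measurableX|exact: measurable_dsk|].
move=> [x y]; rewrite /dsk /A /= !in_itv /= => -[/andP[x0 x1] /andP[y0 y1]].
rewrite expr1n; have : x ^+ 2 <= 1 / 4 by nra.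
have : y ^+ 2 <= 1 / 4 by nra.
lra.
Qed.

(** Continuity of the measure along an increasing exhaustion of the disk. *)
Lemma area_cvg : (fun k => area (1 - k.+2%:R^-1)) @ \oo --> area 1.
Proof.
have e k : (0 : R) < k.+2%:R^-1 <= (1 / 2 : R).
  rewrite invr_gt0 ltr0n /= div1r lef_pV2 ?posrE ?ltr0n //.
  by rewrite ler_nat.
have e' k : (0 : R) <= 1 - k.+2%:R^-1.
  by have := e k; move: (_^-1) => u /andP[]; lra.
have nd : nondecreasing_seq (fun k => dsk (1 - k.+2%:R^-1 : R)).
  move=> k l kl; apply/subsetPset => p; rewrite /dsk /= => h; apply: (lt_le_trans h).
  apply: lerXn2r; rewrite ?nnegrE ?e' //.
  by rewrite lerD2l lerN2 lef_pV2 ?posrE ?ltr0n // ler_nat.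
have U : \bigcup_k dsk (1 - k.+2%:R^-1 : R) = dsk 1.
  apply/seteqP; split => p.
    move=> [k _]; have /andP[k0 _] := e k; rewrite !dskP ?ler01 // => h.
    by apply: (lt_trans h); rewrite gtrBl.
  rewrite dskP ?ler01 // => p1.
  have d0 : 0 < 1 - cabs (toC p) by lra.
  have [k hk] := ltr_add_invr d0.
  exists k => //; rewrite dskP //; rewrite add0r in hk.
  have : (k.+2%:R^-1 : R) <= k.+1%:R^-1 by rewrite lef_pV2 ?posrE ?ltr0n // ler_nat.
  by move: (k.+2%:R^-1) (k.+1%:R^-1) hk => u v; lra.
have := @nondecreasing_cvg_mu _ _ _ mu2 (fun k => dsk (1 - k.+2%:R^-1 : R)).
rewrite U => /(_ (fun=> measurable_dsk _) (measurable_dsk _) nd).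
rewrite area_mu => /fine_cvg; rewrite /comp /=.
by under eq_fun do rewrite area_mu.
Qed.

End Energy.

(** * The Bergman norm *)

Section Bergman.
Variable R : realType.
Local Notation C := R[i].
Local Notation cabs := (cabs R).
Local Notation toC := (toC R).
Local Notation T := (measurableTypeR R * measurableTypeR R)%type.
Local Notation mu2 := (@mu2 R).
Local Notation wt0 := (@wt R 0).
Local Notation D := (@dsk R 1).
Local Notation a1 := (area (1 : R)).
Local Notation en := (@en R).
Implicit Types (a b : nat -> C) (r : R) (u v : T -> C) (z : C).

Let mD := @measurable_dsk R 1.

Lemma hseq_nb a M : nb wt0 a M -> hseq a.
Proof.
move=> ha r /andP[r0 r1]; have M0 := nb_gt0 ha.
have [|K [q [K0 /andP[q0 q1] hK]]] := @nat_geom R r; first by rewrite (ltW r0).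
have hn n : n%:R * r ^+ n <= K by apply: (le_trans (hK n)); rewrite ler_piMr // exprn_ile1 // ltW.
exists (M * (K / r)) => n.
have : cabs (a n) <= M * n.+1%:R.
  apply: (le_trans (nb_coord (@wt_gt0 R 0) n ha)); rewrite ler_wpM2l ?(ltW M0) //.
  rewrite /wt addn1 sqrtrV ?ler0n // invrK -[leRHS]sqr_sqrtr ?ler0n // expr2.
  by rewrite ler_peMr ?sqrtr_ge0 // -{1}[1 in leLHS]sqrtr1 ler_sqrt ?ltr0n // ler1n.
move=> h; apply: (le_trans (ler_wpM2r (exprn_ge0 n (ltW r0)) h)).
rewrite -mulrA ler_wpM2l ?(ltW M0) // ler_pdivlMr // -mulrA -exprSr; exact: hn.
Qed.

Lemma ccvg_near (x y : nat -> C) l N : (forall k, (N <= k)%N -> x k = y k) -> ccvg x l -> ccvg y l.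
Proof.
move=> xy; apply: cvg_trans; apply: near_eq_cvg; exists N => // k /= Nk; by rewrite xy.
Qed.

Definition tail N a n : C := if (n < N)%N then 0 else a n.

Lemma hseq_tail a N : hseq a -> hseq (tail N a).
Proof.
move=> ha r r01; have [M hM] := ha r r01; exists M => n; rewrite /tail; case: ifP => // _.
rewrite cabs0 mul0r; apply: le_trans (hM 0%N); rewrite mulr_ge0 ?cabs_ge0 ?exprn_ge0 //.
by case/andP: r01 => /ltW.
Qed.

Lemma sum_tail (V : zmodType) (F G : nat -> V) N k : (N <= k)%N ->
  (forall n, (n < N)%N -> F n = 0) -> (forall n, (N <= n)%N -> F n = G n) ->
  \sum_(n < k) F n = \sum_(n < k) G n - \sum_(n < N) G n.
Proof.
move=> /subnKC <- F0 FG; rewrite !big_split_ord /= [X in X + _]big1; last by move=> n _; exact: F0.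
rewrite add0r addrAC subrr add0r; apply: eq_bigr => i _; apply: FG; exact: leq_addr.
Qed.

Lemma fnD_tail a N z : hseq a -> cabs z < 1 ->
  fnD (tail N a) z = fnD a z - \sum_(n < N) a n * z ^+ n.
Proof.
move=> ha z1; apply: fnD_unique => //; first exact: hseq_tail.
have h := ccvgD (fnD_cvg ha z1) (ccvgN (ccvg_cst (\sum_(n < N) a n * z ^+ n))).
apply: (@ccvg_near _ _ _ N _ h) => k Nk.
apply/esym/(@sum_tail _ (fun n => tail N a n * z ^+ n) (fun n => a n * z ^+ n)) => // n; rewrite /tail; first by move=> ->; rewrite mul0r.
by rewrite leqNgt => /negbTE ->.
Qed.

Lemma nb_tail a M e : nb wt0 a M -> 0 < e -> exists N0, forall N, (N0 <= N)%N -> nb wt0 (tail N a) e.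
Proof.
move=> [M0 hM] e0; pose S N := \sum_(n < N) wt0 n * cabs (a n) ^+ 2.
have t0 n : 0 <= wt0 n * cabs (a n) ^+ 2 by rewrite mulr_ge0 ?sqr_ge0 // ltW // wt_gt0.
have Sn m n : (m <= n)%N -> S m <= S n.
  by move=> /subnKC <-; rewrite /S big_split_ord /= lerDl sumr_ge0.
have hs : has_sup (range S) by split; [exists (S 0%N), 0%N|exists (M ^+ 2) => _ [N _ <-]; exact: hM].
have e20 : 0 < e ^+ 2 by rewrite exprn_gt0.
have [_ [N0 _ <-] hN0] := sup_adherent e20 hs.
exists N0 => N N0N; split => // K.
have [KN|NK] := leqP K N.
  rewrite big1 ?sqr_ge0 // => i _; rewrite /tail (leq_trans _ KN) // cabs0 expr0n /=.
  by rewrite mulr0.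
have : S K <= sup (range S) by apply: sup_ubound; [case: hs|exists K].
have := Sn _ _ N0N; move: hN0.
rewrite (@sum_tail _ (fun n => wt0 n * cabs (tail N a n) ^+ 2) (fun n => wt0 n * cabs (a n) ^+ 2) N K (ltnW NK)) -/(S K) -/(S N).
- by move: (S K) (S N) (S N0) (sup _) => x y z t; lra.
- by move=> n nN; rewrite /tail nN cabs0 expr0n /= mulr0.
- by move=> n; rewrite /tail leqNgt => /negbTE ->.
Qed.

Lemma cmeas_fnD a : hseq a -> cmeas D (fun p => fnD a (toC p)).
Proof.
move=> ha; apply: (@cmeas_cvg _ D (fun N => Sp a N)) => [N|p]; first exact: cmeas_Sp.
by rewrite dskP ?ler01 // => p1; exact: fnD_cvg.
Qed.

Lemma en_ge0 E u : (0 <= en E u)%E.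
Proof. by apply: integral_ge0 => p _; rewrite lee_fin sqr_ge0. Qed.

(** Fatou's lemma along the partial sums, whose energies are explicit by [en_Sp]. *)
Lemma en_fnD_le a M : nb wt0 a M -> (en D (fun p => fnD a (toC p)) <= (a1 * M ^+ 2)%:E)%E.
Proof.
move=> ha; have [M0 hM] := ha; have hh := hseq_nb ha.
have mS N : measurable_fun D (fun p => (cabs (Sp a N p) ^+ 2)%:E).
  by apply/measurable_EFinP; apply: cmeas_cabs2; exact: cmeas_Sp.
have := fatou mu2 mD mS (fun n p _ => _).
rewrite (_ : (\int[mu2]_(x in D) _)%E = en D (fun p => fnD a (toC p))); last first.
  apply: eq_integral => p; rewrite inE dskP ?ler01 // => p1.
  have h : (fun n => (cabs (Sp a n p) ^+ 2)%:E) @ \oo --> (cabs (fnD a (toC p)) ^+ 2)%:E.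
    apply: cvg_EFin; first by near=> n.
    have h2 := ccvg_cabs (fnD_cvg hh p1).
    by rewrite /comp /=; under eq_fun do rewrite expr2; rewrite expr2; exact: cvgM.
  by rewrite is_cvg_limn_einfE; [exact: cvg_lim|apply/cvg_ex; eexists; exact: h].
move=> h; apply: (le_trans (h _)); first by move=> n p; rewrite lee_fin sqr_ge0.
have E n : (\int[mu2]_(x in D) (cabs (Sp a n x) ^+ 2)%:E)%E = (a1 * \sum_(i < n) wt0 i * cabs (a i) ^+ 2)%:E.
  rewrite -[LHS]/(en D (Sp a n)) en_Sp //; congr (_ * _)%:E.
  by apply: eq_bigr => i _; rewrite expr1n mul1r.
under eq_fun do rewrite E.
have B n : a1 * (\sum_(i < n) wt0 i * cabs (a i) ^+ 2) <= a1 * M ^+ 2.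
  by rewrite ler_wpM2l ?area_ge0.
rewrite limn_einf_lim; apply: lime_le; first exact: is_cvg_einfs.
near=> n; apply: (@le_trans _ _ (a1 * (\sum_(i < n) wt0 i * cabs (a i) ^+ 2))%:E); last by rewrite lee_fin.
by apply: ereal_inf_lbound; exists n => /=.
Unshelve. all: by end_near. Qed.

Lemma en_integrable E u : measurable E -> cmeas E u -> (en E u < +oo)%E ->
  mu2.-integrable E (EFin \o (fun p => cabs (u p) ^+ 2)).
Proof.
move=> mE mu ufin; apply/integrableP; split; first by apply/measurable_EFinP; exact: cmeas_cabs2.
apply: le_lt_trans ufin; rewrite /en le_eqVlt; apply/orP; left; apply/eqP.
by apply: eq_integral => p _; rewrite /= ger0_norm ?sqr_ge0.
Qed.

(** Cauchy-Schwarz in additive form, from |u v| <= s |u|^2 + |v|^2 / s. The free parameter s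
    exploits the smallness of one factor. *)
Lemma cintg_pair u v A B : cmeas D u -> cmeas D v -> (en D u <= A%:E)%E -> (en D v <= B%:E)%E ->
  cintg D (fun p => u p * conjc (v p)) /\
  forall s, 0 < s -> cabs (cint D (fun p => u p * conjc (v p))) <= 2 * (s * A + s^-1 * B).
Proof.
move=> mu mv uA vB.
have iu := en_integrable mD mu (le_lt_trans uA (ltry _)).
have iv := en_integrable mD mv (le_lt_trans vB (ltry _)).
have muv : cmeas D (fun p => u p * conjc (v p)) by apply: cmeasM => //; exact: cmeas_conj.
have Z (x : R) (f : T -> R) : mu2.-integrable D (EFin \o f) -> mu2.-integrable D (EFin \o (fun p => x * f p)).
  by move=> fi; rewrite /comp; under eq_fun do rewrite EFinM; exact: integrableZl.
have ig s : mu2.-integrable D (EFin \o (fun p => s * cabs (u p) ^+ 2 + s^-1 * cabs (v p) ^+ 2)).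
  by rewrite /comp; under eq_fun do rewrite EFinD; apply: integrableD => //; exact: Z.
have bd s p : 0 < s -> cabs (u p * conjc (v p)) <= s * cabs (u p) ^+ 2 + s^-1 * cabs (v p) ^+ 2.
  move=> s0; rewrite cabsM cabsJ; move: (cabs (u p)) (cabs (v p)) (cabs_ge0 (u p)) (cabs_ge0 (v p)) => x y x0 y0.
  have : 0 <= s^-1 * ((s * x - y) ^+ 2 + s * x * y) by rewrite mulr_ge0 ?invr_ge0 ?addr_ge0 ?sqr_ge0 ?mulr_ge0 ?(ltW s0).
  have -> : s^-1 * ((s * x - y) ^+ 2 + s * x * y) = s * x ^+ 2 + s^-1 * y ^+ 2 - x * y by field; rewrite gt_eqF.
  by rewrite subr_ge0.
split; first exact: (cintg_le mD muv (ig 1) (fun p _ => bd 1 p ltr01)).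
move=> s s0; apply: (le_trans (cint_le mD muv (ig s) (fun p _ => bd s p s0))).
rewrite ler_wpM2l // RintegralD //; [|exact: Z..]; rewrite !RintegralZl //.
have fu : Rintegral mu2 D (fun p => cabs (u p) ^+ 2) <= A.
  by rewrite -lee_fin /Rintegral fineK //; exact: integrable_fin_num iu.
have fv : Rintegral mu2 D (fun p => cabs (v p) ^+ 2) <= B.
  by rewrite -lee_fin /Rintegral fineK //; exact: integrable_fin_num iv.
by apply: lerD; apply: ler_wpM2l => //; rewrite ?invr_ge0 ltW.
Qed.

Lemma en_lt_Sp a N : exists B, (en D (Sp a N) <= B%:E)%E.
Proof. by rewrite en_Sp //; eexists. Qed.

Lemma cint_fnD_lim u A b M : cmeas D u -> (en D u <= A%:E)%E -> nb wt0 b M ->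
  forall e, 0 < e -> exists N0, forall N, (N0 <= N)%N ->
    cabs (cint D (fun p => u p * conjc (fnD b (toC p))) - cint D (fun p => u p * conjc (Sp b N p))) <= e.
Proof.
move=> mu uA hb e e0; have hh := hseq_nb hb.
have A0 : 0 <= A by rewrite -lee_fin; apply: le_trans uA; exact: en_ge0.
(* With the tail of norm at most s = e/K, the pairing is bounded by 2 (s A + s^-1 a1 s^2) = 2 (A +
   a1) s <= e. *)
pose K := 2 * (A + a1) + 1.
have K0 : 0 < K by rewrite ltr_wpDl // mulr_ge0 // addr_ge0 // area_ge0.
have d0 : 0 < e / K by rewrite divr_gt0.
have [N0 hN0] := nb_tail hb d0; exists N0 => N N0N.
have ht := hN0 N N0N; have hht := hseq_nb ht.
have [i1 h1] := cintg_pair mu (cmeas_fnD hht) uA (en_fnD_le ht).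
have [BS hBS] := en_lt_Sp b N.
have [i2 _] := cintg_pair mu (cmeas_Sp D b N) uA hBS.
have E : cint D (fun p => u p * conjc (fnD b (toC p))) =
  cint D (fun p => u p * conjc (fnD (tail N b) (toC p))) + cint D (fun p => u p * conjc (Sp b N p)).
  rewrite -cintD // /cint; congr Complex; apply: eq_Rintegral => p; rewrite inE dskP ?ler01 // => p1;
    by rewrite fnD_tail // -mulrDr -rmorphD subrK.
rewrite E addrK; apply: (le_trans (h1 _ d0)).
rewrite (_ : 2 * _ = 2 * (A + a1) * (e / K)); last first.
  by move: (a1) (e / K) d0 => x d d0; field; rewrite gt_eqF.
rewrite mulrA ler_pdivrMr // mulrC ler_wpM2l ?(ltW e0) // /K; lra.
Qed.

Lemma sum_delta n N z : (n < N)%N -> \sum_(k < N) (k == n :> nat)%:R * z ^+ k = z ^+ n.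
Proof.
move=> nN; rewrite (bigD1 (Ordinal nN)) //= big1 ?addr0 ?eqxx ?mul1r // => i im.
by rewrite (_ : (i == n :> nat) = false) ?mul0r //; exact: negbTE im.
Qed.

Lemma Sp_delta n p : Sp (fun k => (k == n)%:R) n.+1 p = toC p ^+ n.
Proof. exact: sum_delta. Qed.

Lemma cint_fnD_zpow a M m : nb wt0 a M ->
  cint D (fun p => fnD a (toC p) * conjc (toC p ^+ m)) = a m * (a1 * wt0 m)%:C%C.
Proof.
move=> ha; pose d (n : nat) : C := (n == m)%:R.
have dS p : Sp d m.+1 p = toC p ^+ m by exact: Sp_delta.
have [A hA] := en_lt_Sp d m.+1.
have mS := cmeas_Sp D d m.+1.
have [i0 _] := cintg_pair mS (cmeas_fnD (hseq_nb ha)) hA (en_fnD_le ha).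
have -> : cint D (fun p => fnD a (toC p) * conjc (toC p ^+ m)) =
    conjc (cint D (fun p => Sp d m.+1 p * conjc (fnD a (toC p)))).
  rewrite -cint_conj //; congr cint; apply/funext => p; rewrite dS.
  have cM (x y : C) : conjc (x * y) = conjc x * conjc y by exact: rmorphM.
  by rewrite cM conjcK mulrC.
apply/eqP; rewrite -subr_eq0 -cabs_eq0 eq_le cabs_ge0 andbT; apply/ler_addgt0Pl => e e0; rewrite addr0.
have [N0 hN0] := cint_fnD_lim mS hA ha e0.
have := hN0 (N0 + m.+1)%N (leq_addr _ _).
have [_ ->] := cintg_zpowS d a m.+1 (N0 + m.+1) (ltr01 : (0 : R) < 1).
have mN : (m < N0 + m.+1)%N by rewrite addnS ltnS leq_addl.
have -> : \sum_(i < m.+1) \sum_(j < N0 + m.+1) d i * conjc (a j) * cint D (zpow (R := R) i j) =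
    conjc (a m) * (a1 * wt0 m)%:C%C.
  rewrite (bigD1 ord_max) //= [X in _ + X = _]big1 ?addr0; last first.
    move=> i im; rewrite big1 // => j _; rewrite /d (_ : (i == m :> nat) = false) ?mul0r //.
    exact: negbTE im.
  rewrite (bigD1 (Ordinal mN)) //= big1 ?addr0; last first.
    by move=> j jm; rewrite cint_zpow // ifN ?mulr0 // eq_sym.
  by rewrite /d eqxx mul1r cint_zpow // eqxx expr1n mulr1.
move=> h; rewrite -[leLHS]cabsJ; apply: le_trans h; rewrite le_eqVlt; apply/orP; left; apply/eqP.
have cM (x y : C) : conjc (x * y) = conjc x * conjc y by exact: rmorphM.
have cB (x y : C) : conjc (x - y) = conjc x - conjc y by exact: rmorphB.
by congr cabs; rewrite cB cM conjcK conjc_real.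
Qed.

Lemma sqr_cabsD_le (x y : C) (s : R) : 0 < s ->
  cabs (x + y) ^+ 2 <= (1 + s) * cabs x ^+ 2 + (1 + s^-1) * cabs y ^+ 2.
Proof.
move=> s0; apply: (@le_trans _ _ ((cabs x + cabs y) ^+ 2)).
  by apply: lerXn2r; rewrite ?nnegrE ?addr_ge0 ?cabs_ge0 // cabsD.
move: (cabs x) (cabs y) => u v; rewrite -subr_ge0.
rewrite (_ : _ - _ = s^-1 * (s * u - v) ^+ 2); first by rewrite mulr_ge0 ?sqr_ge0 ?invr_ge0 ?ltW.
by field; rewrite gt_eqF.
Qed.

(** On the smaller disk the partial sums converge uniformly, so their energy is almost that of the
    function; r^(2n) >= r^(2N) for n < N. *)
Lemma en_fnD_ge_disc a B r N : hseq a -> 0 < r < 1 -> (en D (fun p => fnD a (toC p)) <= B%:E)%E ->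
  area r * r ^+ (2 * N) * (\sum_(n < N) wt0 n * cabs (a n) ^+ 2) <= B.
Proof.
move=> ha /andP[r0 r1] fB; have mr := @measurable_dsk R r.
have B0 : 0 <= B by rewrite -lee_fin; apply: le_trans fB; exact: en_ge0.
have J0 := area_ge0 r.
apply/ler_addgt0Pr => e e0.
(* The final error s I + (s^2 + s) area r is at most s (B + 2 area r), hence at most e. *)
pose s := Num.min 1 (e / (B + 2 * area r + 1)).
have Q0 : 0 < B + 2 * area r + 1 by rewrite ltr_wpDl // addr_ge0 // mulr_ge0.
have s0 : 0 < s by rewrite lt_min ltr01 divr_gt0.
have s1 : s <= 1 by rewrite ge_min lexx.
have se : s * (B + 2 * area r + 1) <= e by rewrite -ler_pdivlMr // ge_min lexx orbT.
have r'01 : 0 < (1 + r) / 2 < 1 by lra.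
have [M hM] := ha _ r'01; move: r'01 hM; set r' := (1 + r) / 2 => r'01 hM.
have r'0 : 0 < r' by case/andP: r'01.
have rr' : r < r' by rewrite /r'; lra.
have M0 : 0 <= M by apply: le_trans (hM 0%N); rewrite mulr_ge0 ?cabs_ge0 ?exprn_ge0 ?ltW.
have q0 : 0 <= r / r' by rewrite divr_ge0 ?ltW.
have q1 : r / r' < 1 by rewrite ltr_pdivrMr // mul1r.
have [K NK hK] : exists2 K, (N <= K)%N & M / (1 - r / r') * (r / r') ^+ K <= s.
  have : (fun k => M / (1 - r / r') * (r / r') ^+ k) @ \oo --> (0 : R).
    by rewrite -[X in _ --> X](mulr0 (M / (1 - r / r'))); apply: cvgMr; apply: cvg_expr; rewrite ger0_norm.
  move=> /cvgrPdist_le/(_ _ s0)[K0 _ hK0]; exists (K0 + N)%N; first exact: leq_addl.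
  have := hK0 (K0 + N)%N (leq_addr _ _); rewrite /= sub0r normrN; apply: le_trans; exact: ler_norm.
have near p : dsk r p -> cabs (Sp a K p - fnD a (toC p)) <= s.
  rewrite dskP ?(ltW r0) // => pr; apply: le_trans hK.
  have p1 : cabs (toC p) < 1 by apply: lt_trans r1.
  have pr' : cabs (toC p) < r' by apply: lt_trans rr'.
  rewrite cabsB; apply: (le_trans (ps_tail r'0 hM pr' (fnD_cvg ha p1) K)).
  have pq : cabs (toC p) / r' <= r / r' by rewrite ler_wpM2r ?invr_ge0 ?(ltW r'0) // ltW.
  have p0 : 0 <= cabs (toC p) / r' by rewrite divr_ge0 ?cabs_ge0 ?(ltW r'0).
  apply: ler_pM.
  - by rewrite divr_ge0 // subr_ge0; apply: ltW; exact: le_lt_trans q1.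
  - exact: exprn_ge0.
  - rewrite ler_wpM2l // lef_pV2 ?posrE ?subr_gt0 //; first by rewrite lerD2l lerN2.
    exact: le_lt_trans q1.
  - by apply: lerXn2r; rewrite ?nnegrE.
have sub : dsk r `<=` D.
  by move=> p; rewrite !dskP ?ler01 ?(ltW r0) // => h; exact: lt_trans r1.
have mf := cmeas_fnD ha.
have mfr : cmeas (dsk r) (fun p => fnD a (toC p)).
  by case: mf => m1 m2; split; [exact: measurable_funS m1|exact: measurable_funS m2].
have fBr : (en (dsk r) (fun p => fnD a (toC p)) <= B%:E)%E.
  apply: le_trans fB; apply: ge0_subset_integral => //.
    by apply/measurable_EFinP; exact: cmeas_cabs2.
  by move=> p _; rewrite lee_fin sqr_ge0.
have iF := en_integrable mr mfr (le_lt_trans fBr (ltry _)).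
have SE := en_Sp a K r0.
have iS : mu2.-integrable (dsk r) (EFin \o (fun p => cabs (Sp a K p) ^+ 2)).
  by apply: en_integrable => //; [exact: cmeas_Sp|rewrite SE ltry].
pose I := Rintegral mu2 (dsk r) (fun p => cabs (fnD a (toC p)) ^+ 2).
have IB : I <= B by rewrite -lee_fin /I /Rintegral fineK //; exact: integrable_fin_num iF.
have ic : mu2.-integrable (dsk r) (EFin \o (fun=> (1 + s^-1) * s ^+ 2)).
  apply: measurable_bounded_integrable => //; first exact: mu2_dsk_fin.
  exists `|(1 + s^-1) * s ^+ 2|; split; first exact: num_real.
  by move=> x Mx p _ /=; exact: ltW.
have iZ : mu2.-integrable (dsk r) (EFin \o (fun p => (1 + s) * cabs (fnD a (toC p)) ^+ 2)).
  by rewrite /comp; under eq_fun do rewrite EFinM; exact: integrableZl.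
have L : Rintegral mu2 (dsk r) (fun p => cabs (Sp a K p) ^+ 2) <=
    (1 + s) * I + (1 + s^-1) * s ^+ 2 * area r.
  rewrite /I -RintegralZl // /area -Rintegral_cst // -RintegralD //; apply: le_Rintegral => //.
    by rewrite /comp; under eq_fun do rewrite EFinD; exact: integrableD.
  move=> p pr; rewrite -[Sp a K p](subrK (fnD a (toC p))) addrC.
  apply: (le_trans (sqr_cabsD_le _ _ s0)); rewrite lerD2l ler_wpM2l ?addr_ge0 ?invr_ge0 ?(ltW s0) //.
  by apply: lerXn2r; rewrite ?nnegrE ?cabs_ge0 ?(ltW s0) //; exact: near.
have LE : Rintegral mu2 (dsk r) (fun p => cabs (Sp a K p) ^+ 2) =
    area r * \sum_(n < K) r ^+ (2 * n) * (wt0 n * cabs (a n) ^+ 2).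
  by rewrite /Rintegral -[X in fine X]/(en (dsk r) (Sp a K)) SE.
rewrite LE in L.
apply: (@le_trans _ _ ((1 + s) * I + (1 + s^-1) * s ^+ 2 * area r)); last first.
  rewrite (_ : (1 + s^-1) * s ^+ 2 = s ^+ 2 + s); last by field; rewrite gt_eqF.
  have : s ^+ 2 <= s by rewrite expr2 ler_piMr // ltW.
  have : s * I <= s * B by rewrite ler_wpM2l // ltW.
  move: se; rewrite !mulrDr mulr1 => se h1 h2.
  have h3 : s ^+ 2 * area r <= s * area r by rewrite ler_wpM2r.
  rewrite !mulrDl mul1r; move: h1 h3 se; rewrite mulrCA.
  by move: (s ^+ 2 * area r) (s * area r) (s * I) (s * B) => x1 x2 x3 x4; lra.
apply: le_trans L; rewrite -mulrA ler_wpM2l // mulr_sumr.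
rewrite -(subnKC NK) big_split_ord /=.
have t0 n : 0 <= wt0 n * cabs (a n) ^+ 2 by rewrite mulr_ge0 ?sqr_ge0 // ltW // wt_gt0.
rewrite -[leLHS]addr0; apply: lerD; last by apply: sumr_ge0 => i _; rewrite mulr_ge0 ?exprn_ge0 ?(ltW r0).
apply: ler_sum => n _; apply: ler_wpM2r => //.
by apply: ler_wiXn2l; rewrite ?(ltW r0) ?(ltW r1) // leq_mul2l /= ltnW.
Qed.

Lemma en_fnD_ge a B N : hseq a -> (en D (fun p => fnD a (toC p)) <= B%:E)%E ->
  a1 * (\sum_(n < N) wt0 n * cabs (a n) ^+ 2) <= B.
Proof.
move=> ha fB; set S := \sum_(n < N) _.
have inv0 : (fun k => k.+2%:R^-1 : R) @ \oo --> (0 : R).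
  by rewrite (cvg_shiftS (fun k => k.+1%:R^-1 : R)); exact: cvg_harmonic.
have h1 : (fun k => (1 - k.+2%:R^-1 : R)) @ \oo --> (1 : R).
  by rewrite -[X in _ --> X](subr0 (1 : R)); apply: cvgB => //; exact: cvg_cst.
have hX j : (fun k => (1 - k.+2%:R^-1 : R) ^+ j) @ \oo --> (1 : R).
  elim: j => [|j IH]; first by under eq_fun do rewrite expr0; exact: cvg_cst.
  rewrite (_ : (fun k : nat => (1 - k.+2%:R^-1 : R) ^+ j.+1) =
    (fun k => 1 - k.+2%:R^-1) \* (fun k => (1 - k.+2%:R^-1) ^+ j)); last by apply/funext => k; rewrite exprS.
  by rewrite -[X in _ --> X](mulr1 (1 : R)); exact: cvgM h1 IH.
have L : (fun k => area (1 - k.+2%:R^-1 : R) * (1 - k.+2%:R^-1) ^+ (2 * N) * S) @ \oo --> a1 * 1 * S.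
  by apply: cvgMl; apply: cvgM => //; exact: area_cvg.
rewrite mulr1 in L; rewrite -(cvg_lim _ L) //; apply: limr_le; first by apply/cvg_ex; eexists; exact: L.
near=> k; apply: en_fnD_ge_disc => //.
have : (0 : R) < k.+2%:R^-1 < (1 : R) by rewrite invr_gt0 ltr0n /= invf_lt1 ?ltr0n // ltr1n.
by move: (_^-1) => u /andP[]; lra.
Unshelve. all: by end_near. Qed.

End Bergman.

(** * The Toeplitz operator on the Bergman space *)

Section Transfer.
Variable R : realType.
Local Notation C := R[i].
Local Notation cabs := (cabs R).
Local Notation toC := (toC R).
Local Notation T := (measurableTypeR R * measurableTypeR R)%type.
Local Notation mu2 := (@mu2 R).
Local Notation wt0 := (@wt R 0).
Local Notation D := (@dsk R 1).
Local Notation a1 := (area (1 : R)).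
Local Notation en := (@en R).
Implicit Types (a b : nat -> C) (r : R) (u v : T -> C) (z : C) (f g h : C -> C).

Let mD := @measurable_dsk R 1.
Let w0 := @wt_gt0 R 0.

Lemma nb_dom a b M : (forall n, cabs (b n) <= cabs (a n)) -> nb wt0 a M -> nb wt0 b M.
Proof.
move=> ba [M0 hM]; split => // N; apply: le_trans (hM N); apply: ler_sum => n _.
by rewrite ler_wpM2l ?(ltW (w0 n)) //; apply: lerXn2r; rewrite ?nnegrE ?cabs_ge0.
Qed.

Lemma opb_toep (p : {poly C}) lam : exists2 c, 0 < c & opb wt0 (toep p lam) c.
Proof.
have [cp cp0 hp] := opb_mulp 0 p.
pose s : R := Num.sqrt (1 + 1%:R^-1).
have s0 : 0 < s by rewrite sqrtr_gt0 addr_gt0 // invr_gt0.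
have l0 : 0 < cabs lam + 1 by rewrite ltr_wpDl // cabs_ge0.
exists (s + cp + (cabs lam + 1)) => [|a M ha]; first by rewrite addr_gt0 // addr_gt0.
rewrite !mulrDl; apply: nbB => //; last by rewrite -mulrDl; apply: nbZ => //; lra.
apply: nbD => //; last exact: hp.
apply: nb_dom (opb_shiftL ha) => n; rewrite cabsM /shiftL ler_piMl ?cabs_ge0 //.
by rewrite cabsM cabsV !cabs_nat ler_pdivrMr ?ltr0n // mul1r ler_nat.
Qed.

Lemma nb_poly (p : {poly C}) : exists M, nb wt0 (fun n => p`_n) M.
Proof.
have [c c0 hc] := opb_mulp 0 p; exists (c * (1 + wt0 0)).
have := hc _ _ (nb_delta w0 0%N); rewrite (_ : (fun n => (n == 0)%:R) = fun n => (1 : {poly C})`_n).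
  by rewrite mulp_poly mulr1.
by apply/funext => n; rewrite coef1.
Qed.

Lemma fnD_shift a z : hseq a -> cabs z < 1 -> fnD (mulp 'X a) z = z * fnD a z.
Proof.
move=> ha z1; apply: fnD_unique => //.
  rewrite mulpX => r r01; have [M hM] := ha r r01; exists M.
  have /andP[r0 r1] := r01.
  have M0 : 0 <= M by apply: le_trans (hM 0%N); rewrite mulr_ge0 ?cabs_ge0 ?exprn_ge0 ?ltW.
  case=> [|n]; first by rewrite cabs0 mul0r.
  rewrite exprS mulrCA; apply: (@le_trans _ _ (1 * M)); last by rewrite mul1r.
  by apply: ler_pM; rewrite ?mulr_ge0 ?cabs_ge0 ?exprn_ge0 // ltW.
rewrite /psc /ccvg -(cvg_shiftS (fun N => cabs (\sum_(n < N) mulp 'X a n * z ^+ n - z * fnD a z))).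
rewrite (_ : [sequence _]_n = fun N => cabs (z * (\sum_(n < N) a n * z ^+ n) - z * fnD a z)).
  by apply: ccvgZ; exact: fnD_cvg.
apply/funext => N /=; rewrite big_ord_recl mulpX /= mul0r add0r mulr_sumr.
by congr (cabs (_ - _)); apply: eq_bigr => i _; rewrite exprS mulrCA.
Qed.

Lemma fnD0 z : fnD (fun=> 0) z = 0 :> C.
Proof.
have [z1|z1] := ltP (cabs z) 1; last by rewrite fnD_out.
apply: fnD_unique => //; first by move=> r _; exists 0 => n; rewrite cabs0 mul0r.
rewrite /psc (_ : (fun N => _) = fun=> 0); first exact: ccvg_cst.
by apply/funext => N; rewrite big1 // => n _; rewrite mul0r.
Qed.

Lemma fnD_mulp (p : {poly C}) a M z : nb wt0 a M -> cabs z < 1 -> fnD (mulp p a) z = p.[z] * fnD a z.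
Proof.
move=> ha z1; elim/poly_ind: p => [|p c IH].
  rewrite horner0 mul0r (_ : mulp 0 a = fun=> 0) ?fnD0 //.
  by rewrite -[0]/(0%:P) mulpC; apply/funext => n; rewrite mul0r.
have [cp _ hp] := opb_mulp 0 p; have hpa := hseq_nb (hp _ _ ha).
rewrite addrC mulpDl mulpC (mulrC p) mulpM (fnD_lin c (hseq_nb ha)); last first.
  by have [cX _ hX] := opb_mulp 0 ('X : {poly C}); exact: hseq_nb (hX _ _ (hp _ _ ha)).
by rewrite fnD_shift // IH hornerD hornerC hornerM hornerX mulrDl mulrA.
Qed.

Lemma disk2E : disk2 R = D.
Proof. by apply/seteqP; split => p; rewrite /disk2 /dsk /= expr1n. Qed.

Definition pull f : T -> C := fun p => f (toC p).

Lemma L2D_en f : L2D R f <-> cmeas D (pull f) /\ (en D (pull f) < +oo)%E.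
Proof.
rewrite /L2D disk2E; split.
  move=> [m1 [m2 i]]; split; first by split; [exact: m1|exact: m2].
  have : mu2.-integrable D (fun p => (cabs (f (toC p)) ^+ 2)%:E) by exact: i.
  move=> /integrableP[_]; apply: le_lt_trans; rewrite /en le_eqVlt; apply/orP; left; apply/eqP.
  by apply: eq_integral => p _; rewrite /= ger0_norm ?sqr_ge0.
move=> [m e]; have [m1 m2] := m; split; first exact: m1.
by split; [exact: m2|exact: (en_integrable mD m e)].
Qed.

Lemma innerE f g : inner R f g = cint D (fun p => pull f p * conjc (pull g p)) / (pi%:C)%C.
Proof.
rewrite /inner /dA_int disk2E -fmorphV.
by rewrite /cint; set x := Rintegral _ _ _; set y := Rintegral _ _ _; simpc.
Qed.

Lemma L2a_fnD f : L2a R f <-> exists a M, nb wt0 a M /\ f = fnD a.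
Proof.
split.
  move=> [/L2D_en[m e] [df f0]].
  have [a ha fE] : exists2 a, hseq a & f = fnD a.
    by apply: taylor => // z z1; apply/derivable_cdiff; exact: df.
  have [B hB] : exists B, (en D (pull f) <= B%:E)%E.
    by exists (fine (en D (pull f))); rewrite fineK // ge0_fin_numE // en_ge0.
  have B0 : 0 <= B by rewrite -lee_fin; apply: le_trans hB; exact: en_ge0.
  have J0 := @area1_gt0 R.
  (* The summand 1 keeps the bound positive when f = 0. *)
  exists a, (Num.sqrt (B / a1) + 1); split => //; split; first by rewrite ltr_wpDl // sqrtr_ge0.
  move=> N; apply: (@le_trans _ _ (B / a1)).
    by rewrite ler_pdivlMr // mulrC; apply: en_fnD_ge => //; rewrite -fE.
  have q0 : 0 <= B / a1 by rewrite divr_ge0 // ltW.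
  rewrite -{1}[B / a1]sqr_sqrtr //; apply: lerXn2r; rewrite ?nnegrE ?addr_ge0 ?sqrtr_ge0 //.
  by rewrite lerDl.
move=> [a [M [ha ->]]]; have hh := hseq_nb ha; split; [|split].
- apply/L2D_en; split; first exact: cmeas_fnD.
  exact: le_lt_trans (en_fnD_le ha) (ltry _).
- by move=> z z1; apply/derivable_cdiff; exact: cdiff_fnD.
- by move=> z; exact: fnD_out.
Qed.

(* The norm of the constant 1; that it equals 1, i.e. that the disk has area pi, is never
   needed. *)
Definition kap : R := Num.sqrt (a1 / pi).

Lemma kap_gt0 : 0 < kap.
Proof. by rewrite sqrtr_gt0 divr_gt0 ?area1_gt0 ?pi_gt0. Qed.

Lemma kap2 : kap ^+ 2 * pi = a1.
Proof.
rewrite sqr_sqrtr ?divr_ge0 ?area_ge0 ?pi_ge0 //.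
by rewrite divfK // gt_eqF // pi_gt0.
Qed.

Lemma normL2_sqr f a M : nb wt0 a M -> f = fnD a -> (en D (pull f) = (pi * normL2 R f ^+ 2)%:E)%E.
Proof.
move=> ha ->; have m := cmeas_fnD (hseq_nb ha).
have e := le_lt_trans (en_fnD_le ha) (ltry _).
have ef : en D (pull (fnD a)) \is a fin_num by rewrite ge0_fin_numE // en_ge0.
rewrite /normL2 /dA_int disk2E sqr_sqrtr.
  rewrite mulrC divfK ?gt_eqF ?pi_gt0 // -[LHS]fineK //.
by rewrite divr_ge0 ?pi_ge0 //; apply: Rintegral_ge0 => p _; exact: sqr_ge0.
Qed.

Lemma normL2_le a M : nb wt0 a M -> normL2 R (fnD a) <= kap * M.
Proof.
move=> ha; have M0 := nb_gt0 ha.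
rewrite -(@ler_pXn2r _ 2) ?nnegrE ?sqrtr_ge0 ?mulr_ge0 ?(ltW kap_gt0) ?(ltW M0) //.
have := en_fnD_le ha; rewrite (normL2_sqr ha erefl) lee_fin -kap2.
by rewrite (_ : kap ^+ 2 * pi * M ^+ 2 = pi * (kap * M) ^+ 2) ?ler_pM2l ?pi_gt0 //; ring.
Qed.

Lemma nb_normL2 a M0 M : nb wt0 a M0 -> 0 < M -> normL2 R (fnD a) <= kap * M -> nb wt0 a M.
Proof.
move=> ha M_gt0 h; split => // N.
have nf : (en D (pull (fnD a)) <= (a1 * M ^+ 2)%:E)%E.
  rewrite (normL2_sqr ha erefl) lee_fin -kap2 (_ : kap ^+ 2 * pi * M ^+ 2 = pi * (kap * M) ^+ 2); last by ring.
  rewrite ler_pM2l ?pi_gt0 //; apply: lerXn2r => //; rewrite nnegrE ?sqrtr_ge0 //.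
  by rewrite mulr_ge0 // ltW // kap_gt0.
have := en_fnD_ge N (hseq_nb ha) nf; by rewrite ler_pM2l // area1_gt0.
Qed.

Lemma eq_cint u v : (forall p, D p -> u p = v p) -> cint D u = cint D v.
Proof. by move=> uv; congr Complex; apply: eq_Rintegral => p; rewrite inE => /uv ->. Qed.

Lemma conjcM (x y : C) : conjc (x * y) = conjc x * conjc y.
Proof. exact: rmorphM. Qed.

Lemma cintg_pow u A n : cmeas D u -> (en D u <= A%:E)%E -> cintg D (fun p => u p * conjc (toC p ^+ n)).
Proof.
move=> mu uA; have [B hB] := en_lt_Sp (fun k => (k == n)%:R : C) n.+1.
have [+ _] := cintg_pair mu (cmeas_Sp D _ n.+1) uA hB.
by under eq_fun do rewrite Sp_delta.
Qed.

(** Density of polynomials: a pairing with a Bergman function is the limit of pairings with its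
    partial sums, which the moments determine. *)
Lemma cint_pow_ext u v A B : cmeas D u -> cmeas D v -> (en D u <= A%:E)%E -> (en D v <= B%:E)%E ->
  (forall m, cint D (fun p => u p * conjc (toC p ^+ m)) = cint D (fun p => v p * conjc (toC p ^+ m))) ->
  forall b M, nb wt0 b M ->
    cint D (fun p => u p * conjc (fnD b (toC p))) = cint D (fun p => v p * conjc (fnD b (toC p))).
Proof.
move=> mu mv uA vB uv b M hb.
have pw u' A' N : cmeas D u' -> (en D u' <= A'%:E)%E ->
    cint D (fun p => u' p * conjc (Sp b N p)) = \sum_(n < N) conjc (b n) * cint D (fun p => u' p * conjc (toC p ^+ n)).
  move=> mu' uA'.
  have it n : cintg D (fun p => u' p * conjc (toC p ^+ n)) by exact: cintg_pow uA'.
  have itZ n := cintgZ (conjc (b n)) mD (it n).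
  rewrite (_ : (fun p => _) = fun p => \sum_(n < N) (fun n p => conjc (b n) * (u' p * conjc (toC p ^+ n))) n p).
    by rewrite (cintg_sum N mD itZ).2; apply: eq_bigr => n _; exact: cintZ.
  apply/funext => p; rewrite /Sp rmorph_sum mulr_sumr; apply: eq_bigr => n _.
  by rewrite [X in _ * X]conjcM mulrCA.
apply/eqP; rewrite -subr_eq0 -cabs_eq0 eq_le cabs_ge0 andbT; apply/ler_addgt0Pl => e e0; rewrite addr0.
have e20 : 0 < e / 2 by rewrite divr_gt0.
have [N0 hN0] := cint_fnD_lim mu uA hb e20; have [N1 hN1] := cint_fnD_lim mv vB hb e20.
have := hN0 _ (leq_addr N1 N0); have := hN1 _ (leq_addl N0 N1).
rewrite (pw v B) // (pw u A) //; under eq_bigr do rewrite -uv.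
set s := \sum_(_ < _) _; set x := cint _ _; set y := cint _ _ => hy hx.
rewrite (_ : y - x = (y - s) - (x - s)); last by ring.
apply: (le_trans (cabsD _ _)); rewrite cabsN; move: hx hy.
by move: (cabs (x - s)) (cabs (y - s)) => p q; lra.
Qed.

Lemma fnD_delta n z : cabs z < 1 -> fnD (fun k => (k == n)%:R) z = z ^+ n.
Proof.
move=> z1; apply: fnD_unique => //; first exact: hseq_nb (nb_delta w0 n).
apply: (@ccvg_near _ (fun=> z ^+ n) _ _ n.+1); last exact: ccvg_cst.
by move=> N nN; rewrite sum_delta.
Qed.

(** Pairing conj(z) f with z^m is pairing f with z^(m+1), which yields a_(m+1) times the weight
    ratio (m+1)/(m+2). The explicit function thus has the defining property of the projection. *)
Lemma toeplitz_fnD (q : {poly C}) a M : nb wt0 a M ->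
  toeplitz R (fun z => conjc z + q.[z]) (fnD a) = fnD (toep q 0 a).
Proof.
move=> ha; have [c _ hc] := opb_toep q 0; have hT := hc _ _ ha.
have [cq _ hq] := opb_mulp 0 q; have hqa := hq _ _ ha.
have ea := en_fnD_le ha; have eqa := en_fnD_le hqa; have eT := en_fnD_le hT.
have ma := cmeas_fnD (hseq_nb ha); have mqa := cmeas_fnD (hseq_nb hqa); have mT := cmeas_fnD (hseq_nb hT).
pose u p := conjc (toC p) * fnD a (toC p) + fnD (mulp q a) (toC p).
have uE : pull (fun z => (conjc z + q.[z]) * fnD a z) = u.
  apply/funext => p; rewrite /pull /u; have [p1|p1] := ltP (cabs (toC p)) 1.
    by rewrite (fnD_mulp _ ha) // mulrDl.
  by rewrite !fnD_out // !mulr0 addr0.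
have mc : cmeas D (fun p => conjc (toC p)) by apply: cmeas_conj; exact: cmeas_toC.
have m1 : cmeas D (fun p => conjc (toC p) * fnD a (toC p)) by exact: cmeasM.
have mu : cmeas D u by exact: cmeasD.
have [A eu] : exists A, (en D u <= A%:E)%E.
  pose G p := 2 * cabs (fnD a (toC p)) ^+ 2 + 2 * cabs (fnD (mulp q a) (toC p)) ^+ 2.
  have iG : mu2.-integrable D (EFin \o G).
    have Z (x : R) (f : T -> R) : mu2.-integrable D (EFin \o f) -> mu2.-integrable D (EFin \o (fun p => x * f p)).
      by move=> fi; rewrite /comp; under eq_fun do rewrite EFinM; exact: integrableZl.
    rewrite /comp /G; under eq_fun do rewrite EFinD.
    by apply: integrableD => //; apply: Z; apply: en_integrable => //; [exact: le_lt_trans ea (ltry _)|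
      exact: le_lt_trans eqa (ltry _)].
  have bG p : D p -> cabs (u p) ^+ 2 <= G p.
    rewrite dskP ?ler01 // => p1; apply: (le_trans (sqr_cabsD_le _ _ ltr01)).
    rewrite invr1 -[1 + 1]/(2%:R) lerD2r ler_pM2l //.
    apply: lerXn2r; rewrite ?nnegrE ?cabs_ge0 // cabsM cabsJ ler_piMl ?cabs_ge0 //; exact: ltW.
  exists (fine (\int[mu2]_(p in D) (EFin \o G) p)); rewrite fineK; last exact: integrable_fin_num.
  apply: ge0_le_integral => //.
  - by move=> p _; rewrite lee_fin sqr_ge0.
  - by apply/measurable_EFinP; exact: cmeas_cabs2.
  - by case/integrableP: iG.
have key m : cint D (fun p => u p * conjc (toC p ^+ m)) =
    cint D (fun p => fnD (toep q 0 a) (toC p) * conjc (toC p ^+ m)).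
  have iz b M' n : nb wt0 b M' -> cintg D (fun p => fnD b (toC p) * conjc (toC p ^+ n)).
    by move=> hb; exact: (cintg_pow n (cmeas_fnD (hseq_nb hb)) (en_fnD_le hb)).
  rewrite (cint_fnD_zpow _ hT) (_ : (fun p => _) = fun p => fnD a (toC p) * conjc (toC p ^+ m.+1) +
      fnD (mulp q a) (toC p) * conjc (toC p ^+ m)).
    rewrite (cintD mD (iz _ _ _ ha) (iz _ _ _ hqa)) (cint_fnD_zpow _ ha) (cint_fnD_zpow _ hqa).
    rewrite /toep mul0r subr0 mulrDl; congr (_ + _).
    rewrite /wt !addn1 !rmorphM !fmorphV !rmorph_nat.
    have [u0 v0] : (m.+1%:R != 0 :> C) /\ (m.+2%:R != 0 :> C) by rewrite !pnatr_eq0.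
    by move: (m.+1%:R : C) (m.+2%:R : C) u0 v0 => x y x0 y0; field; rewrite x0 y0.
  apply/funext => p; rewrite /u mulrDl exprS conjcM; congr (_ + _); ring.
have S0 : L2a R (fnD (toep q 0 a)) /\ forall h, L2a R h ->
    inner R (fun z => (conjc z + q.[z]) * fnD a z) h = inner R (fnD (toep q 0 a)) h.
  split; first by apply/L2a_fnD; exists (toep q 0 a), (c * M).
  move=> h /L2a_fnD[b [M' [hb ->]]]; rewrite !innerE uE; congr (_ / _).
  exact: (cint_pow_ext mu mT eu eT key hb).
(* The explicit candidate rules out the default of [xget]; whichever function is chosen has the same
   coefficients, read off by pairing with monomials. *)
rewrite /toeplitz /bergman_proj; case: xgetP => [g _ [Lg hg]|/(_ _ S0) //].
have [g' [M' [hg' gE]]] := (L2a_fnD g).1 Lg.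
rewrite gE; congr fnD; apply/funext => m.
have Ld : L2a R (fnD (fun k => (k == m)%:R)) by apply/L2a_fnD; do 2 eexists; split; first exact: nb_delta.
have dE b M'' : nb wt0 b M'' -> inner R (fnD b) (fnD (fun k => (k == m)%:R)) = b m * (a1 * wt0 m)%:C%C / pi%:C%C.
  move=> hb; rewrite innerE -(cint_fnD_zpow _ hb); congr (_ / _); apply: eq_cint => p.
  by rewrite dskP ?ler01 // => p1; rewrite /pull fnD_delta.
have := S0.2 _ Ld; rewrite (hg _ Ld) gE (dE _ _ hg') (dE _ _ hT) => /mulIf h1.
have pi0 : (pi%:C%C : C)^-1 != 0 by rewrite invr_eq0 -cabs_eq0 cabs_real normr_eq0 gt_eqF // pi_gt0.
have w1 : ((a1 * wt0 m)%:C%C : C) != 0.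
  by rewrite -cabs_eq0 cabs_real normr_eq0 gt_eqF // mulr_gt0 // area1_gt0.
exact: (mulIf w1 (h1 pi0)).
Qed.

End Transfer.

(** * The spectrum *)

Section Spectrum.
Variable R : realType.
Local Notation C := R[i].
Local Notation cabs := (cabs R).
Local Notation wt0 := (@wt R 0).
Local Notation spec q := (toeplitz_spectrum R (fun z => conjc z + q.[z])).
Implicit Types (a b : nat -> C) (q : {poly C}).

Let w0 := @wt_gt0 R 0.

Lemma toeplitz_sub_fnD q lam a M : nb wt0 a M ->
  (fun z => toeplitz R (fun z => conjc z + q.[z]) (fnD a) z - lam * fnD a z) = fnD (toep q lam a).
Proof.
move=> ha; have [c _ hc] := opb_toep q 0.
rewrite (toeplitz_fnD q ha) (_ : toep q lam a = fun n => - lam * a n + toep q 0 a n).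
  rewrite (fnD_lin _ (hseq_nb ha) (hseq_nb (hc _ _ ha))).
  by apply/funext => z; rewrite mulNr addrC.
by apply/funext => n; rewrite /toep; ring.
Qed.

Lemma fnD_nb_inj a b M M' : nb wt0 a M -> nb wt0 b M' -> fnD a = fnD b -> a = b.
Proof. by move=> ha hb ab; apply: (fnD_inj (hseq_nb ha) (hseq_nb hb)) => z _; rewrite ab. Qed.

Lemma nb_normL2_eps a M e : nb wt0 a M -> 0 < e -> nb wt0 a (normL2 R (fnD a) / kap R + e).
Proof.
move=> ha e0; have k0 := kap_gt0 R; apply: (nb_normL2 ha).
  by rewrite ltr_wpDl // divr_ge0 ?sqrtr_ge0 // ltW.
by rewrite mulrDr mulrC divfK ?gt_eqF // lerDl mulr_ge0 // ltW.
Qed.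

Lemma bij_invertible q lam c : bij_bound wt0 (toep q lam) c ->
  invertible_op R (fun f z => toeplitz R (fun z => conjc z + q.[z]) f z - lam * f z).
Proof.
move=> hL; have [_ _ c0 _ _] := hL; have [G hG] := bij_inverse w0 hL.
have [cT _ hT] := opb_toep q lam; have k0 := kap_gt0 R.
(* [cf] recovers the coefficient sequence of a Bergman function, unique by [fnD_nb_inj]; elsewhere
   it is 0. *)
pose cf f := xget (fun=> 0) [set a | (exists M, nb wt0 a M) /\ f = fnD a].
have cfE a M : nb wt0 a M -> cf (fnD a) = a.
  move=> ha; rewrite /cf; case: xgetP => [b _ [[M' hb] ab]|/(_ a)].
    by apply/esym; exact: (fnD_nb_inj ha hb).
  by case; split => //; exists M.
exists (fun f => fnD (G (cf f))); split.
  exists c => f /L2a_fnD[a [M [ha ->]]]; rewrite (cfE _ _ ha); split.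
    by apply/L2a_fnD; do 2 eexists; split; [exact: (hG _ _ ha).1|].
  (* Since [nb] asks for a positive bound, the norm is enlarged by e/(kap c), which costs exactly
     e. *)
  apply/ler_addgt0Pr => e e0.
  have e0' : 0 < e / (kap R * c) by rewrite divr_gt0 // mulr_gt0.
  have h := hG _ _ (nb_normL2_eps ha e0'); apply: (le_trans (normL2_le h.1)).
  rewrite le_eqVlt; apply/orP; left; apply/eqP.
  by move: (normL2 _ _) => x; field; rewrite !gt_eqF.
move=> f /L2a_fnD[a [M [ha ->]]]; rewrite (cfE _ _ ha) (toeplitz_sub_fnD _ _ ha) (cfE _ _ (hT _ _ ha)).
have [hGa hLG] := hG _ _ ha; rewrite (toeplitz_sub_fnD _ _ hGa) hLG; split => //.
have [hGT hLGT] := hG _ _ (hT _ _ ha).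
by congr fnD; exact: (bij_bound_inj w0 hL hGT ha hLGT).
Qed.

Lemma spec_not_surj q lam a M : nb wt0 a M ->
  (forall b M', nb wt0 b M' -> toep q lam b <> a) -> spec q lam.
Proof.
move=> ha nsurj [B [[c hB] hBA]].
have La : L2a R (fnD a) by apply/L2a_fnD; exists a, M.
have [_ hA] := hBA _ La; have [LB _] := hB _ La.
have [b [M' [hb bE]]] := (L2a_fnD _).1 LB.
move: hA; rewrite bE (toeplitz_sub_fnD _ _ hb) => h.
have [cT _ hT] := opb_toep q lam.
exact: (nsurj _ _ hb (fnD_nb_inj (hT _ _ hb) ha h)).
Qed.

Lemma spec_approx q lam :
  (forall e, 0 < e -> exists a, [/\ nb wt0 a 1, nb wt0 (toep q lam a) e &
    exists N, 1 / 2 <= \sum_(n < N) wt0 n * cabs (a n) ^+ 2]) -> spec q lam.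
Proof.
move=> happ [B [[c hB] hBA]]; have k0 := kap_gt0 R.
pose K := `|c| + 1; have K0 : 0 < K by rewrite ltr_wpDl.
(* An inverse of norm at most K would bound the sequence by 1/2, so its squared norm by 1/4, against
   the lower bound 1/2. *)
have e0 : 0 < (2 * K)^-1 by rewrite invr_gt0 mulr_gt0.
have [a [ha hTa [N hN]]] := happ _ e0.
have La : L2a R (fnD a) by apply/L2a_fnD; exists a, 1.
have LT : L2a R (fnD (toep q lam a)) by apply/L2a_fnD; do 2 eexists; split; [exact: hTa|].
have [hBa _] := hBA _ La; have [_ nB] := hB _ LT.
rewrite (toeplitz_sub_fnD _ _ ha) in hBa; rewrite hBa in nB.
have h : normL2 R (fnD a) <= kap R * 2^-1.
  apply: (le_trans nB); apply: (@le_trans _ _ (K * normL2 R (fnD (toep q lam a)))).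
    by rewrite ler_wpM2r ?sqrtr_ge0 // (le_trans (ler_norm _)) // lerDl.
  apply: (le_trans (ler_wpM2l (ltW K0) (normL2_le hTa))).
  by rewrite le_eqVlt; apply/orP; left; apply/eqP; field; rewrite gt_eqF.
have i0 : (0 : R) < 2^-1 by rewrite invr_gt0.
have [_ /(_ N)] := nb_normL2 ha i0 h.
move/(le_trans hN); rewrite div1r exprVn lef_pV2 ?posrE ?exprn_gt0 //.
by rewrite -natrX ler_nat.
Qed.

End Spectrum.

(** An isolated point is both open and closed in S, and mu lies outside it. *)
Lemma not_connected_isolated (R : realType) (S : set R[i]) (lam mu : R[i]) :
  isolated_point R S lam -> S mu -> mu != lam -> ~ connected (S : set (R[i])^o).
Proof.
move=> [Sl [e [e0 he]]] Smu mul conn.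
have h : [set lam] = S.
  apply: (conn [set lam]).
  - by exists lam.
  - exists (ball (lam : R[i]^o) (e%:C%C)); first by apply: ball_open; rewrite ltcR.
    apply/seteqP; split => [z ->|z [Sz]]; first by split => //; apply: ballxx; rewrite ltcR.
    rewrite /ball /= normr_cabs ltcR cabsB => h; exact: he.
  - exists [set lam]; first exact/accessible_closed_set1/hausdorff_accessible/norm_hausdorff.
    by apply/seteqP; split => [z ->|z []].
by move: Smu; rewrite -h => /eqP; rewrite (negPf mul).
Qed.

Theorem theorem4p1 (R : realType) (k : nat) (hk : (2 < k)%N) :
  exists p : {poly R[i]},
    size p = k.+1 /\
    (exists lam : R[i],
        isolated_point R (toeplitz_spectrum R (fun z => conjc z + p.[z])) lam) /\
    ~ connected (toeplitz_spectrum R (fun z => conjc z + p.[z]) : set (R[i])^o).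
Proof.
have [p [t [r [m [sp [/andP[t0 t1] ir m0 rt hq] p1]]]]] := admissible_exists R hk.
have sq : (2 < size ((1 - (t^-1)%:C%C *: 'X) * r)%R)%N.
  have p0 : p != 0 by rewrite -size_poly_gt0 sp.
  have sX : size ('X * p) = k.+2 by rewrite mulrC size_mulX // sp.
  by rewrite -hq addrC size_polyDl sX ?size_poly1 // (ltn_trans hk) // ltnS leqnSn.
have [delta d0 hd] := toep_invertible t0 t1 ir m0 rt hq sq.
exists p; split => //.
have iso : isolated_point R (toeplitz_spectrum R (fun z => conjc z + p.[z])) 0.
  split.
    have [M hM] := nb_poly (('X - (t%:C%C)%:P) ^+ m).
    by apply: (spec_not_surj hM) => b M' hb; exact: (toep_not_surj t0 t1 m0 rt hq hb).
  exists delta; split => // mu Smu; rewrite subr0 => mud; apply/eqP/negPn/negP => mu0.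
  by have [c hc] := hd _ mu0 mud; exact: Smu (bij_invertible hc).
split; first by exists 0.
by apply: not_connected_isolated iso _ p1; apply: spec_approx => e e0; exact: toep_approx.
Qed.
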